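(* Let $\mathcal A$ be any $C^*$-algebra. Then the dual Banach space $\mathcal A^*$ is $1$-Plichko.
   Context: Let $X$ be a (real or complex) Banach space. A linear subspace $D\subset X^*$ is norming if $\|x\|_D=\sup\{|x^*(x)|: x^*\in D,\ \|x^*\|\le 1\}$ defines an equivalent norm on $X$; it is $1$-norming if $\|x\|_D=\|x\|$ for all $x\in X$. A norming linear subspace $D\subset X^*$ is a $\Sigma$-subspace of $X^*$ if there is a linearly dense set $M\subset X$ (i.e., a set whose linear span is dense in $X$) such that $D=\{x^*\in X^*: \{m\in M: x^*(m)\neq 0\}\text{ is countable}\}$, where ''countable'' means finite or countably infinite. $X$ is $1$-Plichko if $X^*$ admits a $1$-norming $\Sigma$-subspace. *)

(* Defs.v *)
From HB Require Import structures.
From mathcomp Require Import all_boot all_order all_algebra.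
From mathcomp Require Import complex.
From mathcomp Require Import all_classical all_reals topology normedtype.

Set Implicit Arguments.
Unset Strict Implicit.
Unset Printing Implicit Defensive.

Import Order.TTheory GRing.Theory Num.Theory numFieldNormedType.Exports.
Local Open Scope classical_set_scope.
Local Open Scope ring_scope.

(* The norm `|x| of a normed module over R[i] is an element of R[i] (a
   nonnegative real one); normR is the same number, in R, so that suprema can be
   taken. *)
Definition normR (R : realType) (V : normedModType R[i]) (x : V) : R :=
  complex.Re `|x|.

Section normR_theory.
Context {R : realType} {V : normedModType R[i]}.
Implicit Types x y : V.

Lemma normRE x : `|x| = ((normR x)%:C)%C.
Proof.
rewrite /normR; have := normr_ge0 x; rewrite lecE => /andP[/eqP/= Im0 _].
by rewrite [LHS]complexE Im0 mulr0 addr0.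
Qed.

Lemma normR_ge0 x : 0 <= normR x.
Proof. by rewrite -ler0c -normRE. Qed.

Lemma normRD x y : normR (x + y) <= normR x + normR y.
Proof. by rewrite -lecR rmorphD/= -!normRE ler_normD. Qed.

Lemma normRZ (k : R[i]) x : normR (k *: x) = normR (k : R[i]^o) * normR x.
Proof. by apply: complexI; rewrite rmorphM/= -!normRE normrZ. Qed.

Lemma normR0 : normR (0 : V) = 0.
Proof. by rewrite /normR normr0. Qed.

Lemma normR_eq0 x : normR x = 0 -> x = 0.
Proof. by move=> x0; apply: normr0_eq0; rewrite normRE x0. Qed.

Lemma normR_gt0 x : x != 0 -> 0 < normR x.
Proof.
move=> x0; rewrite lt_neqAle normR_ge0 andbT eq_sym.
by apply: contra x0 => /eqP/normR_eq0 ->.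
Qed.

Lemma le_normR x (r : R) : (normR x <= r) = (`|x| <= (r%:C)%C).
Proof. by rewrite normRE lecR. Qed.

End normR_theory.

Lemma complex_complete (R : realType) (F : set_system R[i]^o) :
  ProperFilter F -> cauchy F -> cvg F.
Proof.
move=> FF /cauchyP cF.
have part (p : R[i]^o -> R) : {morph p : x y / x - y} ->
    (forall z, ((`|p z|%:C)%C <= `|z|)) -> cvg (p @ F).
  move=> pB ple; apply: R_complete; apply/cauchyP => e e0.
  have [|z Fz] := cF ((e%:C)%C); first by rewrite ltcR.
  exists (p z); apply: (@filterS _ F _ _ _ _ Fz) => w; rewrite -!ball_normE/= => zw.
  by rewrite -ltcR; apply: le_lt_trans zw; rewrite -(pB z w) ple.
have /cvg_ex[/= a /cvgrPdist_lt aP] : cvg (@complex.Re R @ F).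
  by apply: part => [[? ?] [? ?]//|z]; exact: normc_ge_Re.
have /cvg_ex[/= b /cvgrPdist_lt bP] : cvg (@complex.Im R @ F).
  apply: part => [[? ?] [? ?]//|[x y]].
  by rewrite normc_def lecR/= -sqrtr_sqr ler_sqrt ?lerDr ?sqr_ge0 ?addr_ge0 ?sqr_ge0.
apply/cvg_ex; exists (a +i* b)%C; apply/cvgrPdist_lt => e e0.
have eE : e = ((complex.Re e)%:C)%C.
  by move: e0; case: (e) => x y; rewrite ltcE/= => /andP[/eqP-> _].
have e2 : 0 < complex.Re e / 2 by rewrite divr_gt0// -ltcR -eE.
apply: filterS2 (aP _ e2) (bP _ e2) => -[x y] /= ax byy.
rewrite [ltRHS]eE [complex.Re e]splitr rmorphD/=.
rewrite [X in `|X|]complexE (le_lt_trans (ler_normD _ _))// ltrD//.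
  by rewrite [X in X < _](_ : _ = (`|a - x|%:C)%C) ?ltcR// normc_def/= expr0n addr0 sqrtr_sqr.
rewrite normrM normc_def/= expr0n expr1n add0r sqrtr1 mul1r.
by rewrite [X in X < _](_ : _ = (`|b - y|%:C)%C) ?ltcR// normc_def/= expr0n addr0 sqrtr_sqr.
Qed.

Section dual.
Context {R : realType}.

Definition functional (X : normedModType R[i]) : {pred X -> R[i]^o} :=
  [pred f : X -> R[i]^o | `[< linear f /\ continuous f >]].

Record dual (X : normedModType R[i]) := Dual {
  dual_fun :> X -> R[i]^o ;
  dual_funP : dual_fun \in @functional X }.

HB.instance Definition _ X := [isSub for @dual_fun X].
HB.instance Definition _ X := [Choice of dual X by <:].

Section dual_lmodule.
Variable X : normedModType R[i].

Lemma functional_submod_closed : submod_closed (@functional X).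
Proof.
split=> [|k f g /asboolP[lf cf] /asboolP[lg cg]]; apply/asboolP; split.
- by move=> k x y; rewrite -![(0 : X -> R[i]^o) _]/(0 : R[i]^o) scaler0 addr0.
- by move=> x; exact: cvg_cst.
- move=> c x y; rewrite -![(k *: f + g) _]/(k *: f _ + g _).
  rewrite lf lg !scalerDr !scalerA (mulrC k) !addrA.
  by congr (_ + _); rewrite -!addrA; congr (_ + _); rewrite addrC.
- move=> x; apply: (@continuousD _ _ _ (k *: f) g); last exact: cg.
  exact: (@continuousZr _ _ _ f k x (cf x)).
Qed.

HB.instance Definition _ := GRing.isSubmodClosed.Build R[i] (X -> R[i]^o)
  (@functional X) functional_submod_closed.
HB.instance Definition _ := [SubChoice_isSubLmodule of dual X by <:].

Lemma dual_linear (f : dual X) : linear f.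
Proof. by have /asboolP[] := dual_funP f. Qed.

Lemma dual_continuous (f : dual X) : continuous f.
Proof. by have /asboolP[] := dual_funP f. Qed.

HB.instance Definition _ (f : dual X) :=
  GRing.isLinear.Build R[i] X R[i]^o _ f (dual_linear f).

Lemma dualP (f g : dual X) : (forall x, f x = g x) -> f = g.
Proof. by move=> fg; apply: val_inj; apply/funext. Qed.

Lemma dualDE (f g : dual X) x : (f + g) x = f x + g x.
Proof. by []. Qed.

Lemma dualBE (f g : dual X) x : (f - g) x = f x - g x.
Proof. by []. Qed.

Lemma dualZE (k : R[i]) (f : dual X) x : (k *: f) x = k *: f x.
Proof. by []. Qed.

Definition opnorm (f : dual X) : R :=
  sup [set normR (f x) | x in [set x : X | normR x <= 1]].

Lemma has_sup_opnorm (f : dual X) :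
  has_sup [set normR (f x) | x in [set x : X | normR x <= 1]].
Proof.
split; first by exists (normR (f 0)), 0 => //=; rewrite normR0 ler01.
have /linear_bounded_continuous/bounded_funP/(_ 1)[M fM] :=
  @dual_continuous f.
exists (complex.Re M) => _ [x /= x1 <-].
have /fM : `|x| <= 1 by rewrite le_normR in x1.
by rewrite lecE => /andP[].
Qed.

Lemma opnorm_ub (f : dual X) x : normR (f x) <= opnorm f * normR x.
Proof.
have [->|x0] := eqVneq x 0; first by rewrite linear0 !normR0 mulr0.
have nx := normR_gt0 x0.
pose k : R[i] := ((normR x)^-1%:C)%C.
have kE : normR (k : R[i]^o) = (normR x)^-1.
  apply: complexI; rewrite -normRE ger0_norm// ler0c invr_ge0; exact: normR_ge0.
rewrite -ler_pdivrMr// mulrC -kE -normRZ -linearZ/=.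
apply: ub_le_sup; first by have [] := has_sup_opnorm f.
by exists (k *: x) => //=; rewrite normRZ kE mulVf// gt_eqF.
Qed.

Lemma opnorm_le (f : dual X) (M : R) : 0 <= M ->
  (forall x, normR (f x) <= M * normR x) -> opnorm f <= M.
Proof.
move=> M0 fM; apply: ge_sup; first by have [] := has_sup_opnorm f.
move=> _ [x /= x1 <-]; apply: (le_trans (fM x)).
by rewrite -[leRHS]mulr1 ler_wpM2l.
Qed.

Lemma opnorm_ge0 (f : dual X) : 0 <= opnorm f.
Proof.
apply: le_trans (ub_le_sup _ _); first exact: (normR_ge0 (f 0)).
  by have [] := has_sup_opnorm f.
by exists 0 => //=; rewrite normR0 ler01.
Qed.

Definition dual_norm (f : dual X) : R[i] := ((opnorm f)%:C)%C.

Lemma dual_normD f g : dual_norm (f + g) <= dual_norm f + dual_norm g.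
Proof.
rewrite /dual_norm -rmorphD/= lecR; apply: opnorm_le => [|x].
  by rewrite addr_ge0 ?opnorm_ge0.
by rewrite mulrDl (le_trans (normRD _ _))// lerD ?opnorm_ub.
Qed.

Lemma dual_normZ_le k f :
  opnorm (k *: f) <= normR (k : R[i]^o) * opnorm f.
Proof.
apply: opnorm_le => [|x]; first by rewrite mulr_ge0 ?opnorm_ge0 ?normR_ge0.
by rewrite normRZ -mulrA ler_wpM2l ?normR_ge0 ?opnorm_ub.
Qed.

Lemma dual_norm0_eq0 f : dual_norm f = 0 -> f = 0.
Proof.
move=> [f0]; apply: dualP => x; apply: normR_eq0.
by apply/le_anti; rewrite normR_ge0 andbT (le_trans (opnorm_ub _ _))// f0 mul0r.
Qed.

Lemma dual_normZ k f : dual_norm (k *: f) = `|k| * dual_norm f.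
Proof.
have -> : `|k| = ((normR (k : R[i]^o))%:C)%C by rewrite -normRE.
rewrite /dual_norm -rmorphM/=; congr (_%:C)%C; apply/le_anti.
rewrite dual_normZ_le/=.
have [->|k0] := eqVneq k 0; first by rewrite normR0 mul0r opnorm_ge0.
have nk : 0 < normR (k : R[i]^o) by exact: normR_gt0.
have : opnorm f <= normR (k^-1 : R[i]^o) * opnorm (k *: f).
  by rewrite -[X in opnorm X <= _](scalerK k0) dual_normZ_le.
rewrite -(ler_pM2l nk) mulrA -normRZ/=.
suff -> : k *: (k^-1 : R[i]^o) = 1 by rewrite {2}/normR normr1 mul1r.
exact: mulfV.
Qed.

HB.instance Definition _ := @Lmodule_isNormed.Build R[i] (dual X)
  dual_norm dual_normD dual_normZ dual_norm0_eq0.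

Lemma normR_dual (f : dual X) : normR f = opnorm f.
Proof. by []. Qed.

End dual_lmodule.

Section dual_complete.
Variable X : normedModType R[i].

Lemma ler_dual (f : dual X) x : `|f x| <= `|f| * `|x|.
Proof. by rewrite !normRE -rmorphM lecR opnorm_ub. Qed.

Lemma dual_cauchy_eval (F : set_system (dual X)) x : ProperFilter F ->
  cauchy F -> cauchy ((fun f : dual X => f x) @ F).
Proof.
move=> FF /cauchyP cF; apply/cauchyP => e e0.
have x1 : 0 < `|x| + 1 by rewrite ltr_wpDl.
have [f Ff] := cF (e / (`|x| + 1)) (divr_gt0 e0 x1).
exists (f x); apply: (@filterS _ F _ _ _ _ Ff) => h; rewrite -!ball_normE/= => fh.
rewrite -dualBE (le_lt_trans (ler_dual _ _))//.
rewrite (@le_lt_trans _ _ (`|f - h| * (`|x| + 1)))//; last by rewrite -ltr_pdivlMr.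
by rewrite ler_wpM2l// lerDl.
Qed.

Lemma dual_complete (F : set_system (dual X)) :
  ProperFilter F -> cauchy F -> cvg F.
Proof.
move=> FF cF.
pose g x : R[i]^o := lim ((fun f : dual X => f x) @ F).
have gP x : (fun f : dual X => f x) @ F --> g x.
  by apply: complex_complete; exact: dual_cauchy_eval.
have lg : linear g.
  move=> k x y.
  apply: (@cvg_unique _ (@norm_hausdorff R[i] R[i]^o) _ _ _ _ (gP (k *: x + y))).
  rewrite (_ : (fun f : dual X => _) = (fun f => k *: f x + f y)); last first.
    by apply/funext => f; rewrite linearP.
  by apply: cvgD; [apply: cvgZr; exact: gP|exact: gP].
have gF (e : R[i]) : 0 < e ->
    \forall f \near F, forall x, `|g x - (f : dual X) x| <= e * `|x|.
  move=> e0; have e20 : 0 < e / 2 by rewrite divr_gt0.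
  have /cauchyP/(_ _ e20)[h Fh] := cF.
  have hg x : `|g x - h x| <= e / 2 * `|x|.
    apply/ler_addgt0Pr => d d0.
    have Fx : \forall f \near F, `|g x - (f : dual X) x| < d.
      by move/cvgrPdist_lt : (gP x); exact.
    have [f [/= gf]] := filter_ex (filterI Fx Fh).
    rewrite -ball_normE/= => hf; rewrite -[_ - h x](subrKA (f x)) addrC.
    rewrite (le_trans (ler_normD _ _))// lerD//; last exact: ltW.
    rewrite -dualBE (le_trans (ler_dual _ _))// ler_wpM2r//.
    by rewrite distrC ltW.
  apply: filterS Fh => f; rewrite -ball_normE/= => hf x.
  rewrite -[_ - f x](subrKA (h x)) [e]splitr mulrDl.
  rewrite (le_trans (ler_normD _ _))// lerD//.
  by rewrite -dualBE (le_trans (ler_dual _ _))// ler_wpM2r// ltW.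
pose lg' : {linear X -> R[i]^o} := HB.pack g (GRing.isLinear.Build _ _ _ _ _ lg).
have cg : continuous g.
  have [f fg] := filter_ex (gF 1 ltr01).
  apply: (@bounded_linear_continuous _ _ _ lg'); apply/bounded_funP => r.
  exists ((1 + `|f|) * r) => x xr; rewrite -[lg' x](subrK (f x)).
  rewrite (le_trans (ler_normD _ _))// mulrDl lerD//.
    by rewrite (le_trans (fg x))// ler_wpM2l.
  by rewrite (le_trans (ler_dual _ _))// ler_wpM2l.
have gdual : g \in @functional X by apply/asboolP.
apply/cvg_ex; exists (Dual gdual); apply/cvgrPdist_le => e e0.
apply: filterS (gF e e0) => f fg.
have eE : e = ((complex.Re e)%:C)%C.
  by move: e0; case: (e) => a b; rewrite ltcE/= => /andP[/eqP-> _].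
rewrite [leRHS]eE normRE lecR normR_dual; apply: opnorm_le.
  by rewrite -ler0c -eE ltW.
by move=> x; rewrite -lecR rmorphM/= -!normRE -eE; exact: fg.
Qed.

HB.instance Definition _ := Uniform_isComplete.Build (dual X) dual_complete.

End dual_complete.
End dual.

Section plichko.
Context {R : realType} (X : completeNormedModType R[i]).
Implicit Types (D : set (dual X)) (M : set X).

Definition linear_subspace D : Prop :=
  D 0 /\ forall (k : R[i]) (f g : dual X), D f -> D g -> D (k *: f + g).

Definition seminorm_of D (x : X) : R :=
  sup [set normR (f x) | f in [set f : dual X | D f /\ normR f <= 1]].

Definition equivalent_norm (N : X -> R) : Prop :=
  [/\ forall x y, N (x + y) <= N x + N y,
      forall (k : R[i]) x, N (k *: x) = normR (k : R[i]^o) * N x,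
      forall x, N x = 0 -> x = 0 &
      exists c C : R, [/\ 0 < c, 0 < C &
        forall x, c * normR x <= N x <= C * normR x]].

Definition norming D : Prop :=
  linear_subspace D /\ equivalent_norm (seminorm_of D).

Definition one_norming D : Prop :=
  linear_subspace D /\ forall x, seminorm_of D x = normR x.

Definition linear_span M : set X :=
  [set x | exists (n : nat) (k : 'I_n -> R[i]) (m : 'I_n -> X),
     (forall i, M (m i)) /\ x = \sum_(i < n) k i *: m i].

Definition linearly_dense M : Prop := dense (linear_span M).

Definition Sigma_subspace D : Prop :=
  norming D /\ exists M, linearly_dense M /\
    D = [set f : dual X | countable [set m | M m /\ f m != 0]].

Definition one_Plichko : Prop :=
  exists D, Sigma_subspace D /\ one_norming D.

End plichko.

(* A C*-algebra need not have a unit, hence the multiplication is not that of a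
   ring of the algebraic hierarchy. *)
HB.mixin Record isCStarAlgebra (R : realType) A
    & CompleteNormedModule R[i] A := {
  cmul : A -> A -> A ;
  cstar : A -> A ;
  cmulA : associative cmul ;
  cmulDl : left_distributive cmul +%R ;
  cmulDr : right_distributive cmul +%R ;
  cmulZl : forall (k : R[i]) a b, cmul (k *: a) b = k *: cmul a b ;
  cmulZr : forall (k : R[i]) a b, cmul a (k *: b) = k *: cmul a b ;
  ler_norm_cmul : forall a b, `|cmul a b| <= `|a| * `|b| ;
  cstarK : involutive cstar ;
  cstarD : {morph cstar : a b / a + b} ;
  cstarZ : forall (k : R[i]) a, cstar (k *: a) = k^* *: cstar a ;
  cstarM : forall a b, cstar (cmul a b) = cmul (cstar b) (cstar a) ;
  norm_cstar_cmul : forall a, `|cmul (cstar a) a| = `|a| ^+ 2 }.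

#[short(type="cstarAlgType")]
HB.structure Definition CStarAlgebra (R : realType) :=
  {A of CompleteNormedModule R[i] A & isCStarAlgebra R A}.

(* Main.v *)
From HB Require Import structures.
Require Import Defs.
From mathcomp Require Import all_boot all_order all_algebra finmap.
From mathcomp Require Import complex all_classical all_reals topology normedtype.
From mathcomp Require Import sequences ring lra.

(** Why the dual [A*] of a C*-algebra [A] is 1-Plichko.

    Let [H] be a Hilbert space on which [A] acts and in which every functional
    [f] on [A] is a vector functional [a |-> <a xi, eta>] with
    [|xi| |eta| <= |f|] (lemma [universal_representation]).  For a fixed vector
    [e] the map [eta |-> <. e, eta>] is a bounded operator from [H] to [A*];
    by Bessel's inequality every bounded functional on [A*] vanishes at all but
    countably many images of the vectors of an orthonormal basis [B].  The
    linearly dense set used here consists of the functionals [<. e, b>] with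
    [b] in [B] and [e] in a suitable family [E] ([sigma_family]); the
    Sigma-subspace [D] consists of the elements of the bidual that have
    countable support on it.

    The family [E] must be large enough for linear density and sparse enough
    for [D] to be 1-norming.  Call [z] dominated by [e] if
    [|a z|^2 <= C |a e|^2] for all [a] in [A]: such [z] form the orbit of [e]
    under the commutant of [A].  Choose [E] maximal such that the orbits of its
    members are pairwise orthogonal.  Maximality makes the orbits span [H]
    ([total_orth_family]), and this gives linear density
    ([closed_span_sigma_family]).

    To see that [D] is 1-norming, fix [f = <. xi, eta>] and [a] in the unit ball
    of [A] with [f(a)] close to [|f|].  The vector [xi] is close to the span [W]
    of the orbits of a finite part [F] of [E].  Let [p] be the orthogonal
    projection onto the closure of [W].  As [W] is invariant under the commutant,
    [p] belongs to the bicommutant of [A] ([bicommutant]); therefore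
    [y(<. xi, eta>) = <a p xi, eta>] is a well-defined element of the bidual, of
    norm at most [|a|] since [|p xi| |eta| <= |xi| |eta| <= |f|] ([truncation]).  It vanishes at [<. e, b>] for [e] in [E] outside [F],
    so it belongs to [D], and [y(f)] is close to [f(a)].

    The representation [H] is the direct sum of the GNS representations of
    states dominating the functionals [f], in the sense that
    [|Re f(a)|^2 <= |f|^2 psi(a* a)].  Such a state is found with the
    Hahn-Banach theorem ([dominating_state]) and the inequality
    [sum F(a_i)^2 <= |sum a_i* a_i|] for [F] of norm 1.  The latter rests on the
    theorem that [x* x] is positive in a C*-algebra ([pos_star_mul]).  As [A]
    need not have a unit, positivity is studied in the algebra of multipliers of
    [A], which has one.

    Everything is done over the reals: complex functionals are replaced by their
    real parts, and Hermitian inner products by theirs. *)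

Set Implicit Arguments.
Unset Strict Implicit.
Unset Printing Implicit Defensive.

Import Order.TTheory GRing.Theory Num.Theory numFieldNormedType.Exports.
Local Open Scope classical_set_scope.
Local Open Scope ring_scope.

(** * The Hahn-Banach theorem for sublinear functionals *)
Section HahnBanach.
Context {R : realType} {V : lmodType R}.
Implicit Types (p q : V -> R) (S : V -> set R).

Definition sublinear p :=
  (forall u v, p (u + v) <= p u + p v) /\
  (forall t v, 0 <= t -> p (t *: v) = t * p v).

Lemma sublinear0 p : sublinear p -> p 0 = 0.
Proof. by move=> [_ pZ]; rewrite -(scale0r 0) pZ// mul0r. Qed.

(** A family of candidate values [S v] that is stable under sums and positive
    multiples up to decreasing the value has a sublinear lower envelope.  Used
    for the lower bound of a chain, for the decrease of a sublinear functional
    along a direction, and for the functional behind [dominating_state]. *)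
Lemma sublinear_inf S :
  (forall v, S v !=set0) -> (forall v, has_lbound (S v)) ->
  (forall u v x y, S u x -> S v y -> exists2 z, S (u + v) z & z <= x + y) ->
  (forall t v x, 0 < t -> S v x -> exists2 z, S (t *: v) z & z <= t * x) ->
  S 0 0 -> sublinear (fun v => inf (S v)).
Proof.
move=> S0 Slb SD SZ S00.
have Sinf v : has_inf (S v) by split.
have pD u v : inf (S (u + v)) <= inf (S u) + inf (S v).
  apply/ler_addgt0Pr => e e0; have e2 : 0 < e / 2 by rewrite divr_gt0.
  have [x Sx xu] := inf_adherent e2 (Sinf u).
  have [y Sy yv] := inf_adherent e2 (Sinf v).
  have [z Sz zxy] := SD _ _ _ _ Sx Sy.
  by rewrite (le_trans (ge_inf (Slb _) Sz))//; lra.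
have pZ t v : 0 < t -> inf (S (t *: v)) <= t * inf (S v).
  move=> t0; rewrite mulrC -ler_pdivrMr//; apply: lb_le_inf => // x Sx.
  have [z Sz zx] := SZ _ _ _ t0 Sx.
  by rewrite ler_pdivrMr// mulrC (le_trans _ zx)// ge_inf.
split=> // t v; rewrite le_eqVlt => /predU1P[<-|t0].
  rewrite scale0r mul0r; apply/le_anti/andP; split; first exact: ge_inf.
  by have := pD 0 0; rewrite addr0; lra.
apply/le_anti; rewrite pZ//=.
have t10 : 0 < t^-1 by rewrite invr_gt0.
have := pZ _ (t *: v) t10; rewrite scalerA mulVf ?gt_eqF// scale1r.
by rewrite -ler_pdivrMl// invrK.
Qed.

(** The functional [u |-> inf over t >= 0 of p (u + t v) - t p v] is sublinear
    and below [p]; minimality makes it equal to [p], and its value at [- v] is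
    at most [- p v].  Hence [p] is odd, and an odd sublinear functional is
    linear. *)
Lemma minimal_sublinear_linear p : sublinear p ->
  (forall q, sublinear q -> (forall v, q v <= p v) -> forall v, q v = p v) ->
  (forall u v, p (u + v) = p u + p v) /\ (forall t v, p (t *: v) = t * p v).
Proof.
move=> psub pmin; have [pD pZ] := psub; have p0 := sublinear0 psub.
have pN v : p (- v) = - p v.
  pose S u := [set p (u + t *: v) - t * p v | t in [set t | 0 <= t]].
  have Slb u x : S u x -> - p (- u) <= x.
    move=> [t /= t0 <-]; rewrite -pZ//.
    by have := pD (u + t *: v) (- u); rewrite addrAC subrr add0r; lra.
  have Ssub : sublinear (fun u => inf (S u)).
    apply: sublinear_inf.
    - by move=> u; exists (p (u + 0 *: v) - 0 * p v); exists 0 => //=.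
    - by move=> u; exists (- p (- u)) => x; exact: Slb.
    - move=> u w _ _ [t /= t0 <-] [s /= s0 <-].
      exists (p (u + w + (t + s) *: v) - (t + s) * p v).
        by exists (t + s) => //=; exact: addr_ge0.
      rewrite scalerDl addrACA; have := pD (u + t *: v) (w + s *: v); lra.
    - move=> t u _ t0 [s /= s0 <-].
      exists (p (t *: u + (t * s) *: v) - (t * s) * p v).
        by exists (t * s) => //=; rewrite mulr_ge0// ltW.
      by rewrite -scalerA -scalerDr pZ ?(ltW t0)//; lra.
    - by exists 0 => //=; rewrite scale0r addr0 p0; lra.
  have Slbd u : has_lbound (S u) by exists (- p (- u)) => x; exact: Slb.
  have Sp u : inf (S u) <= p u.
    by apply: ge_inf => //; exists 0 => //=; rewrite scale0r addr0; lra.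
  rewrite -(pmin _ Ssub Sp); apply/le_anti/andP; split.
    apply: ge_inf => //; exists 1 => //=.
    by rewrite scale1r addNr p0 mul1r sub0r.
  apply: lb_le_inf; first by exists (p (- v + 0 *: v) - 0 * p v); exists 0 => //=.
  by move=> x /Slb; rewrite opprK.
have pD' u v : p (u + v) = p u + p v.
  apply/le_anti; rewrite pD/=.
  by have := pD (u + v) (- v); rewrite addrK pN; lra.
split=> // t v; have [t0|t0] := leP 0 t; first exact: pZ.
by rewrite -[t]opprK scaleNr pN pZ ?mulNr// oppr_ge0 ltW.
Qed.

(** Hahn-Banach theorem, in the form: the sublinear functionals below [p] have
    a minimal element by Zorn's lemma, and it is linear. *)
Lemma sublinear_linear_minorant p : sublinear p ->
  exists phi : V -> R, [/\ forall u v, phi (u + v) = phi u + phi v,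
    forall t v, phi (t *: v) = t * phi v & forall v, phi v <= p v].
Proof.
move=> psub.
pose T := {q : V -> R | sublinear q /\ forall v, q v <= p v}.
pose r (s t : T) := `[< forall v, sval t v <= sval s v >].
have [|||A Atot|[q [qsub qp]] qmin] := @Zorn T r.
- by move=> t; apply/asboolP.
- move=> s t u /asboolP st /asboolP tu; apply/asboolP => v.
  exact: le_trans (tu v) (st v).
- move=> [s Hs] [t Ht] /asboolP/= st /asboolP/= ts.
  by apply/eq_exist/funext => v; apply/le_anti; rewrite st ts.
- have [[s0 As0]|A0] := pselect (exists s, A s); last first.
    have pP : sublinear p /\ forall v, p v <= p v by [].
    by exists (exist _ p pP) => s As; exfalso; apply: A0; exists s.
  pose S v := [set sval s v | s in A].
  have Slb v x : S v x -> - p (- v) <= x.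
    move=> [[s [ssub sp]] As <-]/=.
    have := ssub.1 v (- v); rewrite subrr (sublinear0 ssub).
    by have := sp (- v); lra.
  have Slbd u : has_lbound (S u) by exists (- p (- u)) => x; exact: Slb.
  have Ssub : sublinear (fun u => inf (S u)).
    apply: sublinear_inf => //.
    - by move=> v; exists (sval s0 v), s0.
    - move=> u v _ _ [s As <-] [t At <-].
      have [/asboolP st|/asboolP ts] := Atot _ _ As At.
        exists (sval t (u + v)); first by exists t.
        by have := (svalP t).1.1 u v; have := st u; lra.
      exists (sval s (u + v)); first by exists s.
      by have := (svalP s).1.1 u v; have := ts v; lra.
    - move=> t v _ t0 [s As <-]; exists (sval s (t *: v)); first by exists s.
      by rewrite (svalP s).1.2// ltW.
    - by exists s0 => //; exact: sublinear0 (svalP s0).1.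
  have Sp v : inf (S v) <= p v.
    have := (svalP s0).2 v; apply: le_trans.
    by apply: ge_inf => //; exists s0.
  exists (exist _ (fun v => inf (S v)) (conj Ssub Sp)) => s As.
  by apply/asboolP => v /=; apply: ge_inf => //; exists s.
have [|qD qZ] := minimal_sublinear_linear qsub.
  move=> q' q'sub q'q v.
  have q'p u : q' u <= p u by exact: le_trans (q'q u) (qp u).
  have /(_ (exist _ q' (conj q'sub q'p))) := qmin.
  have rq : r (exist _ q (conj qsub qp)) (exist _ q' (conj q'sub q'p)).
    by apply/asboolP.
  by move=> /(_ rq) /(congr1 sval)/= ->.
by exists q.
Qed.

End HahnBanach.


(** * Complete semi-inner product spaces *)
(** The rate at which approximating sequences are chosen to converge. *)
Definition invS {R : realType} (n : nat) : R := n.+1%:R^-1.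

Lemma invS_gt0 {R : realType} n : 0 < invS n :> R.
Proof. by rewrite invr_gt0. Qed.

Lemma eventually_invS {R : realType} (e : R) : 0 < e ->
  exists N : nat, forall n, (N <= n)%N -> invS n < e.
Proof.
move=> /ltr_add_invr[k]; rewrite add0r => ke; exists k => n kn.
by apply: le_lt_trans ke; rewrite /invS lef_pV2 ?posrE// ler_nat.
Qed.

Section span.
Context {R : realType} {V : lmodType R} (S : set V).

Inductive span : set V :=
| span0 : span 0
| spanD t s v : S s -> span v -> span (t *: s + v).

Lemma sub_span v : S v -> span v.
Proof. by move=> Sv; rewrite -[v]scale1r -[1 *: v]addr0; apply: spanD => //; exact: span0. Qed.

Lemma span_add u v : span u -> span v -> span (u + v).
Proof.
by move=> Su Sv; elim: Su => [|t s w Ss _ IH]; rewrite ?add0r// -addrA; exact: spanD.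
Qed.

Lemma span_scale t v : span v -> span (t *: v).
Proof.
elim=> [|s u w Su _ IH]; first by rewrite scaler0; exact: span0.
by rewrite scalerDr scalerA; exact: spanD.
Qed.

End span.

(** Vectors of length zero are allowed, so that completions and GNS spaces need
    no quotient; two vectors are the same for the inner product when their
    difference has length zero. *)
Record prehilbert (R : realType) := Prehilbert {
  prehilbert_sort :> lmodType R ;
  dot : prehilbert_sort -> prehilbert_sort -> R ;
  dotC : forall u v, dot u v = dot v u ;
  dotDl : forall u v w, dot (u + v) w = dot u w + dot v w ;
  dotZl : forall t u w, dot (t *: u) w = t * dot u w ;
  dot_ge0 : forall u, 0 <= dot u u }.

Definition sqn {R : realType} {H : prehilbert R} (v : H) := dot v v.

Definition sq_cauchy {R : realType} {H : prehilbert R} (u : nat -> H) :=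
  forall e, 0 < e -> exists N : nat, forall m n, (N <= m)%N -> (N <= n)%N ->
    sqn (u m - u n) < e.

Definition sq_cvg {R : realType} {H : prehilbert R} (u : nat -> H) (l : H) :=
  forall e, 0 < e -> exists N : nat, forall n, (N <= n)%N -> sqn (l - u n) < e.

Record hilbert (R : realType) := Hilbert {
  hilbert_pre :> prehilbert R ;
  dot_complete : forall u : nat -> hilbert_pre, sq_cauchy u -> exists l, sq_cvg u l }.

Section prehilbert_theory.
Context {R : realType} {H : prehilbert R}.
Implicit Types (u v w : H) (W : set H).

Lemma sqn_ge0 v : 0 <= sqn v. Proof. exact: dot_ge0. Qed.

Lemma dotDr u v w : dot u (v + w) = dot u v + dot u w.
Proof. by rewrite dotC dotDl !(dotC u). Qed.
Lemma dotZr t u w : dot u (t *: w) = t * dot u w.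
Proof. by rewrite dotC dotZl (dotC u). Qed.
Lemma dotNl u w : dot (- u) w = - dot u w.
Proof. by rewrite -scaleN1r dotZl mulN1r. Qed.
Lemma dotNr u w : dot u (- w) = - dot u w.
Proof. by rewrite dotC dotNl dotC. Qed.
Lemma dotBl u v w : dot (u - v) w = dot u w - dot v w.
Proof. by rewrite dotDl dotNl. Qed.
Lemma dotBr u v w : dot u (v - w) = dot u v - dot u w.
Proof. by rewrite dotDr dotNr. Qed.
Lemma dot0l v : dot 0 v = 0.
Proof. by rewrite -(scale0r 0) dotZl mul0r. Qed.
Lemma dot0r v : dot v 0 = 0.
Proof. by rewrite dotC dot0l. Qed.

Lemma sqnD u v : sqn (u + v) = sqn u + 2 * dot u v + sqn v.
Proof. by rewrite /sqn dotDl !dotDr (dotC v u); ring. Qed.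
Lemma sqnB u v : sqn (u - v) = sqn u - 2 * dot u v + sqn v.
Proof. by rewrite /sqn dotBl !dotBr (dotC v u); ring. Qed.
Lemma sqnZ t u : sqn (t *: u) = t ^+ 2 * sqn u.
Proof. by rewrite /sqn dotZl dotZr; ring. Qed.
Lemma sqnN u : sqn (- u) = sqn u.
Proof. by rewrite -scaleN1r sqnZ; ring. Qed.
Lemma sqn0 : sqn (0 : H) = 0. Proof. exact: dot0l. Qed.
Lemma sqnBC u v : sqn (u - v) = sqn (v - u).
Proof. by rewrite -sqnN opprB. Qed.

Lemma sqnD_le u v : sqn (u + v) <= 2 * sqn u + 2 * sqn v.
Proof. by have := sqn_ge0 (u - v); rewrite sqnB sqnD; lra. Qed.

(** The quadratic polynomial [sqn (u + t v)] in [t] is nonnegative; it is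
    evaluated at its minimum, or at a point where it would be negative if it
    were affine and not constant. *)
Lemma cauchy_schwarz u v : dot u v ^+ 2 <= sqn u * sqn v.
Proof.
have q t : 0 <= sqn u + 2 * t * dot u v + t ^+ 2 * sqn v.
  by have := sqn_ge0 (u + t *: v); rewrite sqnD sqnZ dotZr; lra.
have [v0|v0] := eqVneq (sqn v) 0.
  have [->|uv0] := eqVneq (dot u v) 0; first by rewrite expr0n mulr_ge0 ?sqn_ge0.
  have := q (- (sqn u + 1) / (2 * dot u v)); rewrite v0 mulr0 addr0.
  suff -> : 2 * (- (sqn u + 1) / (2 * dot u v)) * dot u v = - (sqn u + 1) by lra.
  by field.
have v1 : 0 < sqn v by rewrite lt_neqAle eq_sym v0 sqn_ge0.
have := q (- dot u v / sqn v).
have -> : sqn u + 2 * (- dot u v / sqn v) * dot u v + (- dot u v / sqn v) ^+ 2 * sqn v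
  = (sqn u * sqn v - dot u v ^+ 2) / sqn v by field.
by rewrite pmulr_lge0 ?invr_gt0// subr_ge0.
Qed.

Lemma dot_null u v : sqn u = 0 -> dot u v = 0.
Proof.
move=> u0; have := cauchy_schwarz u v; rewrite u0 mul0r => uv.
by apply/eqP; rewrite -sqrf_eq0; apply/eqP/le_anti; rewrite uv sqr_ge0.
Qed.

(** Continuity of the inner product at the origin, with squared lengths in
    place of lengths. *)
Lemma dot_small v e : 0 < e ->
  exists2 d, 0 < d & forall u, sqn u < d -> `|dot u v| < e.
Proof.
move=> e0; have v1 : 0 < sqn v + 1 by rewrite ltr_wpDl ?sqn_ge0.
exists (e ^+ 2 / (sqn v + 1)); first by rewrite divr_gt0// exprn_gt0.
move=> u; rewrite ltr_pdivlMr// => ud.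
rewrite -(@ltr_pXn2r _ 2)// ?nnegrE// ?ltW// real_normK ?num_real//.
by have := cauchy_schwarz u v; have := sqn_ge0 u; have := sqn_ge0 v; nra.
Qed.

Definition cl W : set H :=
  [set v | forall e, 0 < e -> exists2 w, W w & sqn (v - w) < e].

Lemma sub_cl W v : W v -> cl W v.
Proof. by move=> Wv e e0; exists v => //; rewrite subrr sqn0. Qed.

Lemma cl_mono W W' : W `<=` W' -> cl W `<=` cl W'.
Proof. by move=> WW v clv e /clv[w /WW]; exists w. Qed.

Lemma cl_approx W v u e : cl W v -> 0 < e ->
  exists w, [/\ W w, sqn (v - w) < e & `|dot (v - w) u| < e].
Proof.
move=> clv e0; have [d d0 du] := dot_small u e0.
have [|w Ww] := clv (Num.min e d); first by rewrite lt_min e0.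
by rewrite lt_min => /andP[we wd]; exists w; split=> //; exact: du.
Qed.

Lemma cl_orth W v u : cl W v -> (forall w, W w -> dot w u = 0) -> dot v u = 0.
Proof.
move=> clv Wu; apply/eqP; rewrite -normr_le0; apply/ler_addgt0Pr => e e0.
have [w [Ww _]] := cl_approx u clv e0.
by rewrite dotBl (Wu _ Ww) subr0 add0r => /ltW.
Qed.

Lemma cl_null W v : cl W v -> (forall w, W w -> dot w v = 0) -> sqn v = 0.
Proof. exact: cl_orth. Qed.

Lemma cl_comb W t u v : (forall u v, W u -> W v -> W (t *: u + v)) ->
  cl W u -> cl W v -> cl W (t *: u + v).
Proof.
move=> WD clu clv e e0.
have t1 : 0 < 4 * (t ^+ 2 + 1) by rewrite mulr_gt0// ltr_wpDl ?sqr_ge0.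
have [x Wx ux] := clu (e / (4 * (t ^+ 2 + 1))) (divr_gt0 e0 t1).
have [y Wy vy] : exists2 y, W y & sqn (v - y) < e / 4 by apply: clv; rewrite divr_gt0.
exists (t *: x + y); first exact: WD.
rewrite opprD addrACA -scalerBr (le_lt_trans (sqnD_le _ _))// sqnZ.
move: ux; rewrite ltr_pdivlMr// => ux.
by have := sqn_ge0 (u - x); nra.
Qed.

(** Testing [v] against vectors close to [v] itself gives
    [sqn v ^+ 2 <= C * sqn v] in the limit; [e] is small enough to turn
    [C < sqn v] into a contradiction. *)
Lemma cl_sqn_le W v (C : R) : 0 <= C -> cl W v ->
  (forall w, W w -> dot w v ^+ 2 <= C * sqn w) -> sqn v <= C.
Proof.
move=> C0 clv WC; rewrite leNgt; apply/negP => lt.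
have N0 := sqn_ge0 v.
pose e := sqn v * (sqn v - C) / (2 * (2 * sqn v + 3 * C + 1)).
have den : 0 < 2 * (2 * sqn v + 3 * C + 1) by nra.
have e0 : 0 < e by rewrite divr_gt0// mulr_gt0 ?subr_gt0//; lra.
have [w [Ww le1 le2]] := cl_approx v clv e0.
have := WC _ Ww; move: le1 le2; rewrite sqnB dotBl (dotC v) -/(sqn v).
set x := dot w v => le1; rewrite ltr_norml => /andP[le2 le3].
have eE : e * (2 * (2 * sqn v + 3 * C + 1)) = sqn v * (sqn v - C).
  by rewrite /e divfK// gt_eqF.
move=> xC.
have h1 : C * sqn w <= C * (sqn v + 3 * e) by rewrite ler_wpM2l//; lra.
have h2 : sqn v * (sqn v - x) <= sqn v * e by rewrite ler_wpM2l//; lra.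
have h3 := sqr_ge0 (sqn v - x).
have h4 : 0 <= e * sqn v by rewrite mulr_ge0// ltW.
have h5 : 0 <= e * C by rewrite mulr_ge0// ltW.
lra.
Qed.

Lemma cl_null_shift W p v : cl W p -> sqn (v - p) = 0 -> cl W v.
Proof.
move=> clp vp e e0; have [|w Ww pw] := clp (e / 2); first by rewrite divr_gt0.
exists w => //; rewrite -(subrKA p) (le_lt_trans (sqnD_le _ _))// vp; lra.
Qed.

End prehilbert_theory.

Section hilbert_theory.
Context {R : realType} {H : hilbert R}.
Implicit Types (u v w : H) (W : set H).

(** Riesz representation of a functional [F] that is only defined through a
    parametrization [J] of a subspace: a minimizing sequence of
    [sqn (J k) - 2 F k] is Cauchy by the parallelogram law, and its limit
    represents [F].  With [F k = <J k, v>] this is the orthogonal projection of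
    [v]; with [J a = a e] it turns a functional on an orbit into a vector. *)
Lemma riesz (K : Type) (J : K -> H) (F : K -> R) (C : R) : inhabited K ->
  (forall s t k l, exists m, J m = s *: J k + t *: J l /\ F m = s * F k + t * F l) ->
  0 <= C -> (forall k, F k ^+ 2 <= C * sqn (J k)) ->
  exists eta, [/\ cl (range J) eta, forall k, F k = dot (J k) eta & sqn eta <= C].
Proof.
move=> [k0] comb C0 FC.
pose Q k := sqn (J k) - 2 * F k.
have Qlb k : - C <= Q k.
  have := FC k; rewrite /Q; have := sqn_ge0 (J k).
  move: (sqn _) (F k) => n f n0 fC; rewrite leNgt; apply/negP => h.
  have : 0 < (2 * f - (n + C)) * (2 * f + (n + C)) by apply: mulr_gt0; lra.
  by have := sqr_ge0 (n - C); lra.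
have Qinf : has_inf (range Q).
  by split; [exists (Q k0), k0|exists (- C) => _ [k _ <-]].
pose m := inf (range Q).
have Qm k : m <= Q k by apply: ge_inf; [exact: Qinf.2|exists k].
have /choice[k kP] : forall n : nat, exists k, Q k < m + invS n.
  by move=> n; have [_ [k _ <-] kn] := inf_adherent (invS_gt0 n) Qinf; exists k.
have Jsq n p : sqn (J (k n) - J (k p)) <= 2 * invS n + 2 * invS p.
  have [l [Jl Fl]] := comb (1 / 2) (1 / 2) (k n) (k p).
  have := Qm l; have := kP n; have := kP p.
  rewrite /Q Jl Fl sqnB -scalerDr sqnZ sqnD; lra.
have [e e0|eta etaP] := @dot_complete _ H (J \o k).
  have e4 : 0 < e / 4 by rewrite divr_gt0.
  have [N NP] := eventually_invS e4.
  exists N => a b Na Nb; apply: le_lt_trans (Jsq a b) _.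
  by have := NP _ Na; have := NP _ Nb; lra.
exists eta.
have cleta : cl (range J) eta.
  by move=> e /etaP[N /(_ N (leqnn N)) ?]; exists (J (k N)).
have Feta l : F l = dot (J l) eta.
  have tP t : 0 <= t ^+ 2 * sqn (J l) + 2 * t * (dot (J l) eta - F l).
    apply/ler_addgt0Pr => e e0.
    have t1 : 0 < 2 * `|t| + 1 by rewrite ltr_wpDl// mulr_ge0.
    have e20 : 0 < e / (2 * (2 * `|t| + 1)) by rewrite divr_gt0// mulr_gt0.
    have [d d0 dP] := dot_small (J l) e20.
    have [N1 N1P] := etaP _ d0.
    have e2 : 0 < e / 2 by rewrite divr_gt0.
    have [N2 N2P] := eventually_invS e2.
    pose n := maxn N1 N2.
    have := dP _ (N1P n (leq_maxl _ _)).
    have /= := N2P n (leq_maxr _ _) => n2.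
    have DE : dot (eta - J (k n)) (J l) = dot (J l) eta - dot (J (k n)) (J l).
      by rewrite dotBl (dotC eta).
    move: DE; set D := dot (eta - _) _ => DE.
    rewrite ltr_pdivlMr ?mulr_gt0// => h.
    have [p [Jp Fp]] := comb 1 t (k n) l.
    have := Qm p; have := kP n.
    rewrite /Q Jp Fp scale1r sqnD sqnZ dotZr.
    have hD : - (2 * t * D) <= e / 2.
      have : - (2 * t * D) <= 2 * `|t| * `|D|.
        by rewrite -mulrN (le_trans (ler_norm _))// !normrM normrN ger0_norm.
      by have := normr_ge0 D; have := normr_ge0 t; nra.
    move: hD; rewrite DE; nra.
  have q0 := tP; have sl := sqn_ge0 (J l).
  apply/eqP; rewrite -subr_eq0; apply/eqP.
  have s1 : 0 < sqn (J l) + 1 by rewrite ltr_wpDl.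
  set g := dot (J l) eta - F l in tP.
  have := tP (- g / (sqn (J l) + 1)).
  have -> : (- g / (sqn (J l) + 1)) ^+ 2 * sqn (J l) + 2 * (- g / (sqn (J l) + 1)) * g
    = - (g ^+ 2 * (sqn (J l) + 2) / (sqn (J l) + 1) ^+ 2).
    by field; rewrite gt_eqF.
  rewrite oppr_ge0 pmulr_lle0 ?invr_gt0 ?exprn_gt0// => h.
  have g0 : g ^+ 2 = 0 by have := sqr_ge0 g; nra.
  by move/eqP : g0; rewrite sqrf_eq0 /g => /eqP; lra.
split=> //; apply: (cl_sqn_le C0 cleta) => _ [k' _ <-].
by rewrite -Feta; exact: FC.
Qed.

Lemma projection W v : (exists w, W w) ->
  (forall s t u w, W u -> W w -> W (s *: u + t *: w)) ->
  exists2 p, cl W p & forall w, W w -> dot w (v - p) = 0.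
Proof.
move=> [w0 Ww0] WD; pose K := {w | W w}.
have [|s t k l|||p [clp pP _]] :=
  @riesz K sval (fun k => dot (sval k) v) (sqn v).
- by constructor; exists w0.
- exists (exist _ _ (WD s t _ _ (svalP k) (svalP l))) => /=.
  by rewrite dotDl !dotZl.
- exact: sqn_ge0.
- by move=> k; rewrite mulrC cauchy_schwarz.
exists p; first by apply: cl_mono clp => _ [[w Ww] _ <-].
by move=> w Ww; rewrite dotBr -(pP (exist _ w Ww)) subrr.
Qed.

End hilbert_theory.


(** * Orthonormal bases *)
Section orthonormal.
Context {R : realType} {H : prehilbert R}.
Implicit Types (B : set H) (v : H).

Definition orthonormal B :=
  (forall b, B b -> sqn b = 1) /\ (forall b c, B b -> B c -> b <> c -> dot b c = 0).

Lemma dot_suml (I : Type) (s : seq I) (f : I -> H) v :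
  dot (\sum_(i <- s) f i) v = \sum_(i <- s) dot (f i) v.
Proof.
by elim: s => [|i s IH]; rewrite ?big_nil ?dot0l// !big_cons dotDl IH.
Qed.

(** Bessel's inequality: if [v] is the sum of the [F b *: b] over a finite part
    of [B], then [F v = sqn v] is the sum of the [F b ^+ 2], hence at most [C].
    So only finitely many [b] satisfy [F b ^+ 2 > 1 / (n + 1)]. *)
Lemma bessel_countable B (F : H -> R) (C : R) : orthonormal B ->
  (forall u v, F (u + v) = F u + F v) -> (forall t v, F (t *: v) = t * F v) ->
  0 <= C -> (forall v, F v ^+ 2 <= C * sqn v) -> countable [set b | B b /\ F b != 0].
Proof.
move=> [B1 B0] FD FZ C0 FC.
have sumF (X : {fset H}) : [set` X] `<=` B -> \sum_(b <- X) F b ^+ 2 <= C.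
  move=> XB; set s := \sum_(b <- X) _.
  pose v := \sum_(b <- X) F b *: b.
  have F0 : F 0 = 0 by rewrite -(scale0r 0) FZ mul0r.
  have Fv : F v = s.
    rewrite /v /s; elim: (X : seq _) => [|b r IH]; rewrite ?big_nil// !big_cons.
    by rewrite FD FZ IH expr2.
  have dv b : b \in X -> dot v b = F b.
    move=> bX; rewrite dot_suml (big_fsetD1 b)//= dotZl [dot b b]B1 ?mulr1; last exact: XB.
    rewrite big_seq big1 ?addr0// => c; rewrite !inE => /andP[/eqP cb cX].
    by rewrite dotZl B0 ?mulr0//; exact: XB.
  have sv : sqn v = s.
    rewrite /sqn {1}/v dot_suml /s big_seq [RHS]big_seq; apply: eq_bigr => b bX.
    by rewrite dotZl dotC dv// expr2.
  have := FC v; rewrite Fv sv; have : 0 <= s by apply: sumr_ge0 => b _; exact: sqr_ge0.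
  by rewrite leNgt; move=> s0 sC; apply/negP => Cs; nra.
pose D n := [set b | B b /\ invS n < F b ^+ 2].
have -> : [set b | B b /\ F b != 0] = \bigcup_n D n.
  apply/seteqP; split=> [b [Bb Fb]|b [n _ [Bb Fn]]].
    have /eventually_invS[n /(_ n (leqnn _)) nF] : 0 < F b ^+ 2.
      by rewrite lt_neqAle sqr_ge0 andbT eq_sym sqrf_eq0.
    by exists n.
  by split=> //; apply: contraTneq Fn => ->; rewrite expr0n -leNgt ltW// invS_gt0.
apply: bigcup_countable => // n _; apply: finite_set_countable.
apply: contrapT => /(@infinite_set_fset _ _ (Num.bound (C / invS n)))[X XD].
have X0 : 0 <= C / invS n by rewrite divr_ge0// ltW// invS_gt0.
move=> Xn; have := sumF X (subset_trans XD (fun b h => h.1)); apply/negP; rewrite -ltNge.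
have : invS n * #|` X|%:R <= \sum_(b <- X) F b ^+ 2.
  rewrite -sum1_size natr_sum mulr_sumr big_seq [leRHS]big_seq; apply: ler_sum => b bX.
  by rewrite mulr1 ltW//; have [] := XD _ bX.
apply: lt_le_trans; rewrite mulrC -ltr_pdivrMr ?invS_gt0//.
by rewrite (lt_le_trans (archi_boundP X0))// ler_nat.
Qed.

End orthonormal.

(** A maximal orthonormal set is total: the component of a vector orthogonal to
    its span could be normalized and added. *)
Lemma orthonormal_basis {R : realType} (H : hilbert R) :
  exists B : set H, orthonormal B /\ forall v, cl (span B) v.
Proof.
have [|B [[B1 B0] Bmax]] := @Zorn_bigcup H (@orthonormal R H).
  move=> F FP Ftot; split=> [b [X /FP[X1 _] Xb]|b c [X FX Xb] [Y FY Yc]]; first exact: X1.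
  have [XY|YX] := Ftot _ _ FX FY.
    by have [_] := FP _ FY; apply=> //; exact: XY.
  by have [_] := FP _ FX; apply=> //; exact: YX.
exists B; split=> // v.
have [|s t u w Su Sw|p clp pP] := @projection R H (span B) v.
- by exists 0; exact: span0.
- by apply: span_add; exact: span_scale.
have [n0|n0] := eqVneq (sqn (v - p)) 0.
  exact: cl_null_shift clp n0.
exfalso; pose c := (Num.sqrt (sqn (v - p)))^-1 *: (v - p).
have n1 : 0 < sqn (v - p) by rewrite lt_neqAle eq_sym n0 sqn_ge0.
have c1 : sqn c = 1.
  by rewrite sqnZ exprVn sqr_sqrtr ?sqn_ge0// mulVf.
have cB b : B b -> dot b c = 0.
  by move=> Bb; rewrite dotZr pP ?mulr0//; exact: sub_span.
apply: (Bmax (B `|` [set c])).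
  split=> [b Bb|]; first by left.
  move=> /(_ c (or_intror erefl)) /cB; rewrite -/(sqn c) c1 => /eqP.
  by rewrite oner_eq0.
split=> [b [/B1//|->//]|b b' [Bb|->] [Bb'|->]//].
- exact: B0.
- by move=> _; exact: cB.
- by move=> _; rewrite dotC; exact: cB.
Qed.

(** * Finite powers of a Hilbert space *)
Section power.
Context {R : realType} (H : hilbert R) (n : nat).

Definition power_dot (u v : 'I_n -> H) := \sum_i dot (u i) (v i).

Lemma power_dotC u v : power_dot u v = power_dot v u.
Proof. by apply: eq_bigr => i _; exact: dotC. Qed.

Lemma power_dotDl u v w : power_dot (u + v) w = power_dot u w + power_dot v w.
Proof. by rewrite -big_split; apply: eq_bigr => i _; exact: dotDl. Qed.

Lemma power_dotZl t u w : power_dot (t *: u) w = t * power_dot u w.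
Proof. by rewrite /power_dot mulr_sumr; apply: eq_bigr => i _; exact: dotZl. Qed.

Lemma power_dot_ge0 u : 0 <= power_dot u u.
Proof. by apply: sumr_ge0 => i _; exact: dot_ge0. Qed.

Definition power_pre :=
  Prehilbert power_dotC power_dotDl power_dotZl power_dot_ge0.

Lemma power_sqnE (u : power_pre) : sqn u = \sum_i sqn (u i).
Proof. by []. Qed.

Lemma power_sqn_ge (u : power_pre) i : sqn (u i) <= sqn u.
Proof.
by rewrite power_sqnE (bigD1 i)//= lerDl sumr_ge0// => j _; exact: sqn_ge0.
Qed.

Lemma power_complete (u : nat -> power_pre) : sq_cauchy u -> exists l, sq_cvg u l.
Proof.
move=> cu.
have /choice[l lP] : forall i, exists l, sq_cvg (fun k => u k i : H) l.
  move=> i; apply: dot_complete => e /cu[N NP]; exists N => p q pN qN.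
  exact: le_lt_trans (power_sqn_ge (u p - u q) i) (NP _ _ pN qN).
exists l => e e0.
have n1 : 0 < n.+1%:R :> R by [].
have en : 0 < e / n.+1%:R by rewrite divr_gt0.
have /choice[N NP] : forall i, exists N, forall p, (N <= p)%N -> sqn (l i - u p i) < e / n.+1%:R.
  by move=> i; exact: lP.
exists (\max_i N i) => p pN; rewrite power_sqnE.
have -> : e = e / n.+1%:R *+ n.+1 by rewrite -mulr_natr divfK// gt_eqF.
rewrite mulrSr -[X in _ *+ X]card_ord -sumr_const -[ltLHS]addr0 ler_ltD//.
apply: ler_sum => i _; rewrite ltW// NP//; apply: leq_trans pN.
by rewrite (leq_bigmax i).
Qed.

Definition power : hilbert R := Hilbert power_complete.

End power.

(** * Completion of a semi-inner product space *)
Section completion.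
Context {R : realType} (P : prehilbert R).

(** The completion is the space of Cauchy sequences itself; it carries a
    semi-inner product, so equivalent sequences need not be identified. *)
Definition is_cauchy : {pred nat -> P} := [pred u : nat -> P | `[< sq_cauchy u >]].

Record cauchy_seq := CauchySeq {
  cauchy_fun :> nat -> P ; cauchy_funP : cauchy_fun \in is_cauchy }.

HB.instance Definition _ := [isSub for cauchy_fun].
HB.instance Definition _ := [Choice of cauchy_seq by <:].

Lemma cauchy_submod_closed : submod_closed is_cauchy.
Proof.
split=> [|k f g /asboolP cf /asboolP cg]; apply/asboolP.
  by move=> e e0; exists 0%N => m n _ _; rewrite subrr sqn0.
move=> e e0.
have k1 : 0 < 4 * (k ^+ 2 + 1) by rewrite mulr_gt0// ltr_wpDl ?sqr_ge0.
have [N1 N1P] := cf _ (divr_gt0 e0 k1).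
have e4 : 0 < e / 4 by rewrite divr_gt0.
have [N2 N2P] := cg _ e4.
exists (maxn N1 N2) => m n; rewrite !geq_max => /andP[m1 m2] /andP[n1 n2].
rewrite -![(k *: f + g) _]/(k *: f _ + g _) opprD addrACA -scalerBr.
rewrite (le_lt_trans (sqnD_le _ _))// sqnZ.
have := N1P _ _ m1 n1; rewrite ltr_pdivlMr// => h1.
have := N2P _ _ m2 n2 => h2; have := sqn_ge0 (f m - f n); nra.
Qed.

HB.instance Definition _ := GRing.isSubmodClosed.Build R (nat -> P) is_cauchy
  cauchy_submod_closed.
HB.instance Definition _ := [SubChoice_isSubLmodule of cauchy_seq by <:].

Implicit Types u v w : cauchy_seq.

Lemma cauchy_seqP u : sq_cauchy u.
Proof. by have /asboolP := cauchy_funP u. Qed.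

Lemma cauchy_bounded u : exists2 M, 0 < M & exists N, forall n, (N <= n)%N -> sqn (u n) <= M.
Proof.
have [N NP] := cauchy_seqP u ltr01; exists (2 * sqn (u N) + 2).
  by have := sqn_ge0 (u N); lra.
exists N => n Nn; rewrite -[u n](subrK (u N)).
rewrite (le_trans (sqnD_le _ _))//; have := NP _ _ Nn (leqnn N); lra.
Qed.

Lemma real_cauchy_cvg (x : nat -> R) :
  (forall e, 0 < e -> exists N : nat, forall m n, (N <= m)%N -> (N <= n)%N -> `|x m - x n| < e) ->
  cvgn x.
Proof.
move=> cx; apply: cauchy_cvg; apply/cauchyP => e /cx[N NP].
exists (x N); exists N => // n /= Nn; rewrite -ball_normE/=; exact: NP.
Qed.

Lemma cauchy_dot u v : cvgn (fun n => dot (u n) (v n)).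
Proof.
apply: real_cauchy_cvg => e e0.
have [M1 M10 [N1 N1P]] := cauchy_bounded u.
have [M2 M20 [N2 N2P]] := cauchy_bounded v.
have e2 : 0 < e / 2 by rewrite divr_gt0.
have [N3 N3P] := cauchy_seqP u (divr_gt0 (exprn_gt0 2 e2) M20).
have [N4 N4P] := cauchy_seqP v (divr_gt0 (exprn_gt0 2 e2) M10).
have small (x y : P) M : 0 < M -> sqn x < (e / 2) ^+ 2 / M -> sqn y <= M -> `|dot x y| < e / 2.
  move=> M0; rewrite ltr_pdivlMr// => xe yM.
  rewrite -(@ltr_pXn2r _ 2)// ?nnegrE// ?ltW// real_normK ?num_real//.
  have := cauchy_schwarz x y; have := sqn_ge0 x; nra.
exists (maxn (maxn N1 N2) (maxn N3 N4)) => m n.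
rewrite !geq_max => /andP[/andP[m1 m2] /andP[m3 m4]] /andP[/andP[n1 n2] /andP[n3 n4]].
have -> : dot (u m) (v m) - dot (u n) (v n) = dot (u m - u n) (v m) + dot (v m - v n) (u n).
  by rewrite !dotBl (dotC (v m)) (dotC (v n)); ring.
rewrite (le_lt_trans (ler_normD _ _))// [e]splitr ltrD//.
  by apply: small M20 _ _; [exact: N3P|exact: N2P].
by apply: small M10 _ _; [exact: N4P|exact: N1P].
Qed.

Definition completion_dot u v : R := limn (fun n => dot (u n) (v n)).

Lemma completion_dotP u v : (fun n => dot (u n) (v n)) @ \oo --> completion_dot u v.
Proof. exact: cauchy_dot. Qed.

Lemma completion_dotC u v : completion_dot u v = completion_dot v u.
Proof. by rewrite /completion_dot; under eq_fun do rewrite dotC. Qed.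

Lemma completion_dotDl u v w :
  completion_dot (u + v) w = completion_dot u w + completion_dot v w.
Proof.
apply: cvg_lim => //; rewrite (_ : (fun n => _) = (fun n => dot (u n) (w n) + dot (v n) (w n))).
  exact: (cvgD (@completion_dotP u w) (@completion_dotP v w)).
by apply/funext => n; exact: dotDl.
Qed.

Lemma completion_dotZl t u w : completion_dot (t *: u) w = t * completion_dot u w.
Proof.
apply: cvg_lim => //; rewrite (_ : (fun n => _) = (fun n => t * dot (u n) (w n))).
  exact: (cvgMr (@completion_dotP u w)).
by apply/funext => n; exact: dotZl.
Qed.

Lemma completion_dot_ge0 u : 0 <= completion_dot u u.
Proof.
apply: limr_ge; first exact: cauchy_dot.
by apply: nearW => n; exact: dot_ge0.
Qed.

Definition completion_pre :=
  Prehilbert completion_dotC completion_dotDl completion_dotZl completion_dot_ge0.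

Lemma const_cauchy (x : P) : (fun=> x) \in is_cauchy.
Proof. by apply/asboolP => e e0; exists 0%N => m n _ _; rewrite subrr sqn0. Qed.

Definition to_completion (x : P) : completion_pre := CauchySeq (const_cauchy x).

Lemma to_completion_dot x y : dot (to_completion x) (to_completion y) = dot x y.
Proof. by rewrite [LHS]/(completion_dot _ _) /completion_dot /=; exact: lim_cst. Qed.

Lemma to_completion_comb s t x y :
  to_completion (s *: x + t *: y) = s *: to_completion x + t *: to_completion y.
Proof. exact: val_inj. Qed.

Lemma to_completion_approx (u : completion_pre) e : 0 < e ->
  exists N, forall n, (N <= n)%N -> sqn (u - to_completion ((u : cauchy_seq) n)) < e.
Proof.
move=> e0; have e2 : 0 < e / 2 by rewrite divr_gt0.
have [N NP] := cauchy_seqP u e2; exists N => n Nn.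
apply: le_lt_trans (_ : e / 2 < e); last by lra.
apply: limr_le; first exact: cauchy_dot.
by exists N => // m /= Nm; rewrite ltW//; exact: NP.
Qed.

(** A Cauchy sequence of elements of the completion is replaced by a sequence of
    vectors of [P] within [1 / (n + 1)] of it; that sequence is the limit. *)
Lemma completion_complete (u : nat -> completion_pre) :
  sq_cauchy u -> exists l, sq_cvg u l.
Proof.
move=> cu.
have /choice[p pP] : forall k, exists x, sqn (u k - to_completion x) < invS k.
  move=> k; have [N /(_ N (leqnn N)) ?] := to_completion_approx (u k) (invS_gt0 k).
  by exists ((u k : cauchy_seq) N).
have tcB x y : sqn (to_completion x - to_completion y) = sqn (x - y).
  rewrite /sqn -to_completion_dot; congr (dot _ _); exact: val_inj.
have cp : (p : nat -> P) \in is_cauchy.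
  apply/asboolP => e e0; have e16 : 0 < e / 16 by rewrite divr_gt0.
  have [N1 N1P] := cu _ e16; have [N2 N2P] := eventually_invS e16.
  exists (maxn N1 N2) => m n; rewrite !geq_max => /andP[m1 m2] /andP[n1 n2].
  rewrite -tcB -(subrKA (u n)) -[to_completion (p m) - u n](subrKA (u m)).
  rewrite (le_lt_trans (sqnD_le _ _))//.
  have := sqnD_le (to_completion (p m) - u m) (u m - u n).
  have := N1P _ _ m1 n1; have := N2P _ m2; have := N2P _ n2; have := pP m; have := pP n.
  by rewrite (sqnBC _ (u m)); lra.
exists (CauchySeq cp : completion_pre) => e e0; have e4 : 0 < e / 4 by rewrite divr_gt0.
have [N1 N1P] := to_completion_approx (CauchySeq cp : completion_pre) e4.
have [N2 N2P] := eventually_invS e4.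
exists (maxn N1 N2) => n; rewrite !geq_max => /andP[n1 n2].
rewrite -(subrKA (to_completion (p n))) (le_lt_trans (sqnD_le _ _))//.
by have := N1P _ n1; have := N2P _ n2; have := pP n; rewrite (sqnBC _ (u n)) /=; lra.
Qed.

Definition completion : hilbert R := Hilbert completion_complete.

End completion.


(** * Elementary facts on C*-algebras *)
Definition rscale {R : realType} {V : lmodType R[i]} (t : R) (x : V) : V := (t%:C)%C *: x.

Lemma normR_real {R : realType} (t : R) : normR ((t%:C)%C : R[i]^o) = `|t|.
Proof. by apply: complexI; rewrite -normRE normc_def /= expr0n addr0 sqrtr_sqr. Qed.

Lemma normR_i {R : realType} : normR ('i%C : R[i]^o) = 1.
Proof. by apply: complexI; rewrite -normRE normc_def /= expr0n expr1n add0r sqrtr1. Qed.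

Section normR_more.
Context {R : realType} {V : normedModType R[i]}.
Implicit Types x y : V.

Lemma normR_rscale (t : R) x : normR (rscale t x) = `|t| * normR x.
Proof. by rewrite normRZ normR_real. Qed.

Lemma normRN x : normR (- x) = normR x.
Proof. by apply: complexI; rewrite -!normRE normrN. Qed.

Lemma normRB x y : normR (x - y) <= normR x + normR y.
Proof. by rewrite (le_trans (normRD _ _))// normRN. Qed.

Lemma normR_small_eq0 x : (forall e, 0 < e -> normR x <= e) -> x = 0.
Proof.
move=> h; apply: normR_eq0; apply/le_anti; rewrite normR_ge0 andbT.
by apply/ler_addgt0Pr => e e0; rewrite add0r h.
Qed.

End normR_more.

Lemma banach_cauchy {R : realType} {V : completeNormedModType R[i]} (u : nat -> V) :
  (forall e, 0 < e -> exists N, forall m n, (N <= m)%N -> (N <= n)%N ->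
     normR (u m - u n) <= e) ->
  exists l, forall e, 0 < e -> exists N, forall n, (N <= n)%N -> normR (l - u n) <= e.
Proof.
move=> cu.
have eE (e : R[i]) : 0 < e -> e = ((complex.Re e)%:C)%C /\ 0 < complex.Re e.
  move=> e0; suff eE : e = ((complex.Re e)%:C)%C by split=> //; rewrite -ltcR -eE.
  by move: e0; case: (e) => a b; rewrite ltcE/= => /andP[/eqP-> _].
have /cvg_ex[l /cvgrPdist_le lP] : cvg (u @ \oo).
  apply: cauchy_cvg; apply/cauchyP => e /eE[-> e0].
  have [|N NP] := cu (complex.Re e / 2); first by rewrite divr_gt0.
  exists (u N); exists N => // n /= Nn; rewrite -ball_normE/= normRE ltcR.
  by rewrite (le_lt_trans (NP _ _ (leqnn N) Nn))//; lra.
exists l => e e0; have [|N _ NP] := lP ((e%:C)%C); first by rewrite ltcR.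
by exists N => n Nn; have := NP n Nn; rewrite normRE lecR.
Qed.


Local Notation "a ** b" := (cmul a b) (at level 40, left associativity).

Section cstar_basic.
Context {R : realType} {A : cstarAlgType R}.
Implicit Types a b x y : A.

Lemma normR_cmul a b : normR (a ** b) <= normR a * normR b.
Proof. by rewrite -lecR rmorphM/= -!normRE; exact: ler_norm_cmul. Qed.

Lemma normR_cstar_cmul a : normR (cstar a ** a) = normR a ^+ 2.
Proof. by apply: complexI; rewrite rmorphXn/= -!normRE; exact: norm_cstar_cmul. Qed.

Lemma normR_cstar_le a : normR a <= normR (cstar a).
Proof.
have [->|a0] := eqVneq a 0; first by rewrite normR0 normR_ge0.
have n0 := normR_gt0 a0; rewrite -(ler_pM2r n0) -expr2 -normR_cstar_cmul.
exact: normR_cmul.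
Qed.

Lemma normR_cstar a : normR (cstar a) = normR a.
Proof. by apply/le_anti; rewrite normR_cstar_le -{2}[a]cstarK normR_cstar_le. Qed.

Lemma cmul0l a : 0 ** a = 0.
Proof. by have := cmulZl (0 : R[i]) 0 a; rewrite !scale0r. Qed.
Lemma cmul0r a : a ** 0 = 0.
Proof. by have := cmulZr (0 : R[i]) a 0; rewrite !scale0r. Qed.
Lemma cmulNl a b : (- a) ** b = - (a ** b).
Proof. by rewrite -scaleN1r cmulZl scaleN1r. Qed.
Lemma cmulNr a b : a ** (- b) = - (a ** b).
Proof. by rewrite -scaleN1r cmulZr scaleN1r. Qed.
Lemma cstar0 : cstar (0 : A) = 0.
Proof. by have := cstarZ (0 : R[i]) (0 : A); rewrite rmorph0 !scale0r. Qed.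
Lemma cstarN a : cstar (- a) = - cstar a.
Proof. by rewrite -scaleN1r cstarZ rmorphN1 scaleN1r. Qed.
Lemma conj_real (t : R) : (t%:C)%C^* = (t%:C)%C :> R[i].
Proof. exact: conjc_real. Qed.
Lemma cstar_rscale (t : R) a : cstar (rscale t a) = rscale t (cstar a).
Proof. by rewrite /rscale cstarZ conj_real. Qed.
Lemma cmul_rscalel (t : R) a b : rscale t a ** b = rscale t (a ** b).
Proof. exact: cmulZl. Qed.
Lemma cmul_rscaler (t : R) a b : a ** rscale t b = rscale t (a ** b).
Proof. exact: cmulZr. Qed.

(** Take [y = x*] and use the C*-identity.  This replaces the unit in proofs of
    equality. *)
Lemma cmul_eq0 x : (forall y, y ** x = 0) -> x = 0.
Proof.
move=> /(_ (cstar x)) /(congr1 (@normR R A)); rewrite normR_cstar_cmul normR0 => /eqP.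
by rewrite sqrf_eq0 => /eqP; exact: normR_eq0.
Qed.

Lemma cmul_inj x y : (forall z, z ** x = z ** y) -> x = y.
Proof.
move=> xy; apply/eqP; rewrite -subr_eq0; apply/eqP/cmul_eq0 => z.
by rewrite cmulDr cmulNr xy subrr.
Qed.

End cstar_basic.

Section multiplier.
Context {R : realType} {A : cstarAlgType R}.

(** Multipliers as adjointable maps: existence of an adjoint for the pairing
    [x, y |-> x* y] already forces additivity, homogeneity and compatibility
    with the right multiplication, so these are not recorded.  The multipliers
    form a unital C*-algebra that contains [A] by left multiplications. *)
Record mult := Mult {
  mfun :> A -> A ;
  madj : A -> A ;
  mult_adj : forall x y, cstar (mfun x) ** y = cstar x ** madj y ;
  mult_bnd : exists2 c : R, 0 <= c & forall x, normR (mfun x) <= c * normR x }.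
Implicit Types L M N : mult.

Lemma mult_adj_sym L x y : cstar (madj L x) ** y = cstar x ** L y.
Proof. by rewrite -[LHS]cstarK cstarM cstarK -mult_adj cstarM cstarK. Qed.

Lemma mult_ext L M : (forall x, L x = M x) -> L = M.
Proof.
move=> LM; case: L M LM => [f f' fP fb] [g g' gP gb]/= /funext fg; subst g.
have f'g' : f' = g'.
  apply/funext => z; apply: cmul_inj => w.
  by rewrite -[w]cstarK -fP -gP.
by subst g'; congr Mult; exact: Prop_irrelevance.
Qed.

End multiplier.


(** * The algebra of multipliers *)
#[local] Obligation Tactic := idtac.

Section multiplier_ring.
Context {R : realType} {A : cstarAlgType R}.
Local Notation mult := (@mult R A).
Implicit Types (L M N : mult) (x y z : A).

Lemma mult_pair L x y : x ** L y = cstar (madj L (cstar x)) ** y.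
Proof. by rewrite mult_adj_sym cstarK. Qed.

Lemma multD L x y : L (x + y) = L x + L y.
Proof. by apply: cmul_inj => z; rewrite cmulDr !mult_pair cmulDr. Qed.

Lemma multZ L (k : R[i]) x : L (k *: x) = k *: L x.
Proof. by apply: cmul_inj => z; rewrite cmulZr !mult_pair cmulZr. Qed.

Lemma multN L x : L (- x) = - L x.
Proof. by rewrite -scaleN1r multZ scaleN1r. Qed.

HB.instance Definition _ := gen_eqMixin mult.
HB.instance Definition _ := gen_choiceMixin mult.

Program Definition zero_mult : mult := @Mult R A (fun=> 0) (fun=> 0) _ _.
Next Obligation. by move=> x y /=; rewrite cstar0 cmul0l cmul0r. Qed.
Next Obligation. by exists 0 => // x /=; rewrite normR0 mul0r. Qed.

Program Definition opp_mult L : mult :=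
  @Mult R A (fun x => - L x) (fun x => - madj L x) _ _.
Next Obligation. by move=> L x y /=; rewrite cstarN cmulNl mult_adj cmulNr. Qed.
Next Obligation.
by move=> L; have [c c0 cP] := mult_bnd L; exists c => // x /=; rewrite normRN.
Qed.

Program Definition add_mult L M : mult :=
  @Mult R A (fun x => L x + M x) (fun x => madj L x + madj M x) _ _.
Next Obligation. by move=> L M x y /=; rewrite cstarD cmulDl !mult_adj cmulDr. Qed.
Next Obligation.
move=> L M; have [c c0 cP] := mult_bnd L; have [d d0 dP] := mult_bnd M.
exists (c + d) => [|x /=]; first exact: addr_ge0.
by rewrite (le_trans (normRD _ _))// mulrDl lerD.
Qed.

Program Definition one_mult : mult := @Mult R A id id _ _.
Next Obligation. by []. Qed.
Next Obligation. by exists 1 => // x /=; rewrite mul1r. Qed.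

Program Definition mul_mult L M : mult :=
  @Mult R A (fun x => L (M x)) (fun x => madj M (madj L x)) _ _.
Next Obligation. by move=> L M x y /=; rewrite !mult_adj. Qed.
Next Obligation.
move=> L M; have [c c0 cP] := mult_bnd L; have [d d0 dP] := mult_bnd M.
exists (c * d) => [|x /=]; first exact: mulr_ge0.
by rewrite (le_trans (cP _))// -mulrA ler_wpM2l.
Qed.

Program Definition scale_mult (t : R) L : mult :=
  @Mult R A (fun x => rscale t (L x)) (fun x => rscale t (madj L x)) _ _.
Next Obligation.
by move=> t L x y /=; rewrite cstar_rscale cmul_rscalel mult_adj cmul_rscaler.
Qed.
Next Obligation.
move=> t L; have [c c0 cP] := mult_bnd L.
exists (`|t| * c) => [|x /=]; first exact: mulr_ge0.
by rewrite normR_rscale -mulrA ler_wpM2l.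
Qed.

Program Definition star L : mult := @Mult R A (madj L) L _ _.
Next Obligation. exact: mult_adj_sym. Qed.
Next Obligation.
move=> L; have [c c0 cP] := mult_bnd L; exists c => // y /=.
have [->|z0] := eqVneq (madj L y) 0; first by rewrite normR0 mulr_ge0 ?normR_ge0.
have n0 := normR_gt0 z0; rewrite -(ler_pM2r n0) -expr2 -normR_cstar_cmul.
rewrite -mult_adj (le_trans (normR_cmul _ _))// normR_cstar.
by rewrite mulrAC ler_wpM2r ?normR_ge0.
Qed.

(** Multiplication by the imaginary unit, a central element: the multipliers are
    treated as an algebra over the reals. *)
Program Definition Jmult : mult := @Mult R A (fun x => 'i%C *: x) (fun x => - 'i%C *: x) _ _.
Next Obligation.
move=> x y /=; rewrite cstarZ cmulZl cmulZr; congr (_ *: _).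
by apply/eqP; rewrite eq_complex /= oppr0 !eqxx.
Qed.
Next Obligation. by exists 1 => // x /=; rewrite normRZ normR_i. Qed.

Program Definition lmult (a : A) : mult := @Mult R A (cmul a) (cmul (cstar a)) _ _.
Next Obligation. by move=> a x y /=; rewrite cstarM cmulA. Qed.
Next Obligation. by move=> a; exists (normR a); [exact: normR_ge0|move=> x; exact: normR_cmul]. Qed.

Fact add_multA : associative add_mult.
Proof. by move=> L M N; apply: mult_ext => x /=; rewrite addrA. Qed.
Fact add_multC : commutative add_mult.
Proof. by move=> L M; apply: mult_ext => x /=; rewrite addrC. Qed.
Fact add_mult0 : left_id zero_mult add_mult.
Proof. by move=> L; apply: mult_ext => x /=; rewrite add0r. Qed.
Fact add_multN : left_inverse zero_mult opp_mult add_mult.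
Proof. by move=> L; apply: mult_ext => x /=; rewrite addNr. Qed.
HB.instance Definition _ := GRing.isZmodule.Build mult add_multA add_multC add_mult0 add_multN.

Fact mul_multA : associative mul_mult.
Proof. by move=> L M N; exact: mult_ext. Qed.
Fact mul_mult1l : left_id one_mult mul_mult.
Proof. by move=> L; exact: mult_ext. Qed.
Fact mul_mult1r : right_id one_mult mul_mult.
Proof. by move=> L; exact: mult_ext. Qed.
Fact mul_multDl : left_distributive mul_mult +%R.
Proof. by move=> L M N; exact: mult_ext. Qed.
Fact mul_multDr : right_distributive mul_mult +%R.
Proof. by move=> L M N; apply: mult_ext => x; exact: multD. Qed.
HB.instance Definition _ := GRing.Zmodule_isPzRing.Build mult
  mul_multA mul_mult1l mul_mult1r mul_multDl mul_multDr.

Fact scale_multA (s t : R) L : scale_mult s (scale_mult t L) = scale_mult (s * t) L.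
Proof. by apply: mult_ext => x /=; rewrite /rscale scalerA rmorphM. Qed.
Fact scale_mult1 : left_id 1 scale_mult.
Proof. by move=> L; apply: mult_ext => x /=; rewrite /rscale rmorph1 scale1r. Qed.
Fact scale_multDr : right_distributive scale_mult +%R.
Proof. by move=> t L M; apply: mult_ext => x; exact: scalerDr. Qed.
Fact scale_multDl L : {morph scale_mult^~ L : s t / s + t}.
Proof. by move=> s t; apply: mult_ext => x /=; rewrite /rscale rmorphD scalerDl. Qed.
HB.instance Definition _ := GRing.Zmodule_isLmodule.Build R mult
  scale_multA scale_mult1 scale_multDr scale_multDl.

Lemma mult_scaleAl (t : R) L M : t *: (L * M) = (t *: L) * M.
Proof. exact: mult_ext. Qed.
Lemma mult_scaleAr (t : R) L M : t *: (L * M) = L * (t *: M).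
Proof. by apply: mult_ext => x; rewrite /= [RHS]multZ. Qed.

Lemma starK L : star (star L) = L.
Proof. exact: mult_ext. Qed.
Lemma starD L M : star (L + M) = star L + star M.
Proof. exact: mult_ext. Qed.
Lemma starN L : star (- L) = - star L.
Proof. exact: mult_ext. Qed.
Lemma starB L M : star (L - M) = star L - star M.
Proof. exact: mult_ext. Qed.
Lemma starM L M : star (L * M) = star M * star L.
Proof. exact: mult_ext. Qed.
Lemma starZ (t : R) L : star (t *: L) = t *: star L.
Proof. exact: mult_ext. Qed.
Lemma star1 : star 1 = 1.
Proof. exact: mult_ext. Qed.
Lemma star0 : star 0 = 0.
Proof. exact: mult_ext. Qed.
Lemma starJ : star Jmult = - Jmult.
Proof. by apply: mult_ext => x /=; rewrite scaleNr. Qed.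
Lemma JJ : Jmult * Jmult = - 1.
Proof.
apply: mult_ext => x /=; rewrite scalerA -scaleN1r; congr (_ *: _).
by rewrite -expr2 sqr_i.
Qed.
Lemma JC L : Jmult * L = L * Jmult.
Proof. by apply: mult_ext => x /=; rewrite multZ. Qed.
Lemma star_lmult a : star (lmult a) = lmult (cstar a).
Proof. exact: mult_ext. Qed.
Lemma lmultM a b : lmult (a ** b) = lmult a * lmult b.
Proof. by apply: mult_ext => x /=; rewrite cmulA. Qed.
Lemma lmultD a b : lmult (a + b) = lmult a + lmult b.
Proof. by apply: mult_ext => x /=; rewrite cmulDl. Qed.
Lemma lmultZ (t : R) a : lmult (rscale t a) = t *: lmult a.
Proof. by apply: mult_ext => x /=; rewrite cmul_rscalel. Qed.

(** [bnd L c] expresses that the operator norm of [L] is at most [c], without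
    reference to a supremum. *)
Definition bnd L (c : R) := forall x, normR (L x) <= c * normR x.

Lemma bnd_ex L : exists2 c, 0 < c & bnd L c.
Proof.
have [c c0 cP] := mult_bnd L; exists (c + 1) => [|x]; first by rewrite ltr_wpDl.
by rewrite (le_trans (cP x))// ler_wpM2r ?normR_ge0// lerDl.
Qed.

Lemma bnd_le L c d : c <= d -> bnd L c -> bnd L d.
Proof. by move=> cd Lc x; rewrite (le_trans (Lc x))// ler_wpM2r ?normR_ge0. Qed.
Lemma bndD L M c d : bnd L c -> bnd M d -> bnd (L + M) (c + d).
Proof. by move=> Lc Md x; rewrite (le_trans (normRD _ _))// mulrDl lerD. Qed.
Lemma bndN L c : bnd L c -> bnd (- L) c.
Proof. by move=> Lc x; rewrite normRN. Qed.
Lemma bndB L M c d : bnd L c -> bnd M d -> bnd (L - M) (c + d).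
Proof. by move=> Lc Md; apply: bndD => //; exact: bndN. Qed.
Lemma bndBC L M c : bnd (L - M) c -> bnd (M - L) c.
Proof. by move=> /bndN; rewrite opprB. Qed.
Lemma bndM L M c d : 0 <= c -> bnd L c -> bnd M d -> bnd (L * M) (c * d).
Proof.
by move=> c0 Lc Md x; rewrite (le_trans (Lc _))// -mulrA ler_wpM2l.
Qed.
Lemma bndZ (t : R) L c : bnd L c -> bnd (t *: L) (`|t| * c).
Proof. by move=> Lc x; rewrite /= normR_rscale -mulrA ler_wpM2l. Qed.
Lemma bnd1 : bnd 1 1.
Proof. by move=> x; rewrite mul1r. Qed.
Lemma bnd0 : bnd 0 0.
Proof. by move=> x; rewrite normR0 mul0r. Qed.
Lemma bnd_scalar (t : R) : bnd (t *: (1 : mult)) `|t|.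
Proof. by rewrite -[X in bnd _ X]mulr1; exact: bndZ bnd1. Qed.

(** From [|L* y|^2 = |y* L (L* y)|], after division by [|L* y|]. *)
Lemma bnd_star L c : bnd L c -> bnd (star L) c.
Proof.
move=> cP y.
have [->|z0] := eqVneq (star L y) 0.
  have [->|y0] := eqVneq y 0; first by rewrite normR0 mulr0.
  rewrite normR0 mulr_ge0 ?normR_ge0//.
  have := le_trans (normR_ge0 _) (cP y).
  by rewrite pmulr_lge0//; exact: normR_gt0.
have n0 := normR_gt0 z0; rewrite -(ler_pM2r n0) -expr2 -normR_cstar_cmul.
rewrite [star L y]/= -mult_adj (le_trans (normR_cmul _ _))// normR_cstar.
by rewrite mulrAC ler_wpM2r ?normR_ge0.
Qed.

(** The C*-identity for multipliers, [|L x|^2 = |x* (L* L) x|]. *)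
Lemma bnd_sq L c : 0 <= c -> bnd (star L * L) (c ^+ 2) -> bnd L c.
Proof.
move=> c0 LL x; rewrite -(@ler_pXn2r _ 2)// ?nnegrE ?mulr_ge0 ?normR_ge0//.
rewrite -normR_cstar_cmul mult_adj (le_trans (normR_cmul _ _))// normR_cstar.
have := LL x; have := normR_ge0 x; rewrite [_ x]/= => x0 LLx.
by rewrite mulrC exprMn [_ x ^+ 2]expr2 mulrA ler_wpM2r.
Qed.

Lemma bnd_limit L c : (forall e, 0 < e -> bnd L (c + e)) -> bnd L c.
Proof.
move=> h x; apply/ler_addgt0Pr => e e0.
have x1 : 0 < normR x + 1 by rewrite ltr_wpDl ?normR_ge0.
rewrite (le_trans (h _ (divr_gt0 e0 x1) x))// mulrDl lerD2l mulrAC ler_pdivrMr//.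
by rewrite ler_wpM2l ?(ltW e0)// lerDl.
Qed.

Lemma bnd0_eq0 L : bnd L 0 -> L = 0.
Proof.
move=> h; apply: mult_ext => x; apply: normR_eq0; apply/le_anti.
by rewrite normR_ge0 andbT (le_trans (h x))// mul0r.
Qed.

Lemma bnd_small_eq0 L : (forall e, 0 < e -> bnd L e) -> L = 0.
Proof. by move=> h; apply/bnd0_eq0/bnd_limit => e; rewrite add0r; exact: h. Qed.

Lemma star_mul_eq0 L : star L * L = 0 -> L = 0.
Proof. by move=> LL; apply/bnd0_eq0/bnd_sq; rewrite // LL expr0n; exact: bnd0. Qed.

Lemma bnd_lmult a : bnd (lmult a) (normR a).
Proof. by move=> x; exact: normR_cmul. Qed.

Lemma bnd_lmult_le a c : 0 <= c -> bnd (lmult a) c -> normR a <= c.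
Proof.
move=> c0 /bnd_star; rewrite star_lmult => /(_ a)/=.
rewrite normR_cstar_cmul expr2.
have [->|a0] := eqVneq a 0; first by rewrite normR0.
by rewrite ler_pM2r ?normR_gt0.
Qed.

(** A Cauchy sequence of multipliers converges pointwise, together with the
    sequence of adjoints, and adjointness passes to the limit. *)
Lemma mult_complete (u : nat -> mult) :
  (forall e, 0 < e -> exists N : nat, forall m n, (N <= m)%N -> (N <= n)%N -> bnd (u m - u n) e) ->
  exists l, forall e, 0 < e -> exists N : nat, forall n, (N <= n)%N -> bnd (l - u n) e.
Proof.
have lim (v : nat -> mult) :
  (forall e, 0 < e -> exists N : nat, forall m n, (N <= m)%N -> (N <= n)%N -> bnd (v m - v n) e) ->
  exists l : A -> A, forall e, 0 < e -> exists N : nat, forall n, (N <= n)%N -> forall x,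
    normR (l x - v n x) <= e * normR x.
  move=> cv.
  have /choice[l lP] : forall x, exists y, forall e, 0 < e -> exists N : nat, forall n, (N <= n)%N ->
      normR (y - v n x) <= e.
    move=> x; apply: banach_cauchy => e e0.
    have x1 : 0 < normR x + 1 by rewrite ltr_wpDl ?normR_ge0.
    have [N NP] := cv _ (divr_gt0 e0 x1); exists N => m n Nm Nn.
    rewrite (le_trans (NP m n Nm Nn x))// mulrAC ler_pdivrMr//.
    by rewrite ler_wpM2l ?(ltW e0)// lerDl.
  exists l => e e0; have [N NP] := cv _ e0; exists N => n Nn x.
  apply/ler_addgt0Pr => d d0; have [N' N'P] := lP x _ d0.
  rewrite -(subrKA (v (maxn N N') x)) addrC (le_trans (normRD _ _))// lerD//.
    by apply: (NP (maxn N N') n) => //; exact: leq_maxl.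
  by apply: N'P; exact: leq_maxr.
move=> cu; have [l lP] := lim u cu.
have [|l' l'P] := lim (fun n => star (u n)).
  move=> e /cu[N NP]; exists N => m n Nm Nn.
  by rewrite -starB; apply: bnd_star; exact: NP.
have adj x y : cstar (l x) ** y = cstar x ** l' y.
  apply/eqP; rewrite -subr_eq0; apply/eqP/normR_small_eq0 => e e0.
  set c := 2 * normR x * normR y + 1.
  have c0 : 0 < c by rewrite ltr_wpDl// !mulr_ge0 ?normR_ge0.
  have [N NP] := lP _ (divr_gt0 e0 c0); have [N' N'P] := l'P _ (divr_gt0 e0 c0).
  set n := maxn N N'.
  have := NP n (leq_maxl _ _) x; have := N'P n (leq_maxr _ _) y => h1 h2.
  have -> : cstar (l x) ** y - cstar x ** l' y =
      cstar (l x - u n x) ** y - cstar x ** (l' y - star (u n) y).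
    rewrite cmulDr cmulNr cstarD cmulDl cstarN cmulNl mult_adj opprB.
    by rewrite addrA subrK.
  apply: (le_trans (normRB _ _)); apply: (@le_trans _ _ (e / c * normR x * normR y + normR x * (e / c * normR y))).
    apply: lerD; apply: (le_trans (normR_cmul _ _)); rewrite normR_cstar.
      by rewrite ler_wpM2r ?normR_ge0.
    by rewrite ler_wpM2l ?normR_ge0.
  have -> : e / c * normR x * normR y + normR x * (e / c * normR y) = e * (2 * normR x * normR y) / c by ring.
  by rewrite ler_pdivrMr// ler_wpM2l ?(ltW e0)// /c lerDl.
have lb : exists2 c : R, 0 <= c & forall x, normR (l x) <= c * normR x.
  have [N /(_ N (leqnn N)) NP] := lP _ ltr01; have [c c0 cP] := mult_bnd (u N).
  exists (1 + c) => [|x]; first by rewrite addr_ge0.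
  by rewrite -[l x](subrK (u N x)) (le_trans (normRD _ _))// mulrDl lerD.
by exists (Mult adj lb) => e /lP[N NP]; exists N.
Qed.

End multiplier_ring.


(** * Positive multipliers and their square roots *)
(** [ncring] proves identities in a noncommutative ring: it expands both sides
    into signed monomials and cancels these in pairs, moving the last monomial
    to the left until it meets its opposite. *)
Ltac ncring_neg t :=
  first [rewrite (addrK t) | rewrite (subrr t) | rewrite (addrAC _ _ (- t)); ncring_neg t].
Ltac ncring_pos t :=
  first [rewrite (subrK t) | rewrite (addNr t) | rewrite (addrAC _ _ t); ncring_pos t].
Ltac ncring_step :=
  match goal with
  | |- ?S - ?t = 0 => ncring_neg t
  | |- ?S + ?t = 0 => ncring_pos t
  end; rewrite ?add0r.
Ltac ncring_expand :=
  rewrite ?(mulrDl, mulrDr, mulNr, mulrN, opprD, opprK, addrA, mulrA, mul1r, mulr1,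
    mul0r, mulr0, oppr0, addr0, add0r).
Ltac ncring :=
  apply/eqP; rewrite -subr_eq0; apply/eqP; ncring_expand;
  repeat ncring_step; try reflexivity.

Section sqrt_scalar.
Context {R : realType}.

(** The scalar case [g = 1] of the iteration [sqrt_iter] below.  It increases to
    1, and its increments dominate the norms of the increments of [sqrt_iter]
    when [|g| <= 1], including the case [|g| = 1] where the iteration has no
    contraction constant. *)
Fixpoint sqrt_majorant (n : nat) : R :=
  if n is n'.+1 then (1 + sqrt_majorant n' ^+ 2) / 2 else 0.
Local Notation tau := sqrt_majorant.

Lemma sqrt_majorant_itv n : 0 <= tau n <= 1.
Proof.
elim: n => [|n /andP[t0 t1]] /=; first by rewrite lexx ler01.
by apply/andP; split; nra.
Qed.

Lemma sqrt_majorant_nondecreasing m n : (m <= n)%N -> tau m <= tau n.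
Proof.
move=> /subnK <-; elim: (n - m)%N => // k IH; apply: (le_trans IH).
rewrite addSn /=; have := sqr_ge0 (tau (k + m) - 1); lra.
Qed.

Lemma sqrt_majorant_cauchy e : 0 < e ->
  exists N : nat, forall n, (N <= n)%N -> tau n - tau N <= e.
Proof.
move=> e0; have ub : ubound (range tau) 1.
  by move=> _ [n _ <-]; have /andP[] := sqrt_majorant_itv n.
have sup : has_sup (range tau) by split; [exists (tau 0), 0%N|exists 1].
have [_ [N _ <-] NP] := sup_adherent e0 sup.
exists N => n _; have : tau n <= reals.sup (range tau) by apply: ub_le_sup; [exists 1|exists n].
lra.
Qed.

End sqrt_scalar.

Section positive.
Context {R : realType} {A : cstarAlgType R}.
Local Notation mult := (@mult R A).
Local Notation J := (@Jmult R A).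
Local Notation "t %:S" := (t *: (1 : mult)) (at level 1, format "t %:S").
Implicit Types (g h k u v w x y L M : mult).

Lemma scalMl (t : R) L : t%:S * L = t *: L.
Proof. by rewrite -mult_scaleAl mul1r. Qed.
Lemma scalMr (t : R) L : L * t%:S = t *: L.
Proof. by rewrite -mult_scaleAr mulr1. Qed.
Lemma star_scal (t : R) : star t%:S = t%:S.
Proof. by rewrite starZ star1. Qed.

Lemma commZ (t : R) k h : GRing.comm k h -> GRing.comm k (t *: h).
Proof. by move=> kh; rewrite /GRing.comm -mult_scaleAr kh mult_scaleAl. Qed.
Lemma commS (t : R) k : GRing.comm k t%:S.
Proof. by rewrite /GRing.comm scalMl scalMr. Qed.

Lemma half_double h : 2^-1 *: (h + h) = h.
Proof. by rewrite scalerDr -scalerDl (_ : 2^-1 + 2^-1 = 1 :> R) ?scale1r//; field. Qed.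

Fixpoint sqrt_iter g (n : nat) : mult :=
  if n is n'.+1 then 2^-1 *: (g + sqrt_iter g n' * sqrt_iter g n') else 0.

Lemma bnd_half L c : bnd L c -> bnd (2^-1 *: L) (c / 2).
Proof. by move=> /(@bndZ _ _ 2^-1); rewrite ger0_norm ?invr_ge0 ?ler0n// mulrC. Qed.

Lemma sqrt_iter_bnd g n : bnd g 1 -> bnd (sqrt_iter g n) (sqrt_majorant n).
Proof.
move=> g1; elim: n => [|n IH] /=; first exact: bnd0.
have /andP[t0 _] := @sqrt_majorant_itv R n.
by apply/bnd_half/bndD => //; rewrite expr2; exact: bndM.
Qed.

Lemma sqrt_iter_dist g m n : bnd g 1 -> (n <= m)%N ->
  bnd (sqrt_iter g m - sqrt_iter g n) (sqrt_majorant m - sqrt_majorant n).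
Proof.
move=> g1; elim: n m => [|n IH] [|m] //= nm; rewrite ?subr0 ?subrr.
- exact: bnd0.
- exact: (@sqrt_iter_bnd g m.+1).
rewrite -scalerBr opprD addrACA subrr add0r.
have := IH _ nm; set a := sqrt_iter g m; set b := sqrt_iter g n.
set s := sqrt_majorant m; set t := sqrt_majorant n => ab.
have /andP[s0 _] := @sqrt_majorant_itv R m.
have st : 0 <= s - t by rewrite subr_ge0 sqrt_majorant_nondecreasing.
have -> : a * a - b * b = a * (a - b) + (a - b) * b.
  by rewrite mulrBr mulrBl addrA subrK.
have -> : (1 + s ^+ 2) / 2 - (1 + t ^+ 2) / 2 = (s * (s - t) + (s - t) * t) / 2 by ring.
by apply/bnd_half/bndD; apply: bndM => //; exact: sqrt_iter_bnd.
Qed.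

Lemma mult_limit_star (u : nat -> mult) l :
  (forall n, star (u n) = u n) ->
  (forall e, 0 < e -> exists N : nat, forall n, (N <= n)%N -> bnd (l - u n) e) ->
  star l = l.
Proof.
move=> su lP; apply/eqP; rewrite -subr_eq0; apply/eqP/bnd_small_eq0 => e e0.
have e2 : 0 < e / 2 by rewrite divr_gt0.
have [N /(_ N (leqnn N)) h] := lP _ e2.
have -> : star l - l = star (l - u N) - (l - u N) by rewrite starB su opprB addrA subrK.
by rewrite [e]splitr; apply: bndB => //; exact: bnd_star.
Qed.

Lemma mult_limit_comm (u : nat -> mult) l k :
  (forall n, GRing.comm k (u n)) ->
  (forall e, 0 < e -> exists N : nat, forall n, (N <= n)%N -> bnd (l - u n) e) ->
  GRing.comm k l.
Proof.
move=> ku lP; apply/eqP; rewrite -subr_eq0; apply/eqP/bnd_small_eq0 => e e0.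
have [c c0 kc] := bnd_ex k.
have e2 : 0 < e / (2 * c) by rewrite divr_gt0// mulr_gt0.
have [N /(_ N (leqnn N)) h] := lP _ e2.
have -> : k * l - l * k = k * (l - u N) - (l - u N) * k.
  by rewrite mulrBr mulrBl opprB ku addrA subrK.
have -> : e = c * (e / (2 * c)) + e / (2 * c) * c by field; rewrite gt_eqF.
by apply: bndB; apply: bndM => //; exact: ltW.
Qed.

(** The limit [s] of the iteration satisfies [2 s = g + s^2], that is
    [(1 - s)^2 = 1 - g]: it provides the square root [1 - s] of [1 - g].  Being a
    limit of polynomials in [g], it commutes with what commutes with [g]. *)
Lemma sqrt_near_one g : star g = g -> bnd g 1 ->
  exists s, [/\ star s = s, bnd s 1, s + s = g + s * s &
    forall k, GRing.comm k g -> GRing.comm k s].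
Proof.
move=> sg g1; pose u := sqrt_iter g; pose t := @sqrt_majorant R.
have u1 n : bnd (u n) 1.
  by apply: bnd_le (sqrt_iter_bnd n g1); have /andP[] := @sqrt_majorant_itv R n.
have [|s sP] := @mult_complete R A u.
  move=> e e0; have e2 : 0 < e / 2 by rewrite divr_gt0.
  have [N NP] := sqrt_majorant_cauchy e2.
  exists N => m n Nm Nn; rewrite -(subrKA (u N)) [e]splitr; apply: bndD.
    by apply: bnd_le (sqrt_iter_dist g1 Nm); exact: NP.
  by apply/bndBC; apply: bnd_le (sqrt_iter_dist g1 Nn); exact: NP.
have su n : star (u n) = u n.
  by elim: n => [|n IH]; rewrite /u /= ?star0// starZ starD sg starM IH.
have s1 : bnd s 1.
  apply: bnd_limit => e /sP[N /(_ N (leqnn N))] h.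
  by rewrite -[s](subrK (u N)) [1 + e]addrC; exact: bndD.
exists s; split=> //.
- exact: mult_limit_star su sP.
- apply/eqP; rewrite -subr_eq0; apply/eqP/bnd_small_eq0 => e e0.
  have e6 : 0 < e / 6 by rewrite divr_gt0.
  have [N NP] := sP _ e6.
  have h := NP N (leqnn N); have h' := NP N.+1 (leqnSn N).
  have uS : u N.+1 + u N.+1 = g + u N * u N.
    by rewrite {1 2}/u /= -scalerDr half_double.
  have -> : s + s - (g + s * s) =
      (s - u N.+1) + (s - u N.+1) - (s * (s - u N) + (s - u N) * u N).
    have -> : g = u N.+1 + u N.+1 - u N * u N by rewrite uS addrK.
    by ncring.
  apply: bnd_le (_ : (e / 6 + e / 6) + (1 * (e / 6) + e / 6 * 1) <= e) _; first by lra.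
  by apply: bndB; apply: bndD => //; apply: bndM => //; exact: ltW.
- move=> k kg; apply: mult_limit_comm sP => n.
  elim: n => [|n IH]; rewrite /u /=; first exact: commr0.
  by apply/commZ/commrD => //; exact: commrM.
Qed.

(** Positivity expressed by the norm: a self-adjoint element is positive when its
    distance to some scalar [T > 0] is at most [T].  In this form positive elements are
    visibly stable under sums, and their square roots come from
    [sqrt_near_one]. *)
Definition pos h := star h = h /\ exists2 T : R, 0 < T & bnd (T%:S - h) T.

Lemma posD h k : pos h -> pos k -> pos (h + k).
Proof.
move=> [sh [T T0 hT]] [sk [S S0 kS]]; split; first by rewrite starD sh sk.
exists (T + S); first exact: addr_gt0.
by rewrite scalerDl opprD addrACA; exact: bndD.
Qed.

Lemma pos_scal_sub h (t : R) : star h = h -> bnd h t -> 0 <= t -> pos (t%:S - h).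
Proof.
move=> sh ht t0; split; first by rewrite starB star_scal sh.
exists (1 + t) => [|]; first by rewrite ltr_pwDl.
have -> : (1 + t)%:S - (t%:S - h) = 1 + h by rewrite scalerDl scale1r; ncring.
by apply: bndD => //; exact: bnd1.
Qed.

Lemma posZ (t : R) h : 0 < t -> pos h -> pos (t *: h).
Proof.
move=> t0 [sh [T T0 hT]]; split; first by rewrite starZ sh.
exists (t * T); first exact: mulr_gt0.
by rewrite -scalerA -scalerBr -{2}(gtr0_norm t0); exact: bndZ.
Qed.

Lemma pos0 : pos 0.
Proof.
by split; [exact: star0|exists 1 => //; rewrite subr0 scale1r; exact: bnd1].
Qed.

Lemma pos_sqrt h : pos h ->
  exists u, [/\ star u = u, pos u, u * u = h & forall k, GRing.comm k h -> GRing.comm k u].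
Proof.
move=> [sh [T T0 hT]].
have TV : 0 < T^-1 by rewrite invr_gt0.
pose g := 1 - T^-1 *: h.
have gE : g = T^-1 *: (T%:S - h) by rewrite scalerBr scalerA mulVf ?gt_eqF// scale1r.
have g1 : bnd g 1.
  by rewrite gE -(mulVf (lt0r_neq0 T0)) -{2}(gtr0_norm TV); exact: bndZ.
have sg : star g = g by rewrite starB star1 starZ sh.
have [s [ss s1 s2 sc]] := sqrt_near_one sg g1.
pose r := Num.sqrt T.
have r0 : 0 < r by rewrite sqrtr_gt0.
exists (r *: (1 - s)); split.
- by rewrite starZ starB star1 ss.
- by apply: posZ => //; have := pos_scal_sub ss s1 ler01; rewrite scale1r.
- rewrite -mult_scaleAl -mult_scaleAr scalerA -expr2 sqr_sqrtr ?ltW//.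
  have -> : (1 - s) * (1 - s) = T^-1 *: h.
    have -> : T^-1 *: h = 1 - (s + s - s * s) by rewrite s2 addrK opprB addrCA subrr addr0.
    by ncring.
  by rewrite scalerA divff ?gt_eqF// scale1r.
- move=> k kh; apply/commZ; apply: commrB; first exact: commr1.
  by apply: sc; apply: commrB; [exact: commr1|exact: commZ].
Qed.

End positive.


(** * Positivity of squares *)
Section positive.
Context {R : realType} {A : cstarAlgType R}.
Local Notation mult := (@mult R A).
Local Notation J := (@Jmult R A).
Local Notation "t %:S" := (t *: (1 : mult)) (at level 1, format "t %:S").
Implicit Types (g h k u v w x y L M : mult).

(** The expansion of [|u + i v|^2]. *)
Lemma star_mul_J u v : star u = u -> star v = v ->
  star (u + J * v) * (u + J * v) = u * u + v * v + J * (u * v - v * u).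
Proof.
move=> su sv; rewrite starD starM starJ su sv.
have e1 : u * J = J * u by rewrite JC.
have e2 : v * J = J * v by rewrite JC.
have e3 : J * (J * (v * v)) = - (v * v) by rewrite mulrA JJ mulN1r.
rewrite mulrN e2 mulrBl !mulrDr !mulrA e1 -!mulrA (mulrA v J) e2 -!mulrA e3.
by rewrite !mulrN; ncring.
Qed.

(** For commuting self-adjoint [u] and [v], [u^2 + v^2 = (u + i v)* (u + i v)];
    so [|u + i v| <= c], and [u] is the real part of [u + i v]. *)
Lemma bnd_commuting_squares u v (c : R) : 0 <= c -> star u = u -> star v = v ->
  GRing.comm u v -> bnd (u * u + v * v) (c ^+ 2) -> bnd u c.
Proof.
move=> c0 su sv uv uvc; pose w := u + J * v.
have wc : bnd w c.
  by apply: bnd_sq => //; rewrite star_mul_J// uv subrr mulr0 addr0.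
have -> : u = 2^-1 *: (w + star w).
  rewrite /w starD starM starJ su sv mulrN -JC addrACA subrr addr0.
  by rewrite half_double.
have -> : c = (c + c) / 2 by field.
by apply/bnd_half/bndD => //; exact: bnd_star.
Qed.

(** If [|k| <= c], then [c^2 - k^2] has a self-adjoint square root [u] that
    commutes with [k], and [u^2 + k^2 = c^2] bounds [u] by [c], hence
    [c^2 - k^2] by [c^2]. *)
Lemma pos_sqr k : star k = k -> pos (k * k).
Proof.
move=> sk; have [c c0 kc] := bnd_ex k.
have kk : bnd (k * k) (c ^+ 2) by rewrite expr2; apply: bndM => //; exact: ltW.
have skk : star (k * k) = k * k by rewrite starM sk.
have [u [su _ uu uc]] := pos_sqrt (pos_scal_sub skk kk (sqr_ge0 c)).
split=> //; exists (c ^+ 2); first exact: exprn_gt0.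
rewrite -uu expr2; apply: bndM; [exact: ltW| |].
all: apply: (@bnd_commuting_squares _ k) => //; first exact: ltW.
all: try by apply/commr_sym/uc/commrB; [exact: commS|exact: commrM].
all: by rewrite uu subrK -[X in bnd _ X]ger0_norm ?sqr_ge0//; exact: bnd_scalar.
Qed.

(** [w = u^2] and [t - w = v^2] with [u] and [v] commuting, so [u] is bounded by
    the square root of [t]. *)
Lemma pos_bnd w (t : R) : 0 <= t -> pos w -> pos (t%:S - w) -> bnd w t.
Proof.
move=> t0 pw ptw.
have [u [su _ uu uc]] := pos_sqrt pw; have [v [sv _ vv vc]] := pos_sqrt ptw.
have ut : bnd u (Num.sqrt t).
  apply: (@bnd_commuting_squares _ v) => //; first exact: sqrtr_ge0.
    apply/vc/commrB; first exact: commS.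
    by apply/commr_sym/uc.
  by rewrite uu vv addrC subrK sqr_sqrtr// -[X in bnd _ X]ger0_norm//; exact: bnd_scalar.
rewrite -uu -(sqr_sqrtr t0) expr2; apply: bndM => //; exact: sqrtr_ge0.
Qed.

Lemma pos_opp_eq0 g : pos g -> pos (- g) -> g = 0.
Proof.
move=> pg png; apply/bnd0_eq0/pos_bnd => //.
by rewrite scale0r sub0r.
Qed.

(** For self-adjoint [g] the C*-identity reads [|g^2| = |g|^2]; iterate it. *)
Lemma bnd_exp2 g c j : 0 <= c -> star g = g -> bnd (g ^+ (2 ^ j)) (c ^+ (2 ^ j)) -> bnd g c.
Proof.
move=> c0 sg; elim: j => [|j IH]; first by rewrite expn0 !expr1.
rewrite expnS mulnC !exprM => h; apply/IH/bnd_sq; first exact: exprn_ge0.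
suff -> : star (g ^+ (2 ^ j)) = g ^+ (2 ^ j) by rewrite -expr2.
elim: (2 ^ j)%N => [|n IHn]; first by rewrite expr0 star1.
by rewrite {1}exprS starM IHn sg -exprSr.
Qed.

Lemma bernoulli (d : R) n : 0 <= d -> 1 + n%:R * d <= (1 + d) ^+ n.
Proof.
move=> d0; elim: n => [|n IH]; first by rewrite mul0r addr0 expr0.
have d1 : 0 <= 1 + d by rewrite addr_ge0.
rewrite exprS; apply: le_trans (ler_wpM2l d1 IH); rewrite -natr1.
by have := mulr_ge0 (ler0n R n) (sqr_ge0 d); lra.
Qed.

(** If [|g| = 1 + d], then [|g^m| = (1 + d)^m] for [m] a power of 2, and this
    outgrows every linear bound.  Bernoulli's inequality squared makes the growth
    quadratic, whence the exponent [2 * 2 ^ n] and the choice of [n]. *)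
Lemma bnd_linear_powers g (K : R) : star g = g -> 0 <= K ->
  (forall m, bnd (g ^+ m) (1 + m%:R * K)) -> bnd g 1.
Proof.
move=> sg K0 gK; apply: bnd_limit => d d0.
pose n := Num.bound (2 * K / d ^+ 2).
have nK : 2 * K <= n%:R * d ^+ 2.
  rewrite -ler_pdivrMr ?exprn_gt0// ltW// archi_boundP//.
  by rewrite divr_ge0 ?sqr_ge0// mulr_ge0.
have n2 : n%:R <= (2 ^ n)%:R :> R by rewrite ler_nat ltnW// ltn_expl.
apply: (@bnd_exp2 _ _ n.+1) => //; first by rewrite addr_ge0// ltW.
apply: bnd_le (gK _); rewrite expnS mulnC exprM natrM.
set N := (2 ^ n)%N in n2 *.
have N0 : 0 <= N%:R :> R by [].
have b := bernoulli N (ltW d0).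
have : (1 + N%:R * d) ^+ 2 <= ((1 + d) ^+ N) ^+ 2.
  rewrite ler_pXn2r// nnegrE; first by rewrite addr_ge0// mulr_ge0// ltW.
  by rewrite exprn_ge0// addr_ge0// ltW.
apply: le_trans.
have : 2 * K <= N%:R * d ^+ 2.
  by apply: (le_trans nK); rewrite ler_wpM2r ?sqr_ge0.
move=> /(ler_wpM2l N0); have := mulr_ge0 N0 (ltW d0); lra.
Qed.

(** Kaplansky's argument without spectral theory.  With [y = b + i c], the
    identity [y* y + y y* = 2 b^2 + 2 c^2] shows that [p = y y*] is positive;
    scale it to [|1 - p / T| <= 1].  As [y* (1 - p / T) = (1 + k^2 / T) y*], the
    products [(1 + g)^m g] with [g = k^2 / T] are bounded independently of [m].
    Summation over [m] shows that the powers of [1 + g] grow at most linearly,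
    so [|1 + g| <= 1], that is, [- g] is positive.  Since [g] is positive too, it
    vanishes. *)
Lemma star_mul_opp_sqr y k : star k = k -> star y * y = - (k * k) -> k = 0.
Proof.
move=> sk yk.
(* real and imaginary parts of y *)
pose b := 2^-1 *: (y + star y); pose c := 2^-1 *: (J * (star y - y)).
have sb : star b = b by rewrite starZ starD starK addrC.
have sc : star c = c.
  by rewrite starZ starM starB starK starJ mulrN -mulNr opprB -JC.
have Jc : J * c = 2^-1 *: (y - star y).
  by rewrite /c -mult_scaleAr mulrA JJ mulN1r opprB.
have yE : y = b + J * c.
  rewrite Jc /b -scalerDr addrACA subrr addr0; apply/esym; exact: half_double.
have syE : star y = b + J * (- c).
  rewrite mulrN Jc /b -scalerBr (_ : _ - _ = star y + star y) ?half_double//.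
  by ncring.
have sum : star y * y + y * star y = (b * b + b * b) + (c * c + c * c).
  have e1 : star y * y = b * b + c * c + J * (b * c - c * b).
    by rewrite {1 2}yE star_mul_J.
  have e2 : y * star y = b * b + c * c + J * (c * b - b * c).
    rewrite -{1}[y]starK {1 2}syE star_mul_J ?starN ?sc//.
    by congr (_ + _); [ncring|congr (J * _); ncring].
  rewrite e1 e2 addrACA -mulrDr (_ : b * c - c * b + (c * b - b * c) = 0); last by ncring.
  by rewrite mulr0 addr0 addrACA.
pose p := y * star y.
have pp : pos p.
  have -> : p = (b * b + b * b) + (c * c + c * c) + k * k.
    by rewrite -sum yk; rewrite addrAC addNr add0r.
  by do ?[apply: posD]; exact: pos_sqr.
have [_ [T T0 pT]] := pp.
have TV : 0 < T^-1 by rewrite invr_gt0.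
pose g := T^-1 *: (k * k); pose G := 1 + g; pose q := 1 - T^-1 *: p.
have q1 : bnd q 1.
  have -> : q = T^-1 *: (T%:S - p) by rewrite scalerBr scalerA mulVf ?gt_eqF// scale1r.
  by rewrite -(mulVf (lt0r_neq0 T0)) -{2}(gtr0_norm TV); exact: bndZ.
have intertwine m : star y * q ^+ m = G ^+ m * star y.
  elim: m => [|m IH]; first by rewrite !expr0 mulr1 mul1r.
  rewrite exprSr mulrA IH -mulrA exprSr -mulrA; congr (_ * _).
  rewrite /q /G /p mulrBr mulrDl mulr1 mul1r; congr (_ + _).
  by rewrite -mult_scaleAr mulrA yk mulNr scalerN opprK mult_scaleAl.
have [e e0 ye] := bnd_ex y.
pose K := T^-1 * (e * e).
have K0 : 0 <= K by rewrite mulr_ge0 ?(ltW TV)// mulr_ge0// ltW.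
have Gg m : bnd (G ^+ m * g) K.
  have -> : G ^+ m * g = - (T^-1 *: (star y * q ^+ m * y)).
    by rewrite intertwine -mulrA yk mulrN scalerN opprK -mult_scaleAr.
  apply: bndN; rewrite /K -{2}(gtr0_norm TV); apply: bndZ.
  apply: bndM => //; first exact: ltW.
  rewrite -[X in bnd _ X]mulr1; apply: bndM; [exact: ltW|exact: bnd_star|].
  elim: m => [|m IH]; first by rewrite expr0; exact: bnd1.
  by rewrite exprS -[1]mulr1; apply: bndM.
(* sum the bounds Gg, as G ^+ m.+1 - G ^+ m = G ^+ m * g *)
have Gm m : bnd (G ^+ m) (1 + m%:R * K).
  elim: m => [|m IH]; first by rewrite expr0 mul0r addr0; exact: bnd1.
  rewrite exprSr {2}/G mulrDr mulr1 -natr1 mulrDl mul1r addrA.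
  exact: bndD.
have sg : star g = g by rewrite starZ starM sk.
have G1 : bnd G 1 by apply: (bnd_linear_powers _ K0 Gm); rewrite starD star1 sg.
have g0 : g = 0.
  apply: pos_opp_eq0; first by apply/posZ/pos_sqr.
  by split; [rewrite starN sg|exists 1 => //; rewrite scale1r opprK].
apply: star_mul_eq0; rewrite sk.
by rewrite -[k * k](scalerK (lt0r_neq0 TV)) -/g g0 scaler0.
Qed.

(** Let [h = x* x], let [a] be the absolute value of [h] (the square root of
    [h^2]) and [n = a - h], twice the negative part of [h].  Then [n (a + h) = 0],
    so that [y = x n] satisfies [y* y = n h n = - n^2 a], the opposite of the
    square of [n r] where [r] is the square root of [a].  By [star_mul_opp_sqr],
    [n r = 0]; this forces [n = 0] and [h = a]. *)
Lemma pos_star_mul x : pos (star x * x).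
Proof.
set h := star x * x; have sh : star h = h by rewrite starM starK.
have [a [sa pa aa ac]] := pos_sqrt (pos_sqr sh).
have [r [sr _ rr rc]] := pos_sqrt pa.
have ha : GRing.comm h a by apply: ac; exact: commrM.
pose n := a - h.
have sn : star n = n by rewrite starB sa sh.
have nah : n * (a + h) = 0 by rewrite /n; have := ha; rewrite /GRing.comm => ha'; rewrite mulrBl !mulrDr aa ha'; ncring.
have nr : GRing.comm n r.
  by apply: rc; apply/commr_sym/commrB => //; exact: commr_sym.
have k0 : n * r = 0.
  apply: (@star_mul_opp_sqr (x * n)); first by rewrite starM sn sr nr.
  rewrite starM sn -mulrA (mulrA (star x)) -/h.
  have nh : n * h = - (n * a).
    by apply/eqP; rewrite -addr_eq0 -mulrDr addrC nah.
  have hn : h * n = n * h by rewrite /n mulrBl mulrBr ha.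
  by rewrite hn nh mulrN -rr !mulrA -(mulrA n r n) -nr !mulrA.
have na : n * a = 0 by rewrite -rr mulrA k0 mul0r.
have nh : n * h = 0 by move: nah; rewrite mulrDr na add0r.
have n0 : n = 0 by apply: star_mul_eq0; rewrite sn {2}/n mulrBr na nh subrr.
by rewrite -[h](subKr a) -/n n0 subr0.
Qed.

End positive.


(** * States dominating a functional *)
Section state.
Context {R : realType} {A : cstarAlgType R}.
Local Notation mult := (@mult R A).
Local Notation "t %:S" := (t *: (1 : mult)) (at level 1, format "t %:S").

(** Real parts of positive functionals of norm at most 1.  The inequality
    [psi a ^+ 2 <= psi (a* a)] is the Cauchy-Schwarz inequality against a unit,
    which [A] may lack. *)
Record state (psi : A -> R) : Prop := State {
  stateD : forall a b, psi (a + b) = psi a + psi b ;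
  stateZ : forall t a, psi (rscale t a) = t * psi a ;
  state_star : forall a, psi (cstar a) = psi a ;
  state_sqr : forall a, psi a ^+ 2 <= psi (cstar a ** a) ;
  state_contract : forall a b,
    psi (cstar (a ** b) ** (a ** b)) <= normR a ^+ 2 * psi (cstar b ** b) }.

Section dominating_state.
Variable F : A -> R.
Hypothesis FD : forall a b, F (a + b) = F a + F b.
Hypothesis FZ : forall t a, F (rscale t a) = t * F a.
Hypothesis F1 : forall a, F a <= normR a.
Implicit Types (l : seq A) (s h : mult).

Let msum l : mult := \sum_(a <- l) star (lmult a) * lmult a.
Let fsum l : R := \sum_(a <- l) F a ^+ 2.

Let fsum_ge0 l : 0 <= fsum l.
Proof. by apply: sumr_ge0 => a _; exact: sqr_ge0. Qed.

Let star_msum l : star (msum l) = msum l.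
Proof.
rewrite /msum; elim: l => [|a l IH]; first by rewrite big_nil star0.
by rewrite big_cons starD IH starM starK.
Qed.

(** The sum over [a] in [l] of the squares [|C a - F(a) X|^2], expanded.  For
    [X = sum F(a) a] and [C = sum F(a)^2] it says that
    [X* X <= C (sum a* a)]. *)
Let lagrange l (C : R) (X : mult) : pos (C ^+ 2 *: msum l -
  C *: (star (\sum_(a <- l) F a *: lmult a) * X + star X * (\sum_(a <- l) F a *: lmult a))
  + fsum l *: (star X * X)).
Proof.
rewrite /msum /fsum; elim: l => [|a l IH].
  by rewrite !big_nil star0 mul0r mulr0 addr0 !scaler0 scale0r subr0 addr0; exact: pos0.
rewrite !big_cons; set Y := \sum_(_ <- _) _ in IH *; set S := \sum_(_ <- _) _ in IH *.
set c := \sum_(_ <- _) _ in IH *.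
have := posD (pos_star_mul (C *: lmult a - F a *: X)) IH.
suff -> : star (C *: lmult a - F a *: X) * (C *: lmult a - F a *: X) =
   C ^+ 2 *: (star (lmult a) * lmult a) -
   C *: (F a *: (star (lmult a) * X) + F a *: (star X * lmult a)) + F a ^+ 2 *: (star X * X).
  congr pos.
  rewrite starD starZ !scalerDl !scalerDr !mulrDl !mulrDr -!mult_scaleAl -!mult_scaleAr.
  by rewrite !scalerDr; ncring.
rewrite starB !starZ mulrBl !mulrBr -!mult_scaleAl -!mult_scaleAr !scalerA !scalerDr !scalerA.
by rewrite -!expr2 (mulrC (F a)); ncring.
Qed.

(** The inequality that makes the Hahn-Banach theorem applicable: for
    [x = sum F(a) a] and [C = sum F(a)^2] one has [C = F x <= |x|], while
    [x* x <= C (sum a* a) <= C N]. *)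
Let fsum_le l s (N : R) : pos (s - msum l) -> 0 <= N -> bnd s N -> fsum l <= N.
Proof.
move=> ps N0 sN; have := fsum_ge0 l; rewrite le_eqVlt => /predU1P[<-//|C0].
set C := fsum l in C0 *.
pose x := \sum_(a <- l) rscale (F a) a.
pose X := lmult x.
have XE : X = \sum_(a <- l) F a *: lmult a.
  rewrite /X /x; elim: (l) => [|a r IH].
    by rewrite !big_nil; apply: mult_ext => y /=; rewrite cmul0l.
  by rewrite !big_cons lmultD lmultZ IH.
have Fx : F x = C.
  rewrite /x /C /fsum; elim: (l) => [|a r IH].
    by rewrite !big_nil -(scale0r 0); have := FZ 0 0; rewrite /rscale scale0r mul0r.
  by rewrite !big_cons FD FZ IH expr2.
have CX : pos (C *: msum l - star X * X).
  have := lagrange l C X; rewrite -XE -/C => /(@posZ _ _ C^-1).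
  rewrite invr_gt0 => /(_ C0); congr pos.
  have -> : C ^+ 2 *: msum l - C *: (star X * X + star X * X) + C *: (star X * X) =
     C *: (C *: msum l - star X * X).
    by rewrite expr2 -scalerA scalerBr !scalerDr; ncring.
  by rewrite scalerA mulVf ?gt_eqF// scale1r.
have ss : star s = s.
  by have [] := ps; rewrite starB star_msum => /addIr.
have CN0 : 0 <= C * N by rewrite mulr_ge0// ltW.
have psX : pos ((C * N)%:S - star X * X).
  have -> : (C * N)%:S - star X * X =
     C *: (N%:S - s) + (C *: (s - msum l) + (C *: msum l - star X * X)).
    by rewrite !scalerBr scalerA; ncring.
  by apply: posD; [apply: posZ => //; exact: pos_scal_sub|apply: posD => //; exact: posZ].
have XN : bnd X (Num.sqrt (C * N)).
  apply: bnd_sq; first exact: sqrtr_ge0.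
  by rewrite sqr_sqrtr//; apply: pos_bnd => //; exact: pos_star_mul.
have Cx : C <= Num.sqrt (C * N).
  by rewrite -{1}Fx (le_trans (F1 x))// bnd_lmult_le// sqrtr_ge0.
have : C ^+ 2 <= C * N.
  by rewrite -(sqr_sqrtr CN0) ler_pXn2r// nnegrE ?sqrtr_ge0// ltW.
by rewrite expr2 ler_pM2l.
Qed.

(** Candidate values of a sublinear functional at [h].  A linear [phi] below all
    of them satisfies [phi h <= |h|] (take [l] empty and [s = 0]),
    [phi p >= 0] for positive [p] (take [h = - p] and [s = p]), and
    [phi (a* a) >= F(a)^2] (take [h = - a* a], [l = [:: a]] and [s = a* a]). *)
Let S h : set R := [set v | exists l s (N : R),
  [/\ pos (s - msum l), 0 <= N, bnd (h + s) N & v = N - fsum l]].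

Let nilS h (N : R) : 0 <= N -> bnd h N -> S h N.
Proof.
move=> N0 hN; exists [::], 0, N; rewrite /msum /fsum !big_nil subrr subr0 addr0.
by split=> //; exact: pos0.
Qed.

Let S_lb h (K : R) : 0 <= K -> bnd h K -> lbound (S h) (- K).
Proof.
move=> K0 hK _ [l [s [N [ps N0 hs ->]]]].
have : fsum l <= N + K.
  apply: fsum_le ps _ _; first exact: addr_ge0.
  by rewrite -[s](addKr h) [- h + _]addrC; exact: bndB.
lra.
Qed.

Let S_has_lbound h : has_lbound (S h).
Proof. by have [K K0 hK] := bnd_ex h; exists (- K); apply: S_lb => //; exact: ltW. Qed.

Let S_sublinear : sublinear (fun h => inf (S h)).
Proof.
apply: sublinear_inf => //.
- by move=> h; have [K K0 hK] := bnd_ex h; exists K; apply: nilS => //; exact: ltW.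
- move=> h k _ _ [l [s [N [ps N0 hs ->]]]] [l' [s' [N' [ps' N0' hs' ->]]]].
  exists (N + N' - fsum (l ++ l')); last by rewrite /fsum big_cat /=; lra.
  exists (l ++ l'), (s + s'), (N + N'); split=> //.
  + by rewrite /msum big_cat /= opprD addrACA; exact: posD.
  + exact: addr_ge0.
  + by rewrite addrACA; exact: bndD.
- move=> t h _ t0 [l [s [N [ps N0 hs ->]]]].
  have t2 : Num.sqrt t ^+ 2 = t by rewrite sqr_sqrtr// ltW.
  pose l' := [seq rscale (Num.sqrt t) a | a <- l].
  have fl : fsum l' = t * fsum l.
    rewrite /fsum big_map mulr_sumr; apply: eq_bigr => a _.
    by rewrite FZ exprMn t2.
  have ml : msum l' = t *: msum l.
    rewrite /msum big_map scaler_sumr; apply: eq_bigr => a _.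
    by rewrite lmultZ starZ -mult_scaleAl -mult_scaleAr scalerA -expr2 t2.
  exists (t * N - fsum l'); last by rewrite fl; lra.
  exists l', (t *: s), (t * N); split=> //.
  + by rewrite ml -scalerBr; exact: posZ.
  + by rewrite mulr_ge0// ltW.
  + by rewrite -scalerDr; have := bndZ t hs; rewrite gtr0_norm.
- by apply: nilS => //; exact: bnd0.
Qed.

(** The functional [phi] on multipliers is restricted to [A] and made
    invariant under the involution.  Its value at the unit is at most 1, and
    positivity at [(t + a)* (t + a)] for all real [t] gives
    [psi a ^+ 2 <= psi (a* a)]. *)
Lemma dominating_state : exists2 psi, state psi & forall a, F a ^+ 2 <= psi (cstar a ** a).
Proof.
have [phi [phiD phiZ phiS]] := sublinear_linear_minorant S_sublinear.
have phi_le h v : S h v -> phi h <= v.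
  by move=> Sv; apply: (le_trans (phiS h)); apply: ge_inf.
have phiN h : phi (- h) = - phi h by rewrite -scaleN1r phiZ mulN1r.
have phi_pos h : pos h -> 0 <= phi h.
  move=> ph; rewrite -oppr_le0 -phiN; apply: phi_le.
  exists [::], h, 0; rewrite /msum /fsum !big_nil !subr0 addNr.
  by split=> //; exact: bnd0.
have phiF a : F a ^+ 2 <= phi (star (lmult a) * lmult a).
  rewrite -lerN2 -phiN; apply: phi_le.
  exists [:: a], (star (lmult a) * lmult a), 0.
  rewrite /msum /fsum !big_seq1 subrr addNr sub0r.
  by split=> //; [exact: pos0|exact: bnd0].
have phi1 : phi 1 <= 1 by apply: phi_le; apply: nilS => //; exact: bnd1.
pose psi a := (phi (lmult a) + phi (lmult (cstar a))) / 2.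
have psi_sq a : psi (cstar a ** a) = phi (star (lmult a) * lmult a).
  rewrite /psi cstarM cstarK star_lmult lmultM; by field.
exists psi; last by move=> a; rewrite psi_sq.
constructor.
- by move=> a b; rewrite /psi cstarD !lmultD !phiD; ring.
- by move=> t a; rewrite /psi cstar_rscale !lmultZ !phiZ; ring.
- by move=> a; rewrite /psi cstarK addrC.
- move=> a; rewrite psi_sq.
  have h t : 0 <= t ^+ 2 * phi 1 + 2 * t * psi a + phi (star (lmult a) * lmult a).
    have := phi_pos _ (pos_star_mul (t%:S + lmult a)).
    rewrite starD star_scal mulrDl !mulrDr !scalMl !scalMr scalerA !phiD !phiZ.
    by rewrite /psi star_lmult; congr (_ <= _); field.
  by have := h (- psi a); have := sqr_ge0 (psi a); nra.
- move=> a b; rewrite !psi_sq.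
  set t := normR a; set La := lmult a; set Lb := lmult b.
  have tt : bnd (star La * La) (t ^+ 2).
    rewrite expr2; apply: bndM; [exact: normR_ge0|apply: bnd_star|]; exact: bnd_lmult.
  have sL : star (star La * La) = star La * La by rewrite starM starK.
  have [u [su _ uu _]] := pos_sqrt (pos_scal_sub sL tt (sqr_ge0 t)).
  have := phi_pos _ (pos_star_mul (u * Lb)).
  rewrite starM su -mulrA (mulrA u) uu mulrBl mulrBr scalMl -mult_scaleAr.
  rewrite phiD phiN phiZ subr_ge0 lmultM starM -!mulrA; exact: le_trans.

Qed.

End dominating_state.
End state.


(** * Representations and the GNS construction *)
Definition realified {R : realType} (V : lmodType R[i]) : Type := V.

Section realified.
Context {R : realType} (V : lmodType R[i]).
HB.instance Definition _ := GRing.Zmodule.on (realified V).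

Fact rscaleA (s t : R) (x : V) : rscale s (rscale t x) = rscale (s * t) x.
Proof. by rewrite /rscale scalerA rmorphM. Qed.
Fact rscale1 : left_id 1 (@rscale R V).
Proof. by move=> x; rewrite /rscale rmorph1 scale1r. Qed.
Fact rscaleDr : right_distributive (@rscale R V) +%R.
Proof. by move=> t x y; exact: scalerDr. Qed.
Fact rscaleDl (x : V) : {morph (@rscale R V)^~ x : s t / s + t}.
Proof. by move=> s t; rewrite /rscale rmorphD scalerDl. Qed.
HB.instance Definition _ := GRing.Zmodule_isLmodule.Build R (realified V)
  rscaleA rscale1 rscaleDr rscaleDl.
End realified.

(** Representations by bounded operators on a real Hilbert space; the complex
    structure of [A] is forgotten. *)
Record representation (R : realType) (A : cstarAlgType R) := Representation {
  rep_space :> hilbert R ;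
  act : A -> rep_space -> rep_space ;
  actDr : forall a u v, act a (u + v) = act a u + act a v ;
  actZr : forall a t u, act a (t *: u) = t *: act a u ;
  actDl : forall a b u, act (a + b) u = act a u + act b u ;
  actZl : forall a t u, act (rscale t a) u = t *: act a u ;
  actM : forall a b u, act (a ** b) u = act a (act b u) ;
  act_adj : forall a u v, dot (act a u) v = dot u (act (cstar a) v) ;
  act_bnd : forall a u, sqn (act a u) <= normR a ^+ 2 * sqn u }.

(** Direct sum of the GNS representations of a family of states: finitely
    supported families in [A] with the inner product
    [sum over i of psi_i (v_i* u_i)], completed. *)
Section direct_sum.
Context {R : realType} {A : cstarAlgType R} (I : choiceType) (psi : I -> A -> R).
Hypothesis psi_state : forall i, state (psi i).
Local Notation rA := (realified A).

Definition fin_supp : {pred I -> rA} :=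
  [pred u : I -> rA | `[< finite_set [set i | u i != 0] >]].

Record direct_sum := DirectSum { dsum_fun :> I -> rA ; dsum_funP : dsum_fun \in fin_supp }.

HB.instance Definition _ := [isSub for dsum_fun].
HB.instance Definition _ := [Choice of direct_sum by <:].

Lemma fin_supp_submod_closed : submod_closed fin_supp.
Proof.
split=> [|k f g /asboolP cf /asboolP cg]; apply/asboolP.
  rewrite (_ : [set _ | _] = set0)//; apply/seteqP; split => // i /=.
  by rewrite eqxx.
apply: (@sub_finite_set _ _ ([set i | f i != 0] `|` [set i | g i != 0])); last first.
  by rewrite finite_setU.
move=> i /=; rewrite -![(k *: f + g) _]/(k *: f _ + g _).
have [->|f0 _] := eqVneq (f i) 0; last by left.
by rewrite scaler0 add0r => g0; right.
Qed.

HB.instance Definition _ := GRing.isSubmodClosed.Build R (I -> rA) fin_supp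
  fin_supp_submod_closed.
HB.instance Definition _ := [SubChoice_isSubLmodule of direct_sum by <:].

Implicit Types u v w : direct_sum.

Definition supp u : {fset I} := fset_set [set i | u i != 0].

Lemma suppP u i : (i \in supp u) = (u i != 0).
Proof.
rewrite in_fset_set; last by have /asboolP := dsum_funP u.
by apply/idP/idP => [/set_mem//|?]; exact/mem_set.
Qed.

Lemma state0 i : psi i 0 = 0.
Proof. by have := stateD (psi_state i) 0 0; rewrite addr0; lra. Qed.

Definition dsum_dot u v := \sum_(i <- supp u) psi i (cstar (v i : A) ** (u i : A)).

Lemma dsum_dotE (X : {fset I}) u v : (supp u `<=` X)%fset ->
  dsum_dot u v = \sum_(i <- X) psi i (cstar (v i : A) ** (u i : A)).
Proof.
move=> uX; apply: big_fset_incl => // i _; rewrite suppP negbK => /eqP ->.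
by rewrite cmul0r state0.
Qed.

Lemma dsum_dotC u v : dsum_dot u v = dsum_dot v u.
Proof.
rewrite (@dsum_dotE (supp u `|` supp v)%fset) ?fsubsetUl//.
rewrite (@dsum_dotE (supp u `|` supp v)%fset v) ?fsubsetUr//.
by apply: eq_bigr => i _; rewrite -(state_star (psi_state i)) cstarM cstarK.
Qed.

Lemma dsum_dotDl u v w : dsum_dot (u + v) w = dsum_dot u w + dsum_dot v w.
Proof.
pose X := (supp u `|` supp v `|` supp (u + v)%R)%fset.
have uX : (supp u `<=` X)%fset by rewrite /X -fsetUA fsubsetUl.
have vX : (supp v `<=` X)%fset by rewrite /X fsetUAC fsubsetUr.
rewrite !(@dsum_dotE X) ?fsubsetUr//.
rewrite -big_split; apply: eq_bigr => i _ /=.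
by rewrite -(stateD (psi_state i)) -cmulDr.
Qed.

Lemma dsum_dotZl t u w : dsum_dot (t *: u) w = t * dsum_dot u w.
Proof.
pose X := (supp u `|` supp (t *: u)%R)%fset.
rewrite !(@dsum_dotE X) ?fsubsetUl ?fsubsetUr// mulr_sumr; apply: eq_bigr => i _.
by rewrite -(stateZ (psi_state i)) -cmul_rscaler.
Qed.

Lemma dsum_dot_ge0 u : 0 <= dsum_dot u u.
Proof.
apply: sumr_ge0 => i _; apply: le_trans (state_sqr (psi_state i) _).
exact: sqr_ge0.
Qed.

Definition dsum_pre := Prehilbert dsum_dotC dsum_dotDl dsum_dotZl dsum_dot_ge0.

Fact dsum_act_subproof (a : A) u : (fun i => a ** u i : rA) \in fin_supp.
Proof.
apply/asboolP; apply: (@sub_finite_set _ _ [set i | u i != 0]).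
  by move=> i /=; apply: contra => /eqP ->; rewrite cmul0r.
by have /asboolP := dsum_funP u.
Qed.

Definition dsum_act (a : A) (u : dsum_pre) : dsum_pre := DirectSum (dsum_act_subproof a u).

Lemma dsum_ext (u v : direct_sum) : (forall i, u i = v i) -> u = v.
Proof. by move=> uv; apply: val_inj; apply/funext. Qed.

Lemma dsum_actDr a u v : dsum_act a (u + v) = dsum_act a u + dsum_act a v.
Proof. by apply: dsum_ext => i; exact: cmulDr. Qed.

Lemma dsum_actZr a t u : dsum_act a (t *: u) = t *: dsum_act a u.
Proof. by apply: dsum_ext => i; exact: (cmul_rscaler t a (u i : A)). Qed.

Lemma dsum_act_adj a (u v : dsum_pre) : dot (dsum_act a u) v = dot u (dsum_act (cstar a) v).
Proof.
rewrite [LHS](@dsum_dotE (supp u)); last first.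
  apply/fsubsetP => i; rewrite !suppP; apply: contra => /eqP /= ->.
  by rewrite cmul0r.
by apply: eq_bigr => i _ /=; rewrite cstarM cstarK cmulA.
Qed.

Lemma dsum_act_bnd a (u : dsum_pre) : sqn (dsum_act a u) <= normR a ^+ 2 * sqn u.
Proof.
rewrite [leLHS](@dsum_dotE (supp u)); last first.
  apply/fsubsetP => i; rewrite !suppP; apply: contra => /eqP /= ->.
  by rewrite cmul0r.
rewrite mulr_sumr; apply: ler_sum => i _; exact: (state_contract (psi_state i)).
Qed.

Fact gns_act_subproof (a : A) (u : cauchy_seq dsum_pre) :
  (fun n => dsum_act a (u n)) \in @is_cauchy R dsum_pre.
Proof.
apply/asboolP => e e0.
have a1 : 0 < normR a ^+ 2 + 1 by rewrite ltr_wpDl ?sqr_ge0.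
have [N NP] := cauchy_seqP u (divr_gt0 e0 a1); exists N => m n Nm Nn.
have -> : dsum_act a (u m) - dsum_act a (u n) = dsum_act a (u m - u n).
  by rewrite dsum_actDr -[- u n]scaleN1r dsum_actZr scaleN1r.
apply: (le_lt_trans (dsum_act_bnd _ _)).
have := NP _ _ Nm Nn; rewrite ltr_pdivlMr//; have := sqn_ge0 (u m - u n); nra.
Qed.

Definition gns_act (a : A) (u : completion dsum_pre) : completion dsum_pre :=
  CauchySeq (gns_act_subproof a u).

Lemma gns_ext (u v : cauchy_seq dsum_pre) : (forall n, u n = v n) -> u = v.
Proof. by move=> uv; apply: val_inj; apply/funext. Qed.

Lemma gns_act_bnd a (u : completion dsum_pre) : sqn (gns_act a u) <= normR a ^+ 2 * sqn u.
Proof.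
have h : (fun n => normR a ^+ 2 * dot ((u : cauchy_seq _) n) ((u : cauchy_seq _) n))
    @ \oo --> normR a ^+ 2 * sqn u.
  exact: (cvgMr (@completion_dotP _ _ u u)).
rewrite -[leRHS](cvg_lim _ h)//; apply: ler_lim.
- exact: cauchy_dot.
- by apply/cvg_ex; eexists; exact: h.
- by apply: nearW => n; exact: dsum_act_bnd.
Qed.

Program Definition gns : representation A :=
  @Representation R A (completion dsum_pre) gns_act _ _ _ _ _ _ gns_act_bnd.
Next Obligation. by move=> a u v; apply: gns_ext => n; exact: dsum_actDr. Qed.
Next Obligation. by move=> a t u; apply: gns_ext => n; exact: dsum_actZr. Qed.
Next Obligation.
by move=> a b u; apply: gns_ext => n; apply: dsum_ext => i; exact: cmulDl.
Qed.
Next Obligation.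
by move=> a t u; apply: gns_ext => n; apply: dsum_ext => i; exact: cmul_rscalel.
Qed.
Next Obligation.
by move=> a b u; apply: gns_ext => n; apply: dsum_ext => i; rewrite /= cmulA.
Qed.
Next Obligation.
move=> a u v; rewrite [LHS]/(completion_dot _ _) [RHS]/(completion_dot _ _) /completion_dot.
by under eq_fun do rewrite dsum_act_adj.
Qed.

Fact delta_subproof i (a : A) : (fun j => if j == i then a else 0 : rA) \in fin_supp.
Proof.
apply/asboolP; apply: (@sub_finite_set _ _ [set i]) => // j /=.
by case: (j =P i) => [->//|_]; rewrite eqxx.
Qed.

Definition gns_vec i (a : A) : gns := to_completion (DirectSum (delta_subproof i a) : dsum_pre).

Lemma gns_vec_dot i a b : dot (gns_vec i a) (gns_vec i b) = psi i (cstar b ** a).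
Proof.
rewrite [LHS]to_completion_dot [LHS](@dsum_dotE [fset i]%fset).
  by rewrite big_seq_fset1 /= eqxx.
apply/fsubsetP => j; rewrite suppP inE /=.
by case: (j =P i) => // _; rewrite eqxx.
Qed.

Lemma gns_vec_comb i s t a b :
  gns_vec i (rscale s a + rscale t b) = s *: gns_vec i a + t *: gns_vec i b.
Proof.
rewrite -to_completion_comb; congr to_completion; apply: dsum_ext => j /=.
rewrite -![(s *: _ + t *: _) _]/(s *: _ + t *: _) /=.
by case: (j =P i) => // _; rewrite !scaler0 addr0.
Qed.

Lemma gns_vec_act i a b : gns_vec i (a ** b) = act a (gns_vec i b).
Proof.
apply: gns_ext => n /=; apply: dsum_ext => j /=.
by case: (j =P i) => // _; rewrite cmul0r.
Qed.

Lemma gns_vec_total (z : gns) : (forall i a, dot (gns_vec i a) z = 0) -> sqn z = 0.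
Proof.
move=> h; apply: (@cl_null _ _ (range (@to_completion R dsum_pre))).
  move=> e e0; have [N /(_ N (leqnn N)) zN] := to_completion_approx z e0.
  by exists (to_completion ((z : cauchy_seq _) N)) => //; exists ((z : cauchy_seq _) N).
move=> _ [u _ <-].
pose d (i : I) : dsum_pre := DirectSum (delta_subproof i (u i)).
have -> : u = \sum_(i <- supp u) d i.
  apply: dsum_ext => j.
  have -> : dsum_fun (\sum_(i <- supp u) d i) j = \sum_(i <- supp u) (d i : I -> rA) j.
    by elim: (supp u : seq I) => [|i s IH]; rewrite ?big_nil// !big_cons -IH.
  have [uj|uj] := boolP (j \in supp u).
    rewrite (big_fsetD1 j)//= eqxx big_seq big1 ?addr0// => i.
    by rewrite !inE eq_sym => /andP[/negPf -> _].
  rewrite big_seq big1 => [|i iu] /=; first by move: uj; rewrite suppP negbK => /eqP.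
  by case: (j =P i) => // ji; move: uj; rewrite ji iu.
elim: (supp u : seq I) => [|i s IH].
  by rewrite big_nil; have := @dot0l _ gns z; congr (_ = _); congr dot; exact: val_inj.
rewrite big_cons (_ : to_completion _ = gns_vec i (u i) + to_completion (\sum_(j <- s) d j)).
  by rewrite dotDl h IH addr0.
exact: val_inj.
Qed.

End direct_sum.


(** * The universal representation *)
Section representation_theory.
Context {R : realType} {A : cstarAlgType R} {H : representation A}.
Implicit Types (u v w z : H) (a b : A).

Lemma actNr a u : act a (- u) = - act a u.
Proof. by rewrite -scaleN1r actZr scaleN1r. Qed.
Lemma actBr a u v : act a (u - v) = act a u - act a v.
Proof. by rewrite actDr actNr. Qed.
Lemma act0r a : act a (0 : H) = 0.
Proof. by have := actZr a 0 (0 : H); rewrite !scale0r. Qed.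
Lemma actZDl (s t : R) a b u :
  act (rscale s a + rscale t b) u = s *: act a u + t *: act b u.
Proof. by rewrite actDl !actZl. Qed.

Lemma cl_act (W : set H) a v : (forall w, W w -> W (act a w)) -> cl W v -> cl W (act a v).
Proof.
move=> Wa clv e e0; have a1 : 0 < normR a ^+ 2 + 1 by rewrite ltr_wpDl ?sqr_ge0.
have [w Ww vw] := clv _ (divr_gt0 e0 a1); exists (act a w); first exact: Wa.
rewrite -actBr (le_lt_trans (act_bnd _ _))//.
by move: vw; rewrite ltr_pdivlMr//; have := sqn_ge0 (v - w); nra.
Qed.

Definition cyclic z := range (fun a => act a z).

Lemma cyclic_comb z (s t : R) u v : cyclic z u -> cyclic z v -> cyclic z (s *: u + t *: v).
Proof. by move=> [a _ <-] [b _ <-]; exists (rscale s a + rscale t b) => //; exact: actZDl. Qed.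

Lemma cyclic_act z a u : cyclic z u -> cyclic z (act a u).
Proof. by move=> [b _ <-]; exists (a ** b) => //; exact: actM. Qed.

End representation_theory.

Section Re.
Context {R : realType}.

Lemma Re_le_normR (z : R[i]^o) : complex.Re z <= normR z.
Proof.
apply: (le_trans (ler_norm _)); rewrite -lecR -normRE; exact: normc_ge_Re.
Qed.

Lemma Re_rscale (V : lmodType R[i]) (f : {linear V -> R[i]^o}) t x :
  complex.Re (f (rscale t x)) = t * complex.Re (f x).
Proof. by rewrite /rscale linearZ /=; case: (f x) => p q /=; rewrite mul0r subr0. Qed.

End Re.

Section universal.
Context {R : realType} {A : cstarAlgType R}.

(** [dominating_state] applied to [Re f / |f|], with [1 / 0 = 0] when [f = 0]. *)
Lemma functional_state (f : dual A) : exists psi : A -> R, state psi /\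
  forall a, complex.Re (f a) ^+ 2 <= opnorm f ^+ 2 * psi (cstar a ** a).
Proof.
pose F a := (opnorm f)^-1 * complex.Re (f a).
have f0 := opnorm_ge0 f.
have FB a : complex.Re (f a) = opnorm f * F a /\ F a <= normR a.
  have [n0|n0] := eqVneq (opnorm f) 0.
    have fa0 : f a = 0.
      apply: normR_eq0; apply/le_anti; rewrite normR_ge0 andbT.
      by rewrite (le_trans (opnorm_ub _ _))// n0 mul0r.
    by rewrite /F n0 fa0 /= mulr0 mul0r normR_ge0.
  split; first by rewrite mulrA divff// mul1r.
  have n1 : 0 < opnorm f by rewrite lt_neqAle eq_sym n0.
  by rewrite /F mulrC ler_pdivrMr// mulrC (le_trans (Re_le_normR _))// opnorm_ub.
have [|||psi psiS psiF] := @dominating_state R A F.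
- by move=> a b; rewrite /F linearD /= raddfD mulrDr.
- by move=> t a; rewrite /F Re_rscale; ring.
- by move=> a; have [] := FB a.
exists psi; split=> // a; have [-> _] := FB a.
by rewrite exprMn ler_wpM2l ?sqr_ge0.
Qed.

(** In the direct sum of the GNS spaces of states [psi f] dominating [f], both
    [psi f] and [Re f] are bounded functionals on the summand of index [f].  The
    Riesz vector [xi] of [psi f] plays the role of the class of the unit
    ([a xi] is the class of [a]), and [eta] is the Riesz vector of [Re f]. *)
Lemma universal_representation : exists H : representation A,
  (forall f : dual A, exists xi eta : H, [/\ sqn xi <= 1, sqn eta <= opnorm f ^+ 2 &
     forall a, complex.Re (f a) = dot (act a xi) eta]) /\
  (forall z : H, (forall a, sqn (act a z) = 0) -> sqn z = 0).
Proof.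
have /choice[psi psiP] := functional_state.
have psiS f : state (psi f) by have [] := psiP f.
have psiF f := (psiP f).2.
pose H := gns psiS; exists H.
pose J f : A -> H := gns_vec psiS f.
have Jcomb f (s t : R) a b : exists c, J f c = s *: J f a + t *: J f b /\
    psi f c = s * psi f a + t * psi f b /\
    complex.Re (f c) = s * complex.Re (f a) + t * complex.Re (f b).
  exists (rscale s a + rscale t b); split; first exact: gns_vec_comb.
  rewrite (stateD (psiS f)) !(stateZ (psiS f)); split=> //.
  by rewrite linearD /= raddfD /= !Re_rscale.
have cyc f : exists xi : H, [/\ cl (range (J f)) xi, sqn xi <= 1,
    forall a, psi f a = dot (J f a) xi & forall a, sqn (act a xi - J f a) = 0].
  have [|s t a b|||xi [clxi psixi xi1]] := @riesz R H A (J f) (psi f) 1.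
  - by constructor; exact: 0.
  - by have [c [? [? _]]] := Jcomb f s t a b; exists c.
  - exact: ler01.
  - by move=> a; rewrite mul1r /sqn gns_vec_dot; exact: state_sqr.
  exists xi; split=> // a; apply: (@cl_null _ _ (range (J f))); last first.
    move=> _ [b _ <-]; rewrite dotBr (dotC (J f b) (act a xi)) act_adj dotC.
    rewrite [act _ _](_ : _ = J f (cstar a ** b)); last exact/esym/gns_vec_act.
    by rewrite -psixi gns_vec_dot subrr.
  rewrite addrC -scaleN1r; apply: cl_comb.
  - move=> _ _ [b _ <-] [c _ <-].
    have [d [dE _]] := Jcomb f (-1) 1 b c.
    by exists d => //; rewrite dE scale1r.
  - by apply: sub_cl; exists a.
  - apply: cl_act clxi => _ [b _ <-]; exists (a ** b) => //; exact: gns_vec_act.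
split=> [f|z z0].
- have [xi [_ xi1 _ xiJ]] := cyc f.
  have [|s t a b|||eta [_ feta eta1]] :=
    @riesz R H A (J f) (fun a => complex.Re (f a)) (opnorm f ^+ 2).
  + by constructor; exact: 0.
  + by have [c [? [_ ?]]] := Jcomb f s t a b; exists c.
  + exact: sqr_ge0.
  + by move=> a; rewrite /sqn gns_vec_dot; exact: psiF.
  exists xi, eta; split=> // a; rewrite feta.
  by apply/eqP; rewrite eq_sym -subr_eq0 -dotBl; apply/eqP/dot_null.
- apply: gns_vec_total => f a.
  have [xi [_ _ _ xiJ]] := cyc f.
  have := dot_null z (xiJ a); rewrite dotBl act_adj => /eqP.
  by rewrite (dotC xi) (dot_null _ (z0 (cstar a))) sub0r oppr_eq0 => /eqP.
Qed.

End universal.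


(** * Invariant subspaces of the commutant *)
Section power_representation.
Context {R : realType} {A : cstarAlgType R} (H : representation A) (n : nat).

Definition power_act (a : A) (u : power H n) : power H n := fun i => act a (u i).

Program Definition power_rep : representation A :=
  @Representation R A (power H n) power_act _ _ _ _ _ _ _.
Next Obligation. by move=> a u v; apply/funext => i; exact: actDr. Qed.
Next Obligation. by move=> a t u; apply/funext => i; exact: actZr. Qed.
Next Obligation. by move=> a b u; apply/funext => i; exact: actDl. Qed.
Next Obligation. by move=> a t u; apply/funext => i; exact: actZl. Qed.
Next Obligation. by move=> a b u; apply/funext => i; exact: actM. Qed.
Next Obligation. by move=> a u v; apply: eq_bigr => i _; exact: act_adj. Qed.
Next Obligation.
move=> a u; rewrite !power_sqnE mulr_sumr; apply: ler_sum => i _; exact: act_bnd.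
Qed.

Definition inj_power (i : 'I_n) (v : H) : power H n := fun j => if j == i then v else 0.

Lemma dot_inj_power (u : power H n) i v : dot u (inj_power i v) = dot (u i) v.
Proof.
rewrite [LHS]/(power_dot _ _) /power_dot (bigD1 i)//= /inj_power eqxx big1 ?addr0//.
by move=> j /negPf ->; rewrite dot0r.
Qed.

End power_representation.

Section commutant.
Context {R : realType} {A : cstarAlgType R} {H : representation A}.
Implicit Types (u v w z e : H) (a b : A) (F : set H).

Hypothesis nondegenerate : forall z : H, (forall a, sqn (act a z) = 0) -> sqn z = 0.

(** The orbit of [e] under the commutant of [A], described without operators:
    [z] is dominated by [e] when [a e |-> a z] extends to a bounded operator. *)
Definition dominated e : set H :=
  [set z | exists2 C : R, 0 <= C & forall a, sqn (act a z) <= C * sqn (act a e)].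

(** Invariant under the commutant of [A], as each orbit is. *)
Definition dom_span F : set H := span [set v | exists2 e, F e & dominated e v].

Lemma dominated_refl e : dominated e e.
Proof. by exists 1 => // a; rewrite mul1r. Qed.

Lemma dom_span_comb F (s t : R) u v :
  dom_span F u -> dom_span F v -> dom_span F (s *: u + t *: v).
Proof. by move=> Fu Fv; apply: span_add; exact: span_scale. Qed.

Definition is_proj (W : set H) v p := cl W p /\ forall w, W w -> dot w (v - p) = 0.

Lemma proj_exists F v : exists p, is_proj (dom_span F) v p.
Proof.
have [||p] := @projection R H (dom_span F) v.
- by exists 0; exact: span0.
- by move=> s t u w; exact: dom_span_comb.
by exists p.
Qed.

Lemma is_proj_sqn_le W v p : is_proj W v p -> sqn p <= sqn v.
Proof.
move=> [clp pP]; have h : dot p (v - p) = 0 by exact: cl_orth clp pP.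
by rewrite -[v](subrK p) addrC sqnD h mulr0 addr0 lerDl sqn_ge0.
Qed.

Lemma is_proj_best W v p w : (forall s t u w, W u -> W w -> W (s *: u + t *: w)) ->
  is_proj W v p -> W w -> sqn (v - p) <= sqn (v - w).
Proof.
move=> WD [clp pP] Ww.
have h : dot (p - w) (v - p) = 0.
  by rewrite dotBl (cl_orth clp pP) pP// subrr.
by rewrite -[v - w](subrKA p) [leRHS]sqnD (dotC (v - p)) h mulr0 addr0 lerDl sqn_ge0.
Qed.

(** Joint approximate unit for finitely many vectors: the component of [z]
    orthogonal to its orbit is annihilated by [A], hence null. *)
Lemma cl_cyclic_power n (z : power_rep H n) : cl (cyclic z) z.
Proof.
have [||q clq qP] := @projection R (power_rep H n) (cyclic z) z.
- by exists (act 0 z), 0.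
- by move=> s t u w; exact: cyclic_comb.
apply: (cl_null_shift clq).
have z0 a : sqn (act a (z - q)) = 0.
  have := @act_adj R A (power_rep H n) a (z - q) (act a (z - q)); rewrite -[LHS]/(sqn _) => ->.
  rewrite actBr actBr dotBr !(dotC (z - q)).
  rewrite qP ?sub0r; last by apply: cyclic_act; exists a.
  apply/eqP; rewrite oppr_eq0; apply/eqP; apply: cl_orth qP.
  by apply: cl_act => [w|]; [exact: cyclic_act|apply: cl_act clq => w; exact: cyclic_act].
rewrite power_sqnE big1// => i _; apply: nondegenerate => a.
by apply/le_anti; rewrite sqn_ge0 andbT -(z0 a); exact: (power_sqn_ge (act a (z - q)) i).
Qed.

(** The projection onto the closed orbit of [z] in [H^n] commutes with [A], so
    its matrix entries belong to the commutant and preserve domination.  Here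
    [r] is the image under this projection of [v] placed at the coordinate
    [i]. *)
Lemma cyclic_proj_dominated n (z : power_rep H n) i e v r : dominated e v ->
  cl (cyclic z) r -> (forall w : power_rep H n, cyclic z w -> dot w (inj_power i v - r) = 0) ->
  forall j, dominated e (r j).
Proof.
move=> [C C0 vC] clr rP j; exists C => // a; apply: le_trans (vC a).
apply: (le_trans (power_sqn_ge (act a r) j)).
pose x : power_rep H n := inj_power i v.
have h : dot (act a r) (act a (x - r)) = 0.
  apply: (cl_orth (W := cyclic z)).
    by apply: cl_act clr => w; exact: cyclic_act.
  by move=> w zw; rewrite dotC act_adj dotC rP//; exact: cyclic_act.
have <- : sqn (act a x) = sqn (act a v).
  rewrite power_sqnE (bigD1 i)//= {1}/power_act /x /inj_power eqxx big1 ?addr0//.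
  by move=> k /negPf ki; rewrite /power_act ki act0r sqn0.
by rewrite -[x](subrK r) [_ + r]addrC actDr sqnD h mulr0 addr0 lerDl sqn_ge0.
Qed.

(** Let [Q] be the projection onto the closed orbit of [z] in [H^n] and [P] the
    projection of each coordinate onto the closure of [dom_span F].  By
    [cyclic_proj_dominated], [Q] maps tuples orthogonal to [dom_span F] to such
    tuples ([q'0]); being self-adjoint it commutes with [P].  Hence
    [P z = P Q z = Q P z] lies in the closed orbit. *)
Lemma bicommutant_power F n (z p : power_rep H n) :
  (forall i, is_proj (dom_span F) (z i) (p i)) -> cl (cyclic z) p.
Proof.
move=> zp; pose u' : power_rep H n := z - p.
have Czero : exists w : power_rep H n, cyclic z w by exists (act 0 z), 0.
have Ccomb (s t : R) (u w : power_rep H n) : cyclic z u -> cyclic z w -> cyclic z (s *: u + t *: w).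
  exact: cyclic_comb.
have [q clq qP] := @projection R (power_rep H n) (cyclic z) p Czero Ccomb.
have [q' clq' q'P] := @projection R (power_rep H n) (cyclic z) u' Czero Ccomb.
have q'0 i w : dom_span F w -> dot w (q' i) = 0.
  elim=> [|t v w' [e Fe ev] _ IH]; first by rewrite dot0l.
  rewrite dotDl dotZl IH addr0.
  have [r clr rP] := @projection R (power_rep H n) (cyclic z) (inj_power i v) Czero Ccomb.
  have h1 : dot q' (inj_power i v : power_rep H n) = dot q' r.
    by apply/eqP; rewrite -subr_eq0 -dotBr; apply/eqP; exact: cl_orth clq' rP.
  have h2 : dot q' r = dot u' r.
    by apply/eqP; rewrite eq_sym -subr_eq0 -dotBl dotC; apply/eqP; exact: cl_orth clr q'P.
  rewrite (dotC v) -(dot_inj_power q' i v).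
  rewrite [dot _ _]h1 h2 [dot _ _]big1 ?mulr0// => j _; rewrite dotC.
  have [_] := zp j; apply; apply: sub_span; exists e => //.
  exact: (cyclic_proj_dominated ev clr rP).
(* t is orthogonal to the closed orbit of z, and to p = z - u' because u' is
   orthogonal to both p and q *)
apply: (cl_null_shift clq); set t := p - q.
have tC (w : power_rep H n) : cl (cyclic z) w -> dot w t = 0 by move=> clw; exact: cl_orth clw qP.
have tq : dot t q = 0 by rewrite dotC tC.
have tz : dot t z = 0 by rewrite dotC tC//; exact: cl_cyclic_power.
have pu' : dot p u' = 0.
  rewrite [dot _ _]big1// => i _; have [clp pP] := zp i; exact: cl_orth clp pP.
have pq' : dot p q' = 0.
  by rewrite [dot _ _]big1// => i _; have [clp _] := zp i; exact: cl_orth clp (q'0 i).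
have qu' : dot q u' = 0.
  have -> : dot q u' = dot q q'.
    by apply/eqP; rewrite -subr_eq0 -dotBr; apply/eqP; exact: cl_orth clq q'P.
  have <- : dot p q' = dot q q'; last exact: pq'.
  by apply/eqP; rewrite -subr_eq0 -dotBl dotC; apply/eqP/tC.
have tu' : dot t u' = 0 by rewrite /t dotBl pu' qu' subrr.
rewrite /sqn {2}/t dotBr tq subr0.
have -> : p = z - u' by rewrite /u' opprB addrC subrK.
by rewrite dotBr tz tu' subrr.
Qed.

(** The projection onto the closure of [dom_span F] is approximated strongly by
    elements of [A], on finitely many vectors at a time. *)
Lemma bicommutant F (l : seq (H * H)) d : (forall x, x \in l -> is_proj (dom_span F) x.1 x.2) ->
  0 < d -> exists b, forall x, x \in l -> sqn (x.2 - act b x.1) < d.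
Proof.
move=> lP d0; pose n := size l; pose x0 : H * H := (0, 0).
have [|_ [b _ <-] bP] := (@bicommutant_power F n (fun i => (nth x0 l i).1)
    (fun i => (nth x0 l i).2) _ d d0).
  by move=> i; apply: lP; exact: mem_nth.
exists b => x xl; have il : (index x l < n)%N by rewrite index_mem.
have := power_sqn_ge ((fun i : 'I_n => (nth x0 l i).2) -
   @act _ _ (power_rep H n) b (fun i => (nth x0 l i).1)) (Ordinal il).
move=> /le_lt_trans/(_ bP) /=.
by rewrite -![(_ - _ : power_rep H n) _]/(_ - _) /power_act /= nth_index.
Qed.

Lemma approximate_unit (l : seq H) d : 0 < d ->
  exists b, forall z, z \in l -> sqn (z - act b z) < d.
Proof.
move=> d0; have [|b bP] := @bicommutant setT [seq (z, z) | z <- l] d _ d0.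
  move=> _ /mapP[z _ ->]; split=> [|w _]; last by rewrite subrr dot0r.
  by apply/sub_cl/sub_span; exists z => //; exact: dominated_refl.
by exists b => z zl; apply: (bP (z, z)); apply/mapP; exists z.
Qed.

(** If [z] is orthogonal to the orbit of [e] under the commutant, then so is the
    whole orbit of [z].  For [z'] in the orbit of [z], the operator [a z |-> a z']
    commutes with [A]; its adjoint sends [v] to a vector [s] that is again
    dominated by [e], and [<z', v> = <z, s> = 0]. *)
Lemma orth_transfer z e : (forall v, dominated e v -> dot z v = 0) ->
  forall z' v, dominated z z' -> dominated e v -> dot z' v = 0.
Proof.
move=> ze z' v [C C0 zC] ev.
(* s is the image of x under the adjoint of the operator a z |-> a z' *)
have repr x : exists s, [/\ cl (cyclic z) s, forall a, dot (act a z') x = dot (act a z) s &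
    sqn s <= C * sqn x].
  have [|s t a b|||s [? ? ?]] := @riesz R H A (fun a => act a z) (fun a => dot (act a z') x) (C * sqn x).
  - by constructor; exact: 0.
  - by exists (rscale s a + rscale t b); rewrite !actZDl dotDl !dotZl.
  - by rewrite mulr_ge0// sqn_ge0.
  - by move=> a; rewrite (le_trans (cauchy_schwarz _ _))// mulrAC ler_wpM2r ?sqn_ge0.
  by exists s.
have [s [cls sP sC]] := repr v.
have es : dominated e s.
  have [D D0 vD] := ev; exists (C * D); first exact: mulr_ge0.
  move=> b; have [r [clr rP rC]] := repr (act b v).
  have sr : sqn (act b s - r) = 0.
    apply: (cl_null (W := cyclic z)).
      rewrite addrC -scaleN1r; apply: cl_comb => //.
        by move=> x y zx zy; rewrite -[y]scale1r; exact: cyclic_comb.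
      by apply: cl_act cls => w; exact: cyclic_act.
    move=> _ [a _ <-]; rewrite dotBr -rP (dotC (act a z)) act_adj dotC -actM -sP actM.
    by rewrite act_adj cstarK subrr.
  have -> : sqn (act b s) = sqn r.
    by rewrite -[act b s](subrK r) sqnD sr (dot_null _ sr) mulr0 !add0r.
  by rewrite (le_trans rC)// -mulrA ler_wpM2l.
have zs := ze _ es.
apply/eqP; rewrite -normr_le0; apply/ler_addgt0Pr => d d0; rewrite add0r.
have d2 : 0 < d / 2 by rewrite divr_gt0.
have [d1 d10 d1P] := dot_small v d2; have [d3 d30 d3P] := dot_small s d2.
have [|b bP] := @approximate_unit [:: z; z'] (Num.min d1 d3).
  by rewrite lt_min d10.
have := bP z; rewrite mem_head lt_min => /(_ isT)/andP[_ /d3P h1].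
have := bP z'; rewrite !inE eqxx orbT lt_min => /(_ isT)/andP[/d1P h2 _].
rewrite -[z'](subrK (act b z')) dotDl sP.
have -> : dot (act b z) s = - dot (z - act b z) s by rewrite dotBl zs sub0r opprK.
by rewrite (le_trans (ler_normB _ _))// [d]splitr ltW// ltrD.
Qed.

Definition orth_family (E : set H) := forall e e', E e -> E e' -> e <> e' ->
  forall u v, dominated e u -> dominated e' v -> dot u v = 0.

(** The component [x] of a vector orthogonal to the orbits of a maximal family
    could be added to this family by [orth_transfer]; it would then belong to
    it, and be orthogonal to itself. *)
Lemma total_orth_family : exists E, orth_family E /\ forall z, cl (dom_span E) z.
Proof.
have [|E [Eorth Emax]] := @Zorn_bigcup H orth_family.
  move=> F FP Ftot e e' [X FX Xe] [Y FY Ye'].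
  have [XY|YX] := Ftot _ _ FX FY.
    by apply: (FP _ FY) => //; exact: XY.
  by apply: (FP _ FX) => //; exact: YX.
exists E; split=> // z.
have [p [clp pP]] := proj_exists E z; apply: (cl_null_shift clp).
set x := z - p in pP *.
have xE e v : E e -> dominated e v -> dot x v = 0.
  by move=> Ee ev; rewrite dotC pP//; apply: sub_span; exists e.
have [Ex|nEx] := pselect (E x); first by apply: (xE x) => //; exact: dominated_refl.
exfalso; apply: (Emax (E `|` [set x])).
  by split=> [e Ee|/(_ x (or_intror erefl))//]; left.
move=> e e' [Ee|->] [Ee'|->]// ee' u v ev e'v.
- exact: (Eorth e e').
- by rewrite dotC; apply: (@orth_transfer x e) => // w; exact: xE.
- by apply: (@orth_transfer x e') => // w; exact: xE.
Qed.

End commutant.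


(** * Vector functionals *)
Section real_part.
Context {R : realType} {X : normedModType R[i]}.
Implicit Types (f g : dual X) (x y : X).

(** Rotate [x] so that [f x] becomes real and nonnegative. *)
Lemma functional_bound_Re (f : {linear X -> R[i]^o}) (K : R) :
  (forall x, complex.Re (f x) <= K * normR x) -> forall x, normR (f x) <= K * normR x.
Proof.
move=> fK x; set z := f x.
have [z0|z0] := eqVneq (normR z) 0.
  rewrite z0; have := fK x; have := fK (- x).
  by rewrite linearN /= -/z (normR_eq0 z0) oppr0 normRN.
have zz : z^* * z = ((normR z ^+ 2)%:C)%C :> R[i].
  by rewrite mulrC -normCK rmorphXn /= -normRE.
have nc : normR (z^* : R[i]^o) = normR z.
  by apply: complexI; rewrite -!normRE norm_conjC.
have := fK (z^* *: x); rewrite linearZ /= [_ *: _]zz /= normRZ nc expr2.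
have zp : 0 < normR z by rewrite lt_neqAle eq_sym z0 normR_ge0.
by rewrite mulrCA ler_pM2l.
Qed.

Lemma opnorm_le_Re f (K : R) : 0 <= K ->
  (forall x, complex.Re (f x) <= K * normR x) -> opnorm f <= K.
Proof. by move=> K0 fK; apply: opnorm_le => //; exact: functional_bound_Re. Qed.

Lemma dual_ext_Re f g : (forall x, complex.Re (f x) = complex.Re (g x)) -> f = g.
Proof.
move=> fg; apply: dualP => x.
have := fg x; have := fg ('i%C *: x); rewrite !linearZ /=.
case: (f x) (g x) => [a b] [c d] /=; rewrite !mul0r !mul1r !sub0r => /oppr_inj -> -> //.
Qed.

(** The functional [x |-> Y x - i Y (i x)]. *)
Lemma complexify (Y : X -> R) (K : R) : 0 <= K ->
  (forall x y, Y (x + y) = Y x + Y y) -> (forall t x, Y (rscale t x) = t * Y x) ->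
  (forall x, Y x <= K * normR x) ->
  exists g : dual X, (forall x, complex.Re (g x) = Y x) /\ opnorm g <= K.
Proof.
move=> K0 YD YZ YK.
pose g x : R[i]^o := (Y x +i* - Y ('i%C *: x))%C.
have lg : linear g.
  move=> k x y; case: k => p q.
  have kx (v : X) : (p +i* q)%C *: v = rscale p v + rscale q ('i%C *: v).
    rewrite /rscale scalerA -scalerDl; congr (_ *: _).
    by apply/eqP; rewrite eq_complex /= !mulr0 !mul0r !mulr1 ?subr0 ?addr0 ?add0r !eqxx.
  have iix : 'i%C *: ('i%C *: x) = rscale (-1) x.
    by rewrite /rscale scalerA -expr2 sqr_i rmorphN1.
  have ik : 'i%C *: ((p +i* q)%C *: x) = rscale p ('i%C *: x) + rscale q (rscale (-1) x).
    by rewrite -iix scalerA mulrC -scalerA kx.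
  rewrite /g scalerDr ik kx !YD !YZ.
  apply/eqP; rewrite eq_complex /=; apply/andP; split; apply/eqP; ring.
pose lg' : {linear X -> R[i]^o} := HB.pack g (GRing.isLinear.Build _ _ _ _ _ lg).
have gK := @functional_bound_Re lg' K YK.
have cg : continuous g.
  apply: (@bounded_linear_continuous _ _ _ lg'); apply/bounded_funP => r.
  exists ((K%:C)%C * r) => x xr.
  apply: (@le_trans _ _ ((K%:C)%C * `|x|)).
    by rewrite (normRE x) -rmorphM /= -le_normR; exact: gK.
  by rewrite ler_wpM2l// ler0c.
have gdual : g \in @functional R X by apply/asboolP.
by exists (Dual gdual); split=> //; apply: opnorm_le.
Qed.

End real_part.

Section vector_functional.
Context {R : realType} {A : cstarAlgType R} {H : representation A}.
Implicit Types (u v w z e : H) (a b : A).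

Lemma dot_le_sqrt u v : dot u v <= Num.sqrt (sqn u) * Num.sqrt (sqn v).
Proof.
rewrite -sqrtrM ?sqn_ge0// (le_trans (ler_norm _))// -sqrtr_sqr.
by rewrite ler_sqrt ?mulr_ge0 ?sqn_ge0// cauchy_schwarz.
Qed.

Lemma sqrt_sqn_act a u : Num.sqrt (sqn (act a u)) <= normR a * Num.sqrt (sqn u).
Proof.
rewrite -(ger0_norm (normR_ge0 a)) -sqrtr_sqr -sqrtrM ?sqr_ge0//.
by rewrite ler_sqrt; [exact: act_bnd|rewrite mulr_ge0 ?sqr_ge0 ?sqn_ge0].
Qed.

Lemma vector_functional_ex (p : H * H) : exists f : dual A,
  (forall a, complex.Re (f a) = dot (act a p.1) p.2) /\
  opnorm f <= Num.sqrt (sqn p.1) * Num.sqrt (sqn p.2).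
Proof.
apply: complexify.
- by rewrite mulr_ge0 ?sqrtr_ge0.
- by move=> a b; rewrite actDl dotDl.
- by move=> t a; rewrite actZl dotZl.
- move=> a; rewrite (le_trans (dot_le_sqrt _ _))// mulrAC ler_wpM2r ?sqrtr_ge0//.
  by rewrite mulrC sqrt_sqn_act.
Qed.

Definition vector_functional u v : dual A := sval (cid (vector_functional_ex (u, v))).

Lemma Re_vector_functional u v a : complex.Re (vector_functional u v a) = dot (act a u) v.
Proof. by rewrite /vector_functional; case: cid => f /= []. Qed.

Lemma opnorm_vector_functional u v : opnorm (vector_functional u v) <= Num.sqrt (sqn u) * Num.sqrt (sqn v).
Proof. by rewrite /vector_functional; case: cid => f /= []. Qed.

Lemma vector_functionalDr u v w : vector_functional u (v + w) = vector_functional u v + vector_functional u w.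
Proof.
by apply: dual_ext_Re => a; rewrite dualDE raddfD /= !Re_vector_functional dotDr.
Qed.

Lemma vector_functionalDl u v w : vector_functional (u + v) w = vector_functional u w + vector_functional v w.
Proof.
by apply: dual_ext_Re => a; rewrite dualDE raddfD /= !Re_vector_functional actDr dotDl.
Qed.

Lemma Re_dual_rscale t (f : dual A) a : complex.Re (rscale t f a) = t * complex.Re (f a).
Proof. by rewrite dualZE; case: (f a) => p q /=; rewrite mul0r subr0. Qed.

Lemma vector_functionalZr t u v : vector_functional u (t *: v) = rscale t (vector_functional u v).
Proof. by apply: dual_ext_Re => a; rewrite Re_dual_rscale !Re_vector_functional dotZr. Qed.

Lemma vector_functionalZl t u v : vector_functional (t *: u) v = rscale t (vector_functional u v).
Proof. by apply: dual_ext_Re => a; rewrite Re_dual_rscale !Re_vector_functional actZr dotZl. Qed.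

Lemma vector_functionalBr u v w : vector_functional u (v - w) = vector_functional u v - vector_functional u w.
Proof.
rewrite vector_functionalDr -scaleN1r vector_functionalZr; congr (_ + _).
by rewrite /rscale rmorphN1 scaleN1r.
Qed.

Lemma vector_functionalBl u v w : vector_functional (u - v) w = vector_functional u w - vector_functional v w.
Proof.
rewrite vector_functionalDl -scaleN1r vector_functionalZl; congr (_ + _).
by rewrite /rscale rmorphN1 scaleN1r.
Qed.

Lemma vector_functional_ext u u' v v' : (forall a, dot (act a u) v = dot (act a u') v') -> vector_functional u v = vector_functional u' v'.
Proof. by move=> h; apply: dual_ext_Re => a; rewrite !Re_vector_functional. Qed.

Lemma sqrt_mul_small (u : H) (e : R) : 0 < e ->
  exists2 d, 0 < d & forall v : H, sqn v < d -> Num.sqrt (sqn u) * Num.sqrt (sqn v) < e.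
Proof.
move=> e0; set s := Num.sqrt (sqn u).
have s1 : 0 < s + 1 by rewrite ltr_wpDl ?sqrtr_ge0.
have es : 0 < e / (s + 1) by rewrite divr_gt0.
exists ((e / (s + 1)) ^+ 2); first by rewrite exprn_gt0.
move=> v vd; have : Num.sqrt (sqn v) < e / (s + 1).
  by rewrite -[ltRHS](gtr0_norm es) -sqrtr_sqr ltr_sqrt// exprn_gt0.
rewrite ltr_pdivlMr// => h.
by have := sqrtr_ge0 (sqn v); have := sqrtr_ge0 (sqn u); rewrite -/s; nra.
Qed.

Lemma vector_functional_small_r u (e : R) : 0 < e -> exists2 d, 0 < d & forall v, sqn v < d -> normR (vector_functional u v) < e.
Proof.
move=> /(sqrt_mul_small u)[d d0 dP]; exists d => // v /dP.
exact: le_lt_trans (opnorm_vector_functional u v).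
Qed.

Lemma vector_functional_small_l u (e : R) : 0 < e -> exists2 d, 0 < d & forall v, sqn v < d -> normR (vector_functional v u) < e.
Proof.
move=> /(sqrt_mul_small u)[d d0 dP]; exists d => // v /dP.
by rewrite mulrC; exact: le_lt_trans (opnorm_vector_functional v u).
Qed.

End vector_functional.


(** * Truncating elements of the algebra *)
Lemma dot_small_seq {R : realType} {H : prehilbert R} (I : eqType) (l : seq I) (v : I -> H) (e : R) :
  0 < e -> exists2 d, 0 < d & forall i, i \in l -> forall u : H, sqn u < d -> `|dot u (v i)| < e.
Proof.
move=> e0; elim: l => [|i l [d d0 dP]]; first by exists 1.
have [d' d'0 d'P] := dot_small (v i) e0.
exists (Num.min d d'); first by rewrite lt_min d0.
move=> j; rewrite inE => /predU1P[->|jl] u; rewrite lt_min => /andP[ud ud'].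
  exact: d'P.
exact: dP ud.
Qed.

Section truncation.
Context {R : realType} {A : cstarAlgType R} {H : representation A}.
Hypothesis nondegenerate : forall z : H, (forall a, sqn (act a z) = 0) -> sqn z = 0.
Variables (xi eta : dual A -> H).
Hypothesis xi_le1 : forall f, sqn (xi f) <= 1.
Hypothesis eta_le : forall f : dual A, sqn (eta f) <= opnorm f ^+ 2.
Hypothesis Re_xi_eta : forall (f : dual A) (a : A), complex.Re (f a) = dot (act a (xi f)) (eta f).

Section fixed_set.
Variables (F : set H) (a : A) (p : dual A -> H).
Hypothesis pP : forall f, is_proj (dom_span F) (xi f) (p f).

Let Y (f : dual A) : R := dot (act a (p f)) (eta f).

Let Y_approx (l : seq (dual A)) (z : H) (d e : R) :
  (forall w, dom_span F w -> dot w z = 0) -> 0 < d -> 0 < e ->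
  exists b, sqn (act b z) < d /\ forall f, f \in l -> `|Y f - complex.Re (f (a ** b))| < e.
Proof.
move=> zF d0 e0.
have [d' d'0 d'P] := dot_small_seq l (fun f => act (cstar a) (eta f)) e0.
have [||b bP] := @bicommutant R A H nondegenerate F ((z, 0) :: [seq (xi f, p f) | f <- l]) (Num.min d d').
- move=> x; rewrite inE => /predU1P[->|/mapP[f _ ->]]; last exact: pP.
  by split=> [|w /zF]; [apply/sub_cl; exact: span0|rewrite /= subr0].
- by rewrite lt_min d0.
exists b; split.
  by have := bP _ (mem_head _ _); rewrite /= sub0r sqnN lt_min => /andP[].
move=> f fl; have := bP (xi f, p f); rewrite inE map_f// orbT => /(_ isT).
rewrite /= lt_min => /andP[_ /(d'P _ fl)].
by rewrite Re_xi_eta actM /Y !(act_adj a) -dotBl.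
Qed.

(** The functional [y] is given by [Re (y f) = <a p_f, eta f>], where [p_f] is
    the projection of [xi f] onto the closure of [dom_span F].  The vectors
    [xi f] and [eta f] are chosen for each [f] without any linearity; [y] is
    nevertheless linear because, by [bicommutant], on finitely many functionals
    it is approximated by the evaluation at [a b] for some [b] in [A].  The same
    approximation computes [y] at the functional [<. e, v>] from the vector [e]:
    if [e] is orthogonal to [dom_span F], then [b] can be chosen with [b e]
    small. *)
Lemma truncation : exists y : dual (dual A), [/\ opnorm y <= normR a,
  forall f w, dom_span F w ->
    `|complex.Re (y f) - complex.Re (f a)| <=
      normR a * opnorm f * Num.sqrt (sqn (xi f - w)) &
  forall e v, (forall w, dom_span F w -> dot w e = 0) -> y (vector_functional e v) = 0].
Proof.
have sqrt_eta (f : dual A) : Num.sqrt (sqn (eta f)) <= opnorm f.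
  by rewrite -[leRHS](ger0_norm (opnorm_ge0 f)) -sqrtr_sqr ler_sqrt ?sqr_ge0.
have null0 w : dom_span F w -> dot w (0 : H) = 0 by rewrite dot0r.
have YD f g : Y (f + g) = Y f + Y g.
  apply/eqP; rewrite -subr_eq0 -normr_le0; apply/ler_addgt0Pr => e e0; rewrite add0r.
  have e3 : 0 < e / 3 by rewrite divr_gt0.
  have [b [_ bP]] := Y_approx [:: f; g; f + g] null0 ltr01 e3.
  have := bP f; rewrite mem_head => /(_ isT).
  have := bP g; rewrite !inE eqxx orbT => /(_ isT).
  have := bP (f + g); rewrite !inE eqxx !orbT => /(_ isT).
  rewrite dualDE raddfD /= !ltr_norml ler_norml => /andP[? ?] /andP[? ?] /andP[? ?].
  by apply/andP; split; lra.
have YZ t f : Y (rscale t f) = t * Y f.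
  apply/eqP; rewrite -subr_eq0 -normr_le0; apply/ler_addgt0Pr => e e0; rewrite add0r.
  have t1 : 0 < 2 * (`|t| + 1) by rewrite mulr_gt0// ltr_wpDl.
  have [b [_ bP]] := Y_approx [:: f; rscale t f] null0 ltr01 (divr_gt0 e0 t1).
  have := bP f; rewrite mem_head => /(_ isT).
  have := bP (rscale t f); rewrite !inE eqxx !orbT => /(_ isT).
  rewrite Re_dual_rscale !ltr_pdivlMr//; set x := Y f - _ => h1 h2.
  have -> : Y (rscale t f) - t * Y f =
     (Y (rscale t f) - t * complex.Re (f (a ** b))) - t * x by rewrite /x; ring.
  rewrite (le_trans (ler_normB _ _))// normrM.
  have := mulr_ge0 (normr_ge0 t) (normr_ge0 (Y (rscale t f) - t * complex.Re (f (a ** b)))).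
  have := mulr_ge0 (normr_ge0 t) (normr_ge0 x); have := normr_ge0 x; lra.
have Yle f : Y f <= normR a * normR f.
  rewrite (le_trans (dot_le_sqrt _ _))// ler_pM ?sqrtr_ge0//.
  rewrite (le_trans (sqrt_sqn_act _ _))// -[leRHS]mulr1 ler_wpM2l ?normR_ge0//.
  by rewrite -sqrtr1 ler_sqrt// (le_trans (is_proj_sqn_le (pP f))).
have [y [yY yle]] := complexify (normR_ge0 a) YD YZ Yle.
exists y; split=> // [f w Fw|e v eF].
  rewrite yY /Y Re_xi_eta -dotBl -actBr.
  have h u : dot (act a u) (eta f) <= normR a * opnorm f * Num.sqrt (sqn u).
    rewrite (le_trans (dot_le_sqrt _ _))// mulrAC ler_pM ?sqrtr_ge0//.
    exact: sqrt_sqn_act.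
  have best : sqn (p f - xi f) <= sqn (xi f - w).
    by rewrite sqnBC; apply: (is_proj_best _ (pP f) Fw) => s t u x; exact: dom_span_comb.
  apply: (@le_trans _ _ (normR a * opnorm f * Num.sqrt (sqn (p f - xi f)))).
    rewrite ler_norml h andbT lerNl -dotNl -actNr (le_trans (h _))//.
    by rewrite sqnN.
  by rewrite ler_wpM2l ?mulr_ge0 ?normR_ge0 ?opnorm_ge0// ler_sqrt ?sqn_ge0.
(* b is chosen close to the projection on xi g, and small on e *)
have Y0 (g : dual A) (v' : H) : (forall b, complex.Re (g (a ** b)) = dot (act b e) v') -> Y g = 0.
  move=> gP; apply/eqP; rewrite -normr_le0; apply/ler_addgt0Pr => r r0; rewrite add0r.
  have r2 : 0 < r / 2 by rewrite divr_gt0.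
  have [d d0 dP] := dot_small v' r2.
  have [b [be bP]] := Y_approx [:: g] eF d0 r2.
  have := bP g (mem_head _ _); have := dP _ be; rewrite gP.
  rewrite !ltr_norml ler_norml => /andP[? ?] /andP[? ?].
  by apply/andP; split; lra.
(* y f is determined by the real parts of y at f and at i f *)
have r0 : complex.Re (y (vector_functional e v)) = 0.
  by rewrite yY; apply: (Y0 _ (act (cstar a) v)) => b; rewrite Re_vector_functional actM act_adj.
have i0 : complex.Re (y ('i%C *: vector_functional e v)) = 0.
  rewrite yY; apply: (Y0 _ (act (cstar ('i%C *: a)) v)) => b.
  by rewrite dualZE -linearZ /= -cmulZl Re_vector_functional actM act_adj.
move: i0; rewrite linearZ /=; move: r0; case: (y _) => s t /= -> .
by rewrite mul0r mul1r sub0r => /eqP; rewrite oppr_eq0 => /eqP ->.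
Qed.

End fixed_set.
End truncation.


(** * Finite parts of spans and unions of countable sets *)
Lemma countable_setU T (A B : set T) : countable A -> countable B -> countable (A `|` B).
Proof.
move=> cA cB; rewrite (_ : A `|` B = \bigcup_(b in [set: bool]) if b then A else B).
  by apply: bigcup_countable => [|[]//]; apply: finite_set_countable; exact: finite_finset.
apply/seteqP; split=> [x [Ax|Bx]|x [[] _ ?]]; [by exists true|by exists false|by left|by right].
Qed.

Lemma span_finite {R : realType} {V : lmodType R} {I : Type} (S : I -> set V) (E : set I) v :
  span [set v | exists2 e, E e & S e v] v ->
  exists F, [/\ finite_set F, F `<=` E & span [set v | exists2 e, F e & S e v] v].
Proof.
elim=> [|t s w [e Ee es] _ [F [Ffin FE Fw]]].
  by exists set0; split=> //; exact: span0.
exists (e |` F); split.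
- by rewrite finite_setU; split=> //; exact: finite_set1.
- by move=> x [->|/FE].
- have mono u : span [set v | exists2 e, F e & S e v] u ->
      span [set v | exists2 e', (e |` F) e' & S e' v] u.
    elim=> [|t' s' w' [e' Fe' es'] _ IH]; first exact: span0.
    by apply: spanD => //; exists e' => //; right.
  by apply: spanD; [exists e => //; left|exact: mono].
Qed.

(** * Linearly dense sets *)
Section closed_span.
Context {R : realType} {X : completeNormedModType R[i]} (M : set X).

Lemma linear_span0 : linear_span M 0.
Proof.
by exists 0%N, (fun=> 0), (fun=> 0); split=> [[]//|]; rewrite big_ord0.
Qed.

Lemma linear_spanD x y : linear_span M x -> linear_span M y -> linear_span M (x + y).
Proof.
move=> [n [k [m [Mm ->]]]] [n' [k' [m' [Mm' ->]]]].
pose glue T (f : 'I_n -> T) (g : 'I_n' -> T) (i : 'I_(n + n')) :=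
  match fintype.split i with inl j => f j | inr j => g j end.
exists (n + n')%N, (glue _ k k'), (glue _ m m'); split.
  by move=> i; rewrite /glue; case: fintype.split.
rewrite big_split_ord /=; congr (_ + _); apply: eq_bigr => i _; rewrite /glue.
  by rewrite (unsplitK (inl i)).
by rewrite (unsplitK (inr i)).
Qed.

Lemma linear_spanZ c x : linear_span M x -> linear_span M (c *: x).
Proof.
move=> [n [k [m [Mm ->]]]]; exists n, (fun i => c * k i), m; split=> //.
by rewrite scaler_sumr; apply: eq_bigr => i _; rewrite scalerA.
Qed.

Lemma linear_span_sub x : M x -> linear_span M x.
Proof.
by move=> Mx; exists 1%N, (fun=> 1), (fun=> x); split=> //; rewrite big_ord1 scale1r.
Qed.

Definition closed_span : set X :=
  [set x | forall e, 0 < e -> exists2 m, linear_span M m & normR (x - m) < e].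

Lemma closed_span_sub x : linear_span M x -> closed_span x.
Proof. by move=> Mx e e0; exists x => //; rewrite subrr normR0. Qed.

Lemma closed_spanD x y : closed_span x -> closed_span y -> closed_span (x + y).
Proof.
move=> cx cy e e0; have e2 : 0 < e / 2 by rewrite divr_gt0.
have [m Mm xm] := cx _ e2; have [m' Mm' ym'] := cy _ e2.
exists (m + m'); first exact: linear_spanD.
by rewrite opprD addrACA (le_lt_trans (normRD _ _))// [e]splitr ltrD.
Qed.

Lemma closed_spanZ t x : closed_span x -> closed_span (rscale t x).
Proof.
move=> cx e e0; have t1 : 0 < `|t| + 1 by rewrite ltr_wpDl.
have [m Mm xm] := cx _ (divr_gt0 e0 t1); exists (rscale t m); first exact: linear_spanZ.
rewrite -scalerBr normR_rscale; move: xm; rewrite ltr_pdivlMr//.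
by have := normR_ge0 (x - m); lra.
Qed.

Lemma closed_span_closed x :
  (forall e, 0 < e -> exists2 y, closed_span y & normR (x - y) < e) -> closed_span x.
Proof.
move=> h e e0; have e2 : 0 < e / 2 by rewrite divr_gt0.
have [y /(_ _ e2)[m Mm ym] xy] := h _ e2; exists m => //.
by rewrite -(subrKA y) (le_lt_trans (normRD _ _))// [e]splitr ltrD.
Qed.

Lemma linearly_dense_closed_span : (forall x, closed_span x) -> linearly_dense M.
Proof.
move=> h O [x Ox] oO.
have /nbhs_normP[e /= e0 eO] : nbhs x O by exact: open_nbhs_nbhs.
have eE : e = ((complex.Re e)%:C)%C.
  by move: e0; case: (e) => a b; rewrite ltcE/= => /andP[/eqP-> _].
have [|m Mm xm] := h x (complex.Re e); first by rewrite -ltcR -eE.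
by exists m; split=> //; apply: eO; rewrite /= eE normRE ltcR.
Qed.

End closed_span.

(** * Functionals of countable support *)
Section countable_support.
Context {R : realType} {X : completeNormedModType R[i]}.

Definition supported_on (M : set X) : set (dual X) :=
  [set f | countable [set m | M m /\ f m != 0]].

Lemma supported_on_subspace M : linear_subspace (supported_on M).
Proof.
split=> [|k f g cf cg].
  rewrite /supported_on /= (_ : [set _ | _] = set0)//.
  by apply/seteqP; split=> // m [_]; rewrite eqxx.
apply: sub_countable (countable_setU cf cg); apply: subset_card_le => m [Mm].
rewrite dualDE dualZE; have [->|fm _] := eqVneq (f m) 0; last by left.
by rewrite scaler0 add0r; right.
Qed.

Lemma one_PlichkoI (M : set X) : linearly_dense M ->
  (forall x, seminorm_of (supported_on M) x = normR x) -> one_Plichko X.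
Proof.
move=> Mdense sE; have subsp := supported_on_subspace M.
have sE' : seminorm_of (supported_on M) = @normR R X by apply/funext.
exists (supported_on M); split; last by split.
split; last by exists M.
split=> //; rewrite sE'; split.
- exact: normRD.
- exact: normRZ.
- exact: normR_eq0.
- by exists 1, 1; split=> // x; rewrite mul1r lexx.
Qed.

End countable_support.

(** * The Sigma-subspace of the bidual *)
Section sigma_family.
Context {R : realType} {A : cstarAlgType R} {H : representation A}.
Implicit Types (e v w : H) (E B : set H).

(** The real and imaginary parts of [v |-> x <. e, v>] are bounded functionals on
    the Hilbert space, to which Bessel's inequality applies. *)
Lemma countable_vector_functional_support (x : dual (dual A)) e B : orthonormal B ->
  countable [set m | exists2 b, B b & m = vector_functional e b /\ x m != 0].
Proof.
move=> Bon.
have bound (r : R[i]^o -> R) : (forall z, `|r z| <= normR z) -> forall v,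
    r (x (vector_functional e v)) ^+ 2 <= opnorm x ^+ 2 * sqn e * sqn v.
  move=> rn v; rewrite -real_normK ?num_real//.
  have h : `|r (x (vector_functional e v))| <= opnorm x * (Num.sqrt (sqn e) * Num.sqrt (sqn v)).
    rewrite (le_trans (rn _))// (le_trans (opnorm_ub _ _))// ler_wpM2l ?opnorm_ge0//.
    exact: opnorm_vector_functional.
  have : `|r (x (vector_functional e v))| ^+ 2 <= (opnorm x * (Num.sqrt (sqn e) * Num.sqrt (sqn v))) ^+ 2.
    by rewrite ler_pXn2r// nnegrE ?mulr_ge0 ?opnorm_ge0 ?sqrtr_ge0.
  by rewrite !exprMn !sqr_sqrtr ?sqn_ge0// mulrA.
have C0 : 0 <= opnorm x ^+ 2 * sqn e by rewrite mulr_ge0 ?sqr_ge0 ?sqn_ge0.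
have cRe := @bessel_countable R H B (fun v => complex.Re (x (vector_functional e v))) _ Bon.
have cIm := @bessel_countable R H B (fun v => complex.Im (x (vector_functional e v))) _ Bon.
have := countable_setU (cRe _ _ _ C0 (bound _ _)) (cIm _ _ _ C0 (bound _ _)).
move=> h; apply: (@sub_countable _ _ _ (vector_functional e @` ([set b | B b /\ complex.Re (x (vector_functional e b)) != 0] `|`
   [set b | B b /\ complex.Im (x (vector_functional e b)) != 0]))).
  apply: subset_card_le => _ [b Bb [-> xb]]; exists b => //.
  have [r0|r0] := eqVneq (complex.Re (x (vector_functional e b))) 0; last by left.
  right; split=> //; apply: contra xb => /eqP i0.
  by rewrite eq_complex r0 i0 !eqxx.
apply: sub_countable (card_image_le _ _) _; apply: h => //.
- by move=> u v; rewrite vector_functionalDr linearD /= raddfD.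
- by move=> t v; rewrite vector_functionalZr Re_rscale.
- by move=> z; rewrite -lecR -normRE; exact: normc_ge_Re.
- by move=> u v; rewrite vector_functionalDr linearD /= raddfD.
- by move=> t v; rewrite vector_functionalZr /rscale linearZ /=; case: (x _) => s r /=; rewrite mul0r addr0.
- move=> z; rewrite -lecR -normRE; case: z => s r /=.
  by rewrite normc_def lecR /= -sqrtr_sqr ler_sqrt ?lerDr ?sqr_ge0// addr_ge0 ?sqr_ge0.
Qed.

Definition sigma_family E B : set (dual A) :=
  [set m | exists e b, [/\ E e, B b & m = vector_functional e b]].

(** By totality of [B] the closed span contains [<. e, v>] for [e] in [E]; by the
    Riesz lemma a functional [<. w, v>] with [w] dominated by [e] is of the form
    [<. e, v'>]; by totality of the orbits of [E] these [w] span a dense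
    subspace. *)
Lemma closed_span_sigma_family E B u v :
  (forall w, cl (dom_span E) w) -> (forall w, cl (span B) w) ->
  closed_span (sigma_family E B) (vector_functional u v).
Proof.
move=> Etot Btot; set M := sigma_family E B.
have on_basis e y : E e -> closed_span M (vector_functional e y).
  move=> Ee; apply: closed_span_closed => d d0.
  have [d' d'0 d'P] := vector_functional_small_r e d0.
  have [w Bw yw] := Btot y _ d'0; exists (vector_functional e w); last by rewrite -vector_functionalBr d'P.
  apply: closed_span_sub; elim: Bw {yw} => [|t b {}w Bb _ IH].
    rewrite (_ : vector_functional e 0 = 0); first exact: linear_span0.
    by apply: dual_ext_Re => a; rewrite Re_vector_functional dot0r.
  rewrite vector_functionalDr vector_functionalZr; apply: linear_spanD => //; apply: linear_spanZ.
  by apply: linear_span_sub; exists e, b.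
have on_dominated e w y : E e -> dominated e w -> closed_span M (vector_functional w y).
  move=> Ee [C C0 wC].
  have [|s t a b|||y' [_ y'P _]] := @riesz R H A (fun a => act a e)
      (fun a => dot (act a w) y) (C * sqn y).
  - by constructor; exact: 0.
  - by exists (rscale s a + rscale t b); rewrite !actZDl dotDl !dotZl.
  - by rewrite mulr_ge0// sqn_ge0.
  - by move=> a; rewrite (le_trans (cauchy_schwarz _ _))// mulrAC ler_wpM2r ?sqn_ge0.
  by rewrite (vector_functional_ext y'P); exact: on_basis.
apply: closed_span_closed => d d0.
have [d' d'0 d'P] := vector_functional_small_l v d0.
have [w Ew uw] := Etot u _ d'0; exists (vector_functional w v); last by rewrite -vector_functionalBl d'P.
elim: Ew {uw} => [|t y {}w [e Ee ey] _ IH].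
  rewrite (_ : vector_functional 0 _ = 0); first exact/closed_span_sub/linear_span0.
  by apply: dual_ext_Re => a; rewrite Re_vector_functional act0r dot0l.
rewrite vector_functionalDl vector_functionalZl; apply: closed_spanD; last exact: IH.
by apply: closed_spanZ; exact: on_dominated Ee ey.
Qed.

(** Only the finitely many [e] in [F] contribute to the support of [y], because
    the other members of [E] are orthogonal to [dom_span F]. *)
Lemma supported_sigma_family E B (F : set H) (y : dual (dual A)) :
  orth_family E -> orthonormal B -> finite_set F -> F `<=` E ->
  (forall e v, (forall w, dom_span F w -> dot w e = 0) -> y (vector_functional e v) = 0) ->
  supported_on (sigma_family E B) y.
Proof.
move=> Eorth Bon Ffin FE y0.
apply: (@sub_countable _ _ _ (\bigcup_(e in F) [set m | exists2 b, B b & m = vector_functional e b /\ y m != 0])).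
  apply: subset_card_le => _ [[e [b [Ee Bb ->]]] ym].
  have [Fe|nFe] := pselect (F e); first by exists e => //; exists b.
  exfalso; move/eqP : ym; apply; apply: y0 => u; elim=> [|t v v' [e' Fe' e'v] _ IH].
    by rewrite dot0l.
  rewrite dotDl dotZl IH (Eorth e' e)//; first by rewrite mulr0 addr0.
  - exact: FE.
  - by move=> ee; apply: nFe; rewrite -ee.
  - exact: dominated_refl.
apply: bigcup_countable => [|e _]; first exact: finite_set_countable.
exact: countable_vector_functional_support.
Qed.

End sigma_family.

Theorem corollary1p3 (R : realType) (A : cstarAlgType R) : one_Plichko (dual A).
Proof.
have [H [repr nondegenerate]] := @universal_representation R A.
have [E [Eorth Etot]] := total_orth_family nondegenerate.
have [B [Bon Btot]] := orthonormal_basis H.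
have /choice[xi xiP] : forall f : dual A, exists xi : H, exists eta : H,
    [/\ sqn xi <= 1, sqn eta <= opnorm f ^+ 2 &
     forall a, complex.Re (f a) = dot (act a xi) eta].
  by move=> f; have [xi [eta ?]] := repr f; exists xi, eta.
have /choice[eta xe] := xiP.
have xi1 f : sqn (xi f) <= 1 by have [] := xe f.
have eta1 (f : dual A) : sqn (eta f) <= opnorm f ^+ 2 by have [] := xe f.
have ReE (f : dual A) a : complex.Re (f a) = dot (act a (xi f)) (eta f) by have [] := xe f.
pose M := sigma_family E B.
apply: (@one_PlichkoI R _ M).
  apply: linearly_dense_closed_span => f.
  rewrite (_ : f = vector_functional (xi f) (eta f)); first exact: closed_span_sigma_family.
  by apply: dual_ext_Re => a; rewrite Re_vector_functional.
move=> f; set S := seminorm_of _ f.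
have evalf (y : dual (dual A)) : normR y <= 1 -> normR (y f) <= normR f.
  by move=> y1; rewrite (le_trans (opnorm_ub _ _))// -[leRHS]mul1r ler_wpM2r ?normR_ge0.
have S_bd : has_ubound
    [set normR (y f) | y in [set y : dual (dual A) | supported_on M y /\ normR y <= 1]].
  by exists (normR f) => _ [y [_ y1] <-]; exact: evalf.
have fS a : normR a <= 1 -> complex.Re (f a) <= S.
  move=> a1; apply/ler_addgt0Pr => d d0.
  (* truncating a at a finite part of E moves its value at f by at most d *)
  have [d' d'0 d'P] : exists2 d', 0 < d' & forall v : H, sqn v < d' ->
      normR a * opnorm f * Num.sqrt (sqn v) <= d.
    have c1 : 0 < normR a * opnorm f + 1.
      by rewrite ltr_wpDl// mulr_ge0 ?normR_ge0 ?opnorm_ge0.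
    have dc : 0 < d / (normR a * opnorm f + 1) by rewrite divr_gt0.
    exists ((d / (normR a * opnorm f + 1)) ^+ 2); first by rewrite exprn_gt0.
    move=> v vd; have : Num.sqrt (sqn v) <= d / (normR a * opnorm f + 1).
      by rewrite -[leRHS](gtr0_norm dc) -sqrtr_sqr ler_sqrt ?sqr_ge0// ltW.
    rewrite ler_pdivlMr//; have := sqrtr_ge0 (sqn v); nra.
  have [w Ew fw] := Etot (xi f) _ d'0.
  have [F [Ffin FE Fw]] := span_finite Ew.
  have /choice[p pP] : forall g, exists p, is_proj (dom_span F) (xi g) p.
    by move=> g; exact: proj_exists.
  have [y [ya yf y0]] := truncation nondegenerate xi1 eta1 ReE a pP.
  have yS : normR (y f) <= S.
    apply: ub_le_sup => //; exists y => //; split; last exact: le_trans ya a1.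
    exact: supported_sigma_family FE y0.
  have := yf f w Fw; rewrite ler_norml => /andP[+ _].
  by have := d'P _ fw; have := Re_le_normR (y f); lra.
apply/le_anti/andP; split.
  apply: ge_sup => [|_ [y [_ y1] <-]]; last exact: evalf.
  exists (normR ((0 : dual (dual A)) f)), 0 => //=; split; last by rewrite normR0 ler01.
  by have [] := supported_on_subspace M.
have S0 : 0 <= S by have := fS 0; rewrite normR0 linear0; apply; exact: ler01.
apply: opnorm_le_Re => // a.
have [->|a0] := eqVneq a 0; first by rewrite linear0 normR0 mulr0.
have na := normR_gt0 a0.
rewrite -ler_pdivrMr// mulrC -Re_dual_rscale.
have := fS (rscale (normR a)^-1 a); rewrite normR_rscale Re_rscale Re_dual_rscale; apply.
by rewrite gtr0_norm ?invr_gt0// mulVf// gt_eqF.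
Qed.
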